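(* In the model in which both transmitter and receiver harvest energy with finite batteries (see context), the expected competitive ratio $\mathbf{E}[\mathsf{r}]$ of the modified Accumulate&Dump algorithm with parameter $c\ge1$ satisfies $$\mathbf{E}[\mathsf{r}]\le\left(\frac{\mathcal{C}_r+P_rw}{\mathbf{E}[\mathcal{R}_0]}+\frac{\mathcal{C}_t+\mathcal{C}_t/c}{\mathbf{E}[\mathcal{E}_0]}\right)\frac{g\left(\frac{\mathcal{C}_t}{w}\right)}{g\left(\frac{\mathcal{C}_t}{cw}\right)}$$ for any general distributions $f$ and $h$, and $$\mathbf{E}[\mathsf{r}]\le\left(\frac{P_rw}{\mathbf{E}[\mathcal{R}_0]}+\frac{\mathcal{C}_t/c}{\mathbf{E}[\mathcal{E}_0]}+2\right)\frac{g\left(\frac{\mathcal{C}_t}{w}\right)}{g\left(\frac{\mathcal{C}_t}{cw}\right)}$$ when $f$ and $h$ satisfy: $\mathbf{E}[\mathcal{E}_0\mid\mathcal{E}_0\ge\gamma]\le\gamma+\mathbf{E}[\mathcal{E}_0]$ for all $\gamma\in[0,\mathcal{C}_t)$, and $\mathbf{E}[\mathcal{R}_0\mid\mathcal{R}_0\ge\gamma]\le\gamma+\mathbf{E}[\mathcal{R}_0]$ for all $\gamma\in[0,\mathcal{C}_r)$.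
   Context: Model. Time is divided into slots of length $w>0$. At the beginning of slot $i$ ($i=0,1,2,\dots$) an amount $\mathcal{E}_i$ of energy arrives at the transmitter (battery capacity $\mathcal{C}_t>0$) and an amount $\mathcal{R}_i$ arrives at the receiver (battery capacity $\mathcal{C}_r>0$). The $\mathcal{E}_i$ are i.i.d. with density $f$, $f(x)=0$ for $x<0$ and $x>\mathcal{C}_t$; the $\mathcal{R}_i$ are i.i.d. with density $h$, $h(x)=0$ for $x<0$ and $x>\mathcal{C}_r$. The receiver uses a constant power $P_r>0$ when on, and bits are received only when it is on. With transmit power $p$, bits are sent at rate $g(p)$, where $g:[0,\infty)\to[0,\infty)$ is monotonically increasing, $g(0)=0$, $\lim_{p\to\infty}g(p)=\infty$, $g$ is concave, and $g(p)/p$ is convex and monotonically decreasing with limit $0$ as $p\to\infty$. The goal is to transmit $B_0>0$ bits in minimum time. The online algorithm knows the distributions but sees the realizations only causally. Modified Accumulate&Dump, with constant parameter $c\ge1$: wait for $\mathcal{N}$ slots, where $\mathcal{N}=\min\{n:\sum_{i=0}^{n-1}\mathcal{E}_i\ge\mathcal{C}_t/c\ \text{and}\ \sum_{i=0}^{n-1}\mathcal{R}_i\ge P_rw\}$; in the $\mathcal{N}$-th slot the transmitter uses all its accumulated energy at a constant rate and the receiver is on. Then the system is reset and the procedure is repeated afresh with the subsequent arrivals, until $B_0$ bits have been transmitted. The expected competitive ratio is $\mathbf{E}[\mathsf{r}]=\mathbf{E}[\mathcal{S}_{on}/\mathcal{S}_{\mathrm{off}}]$, where $\mathcal{S}_{on}$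 is the number of slots taken by the modified Accumulate&Dump algorithm to transmit $B_0$ bits and $\mathcal{S}_{\mathrm{off}}$ is the number of slots taken by an optimal offline algorithm (knowing all arrivals in advance, under the same battery and receiver constraints). *)

(* Defs.v *)
From HB Require Import structures.
From mathcomp Require Import all_boot all_order all_algebra.
From mathcomp Require Import all_classical all_reals all_analysis.

Set Implicit Arguments.
Unset Strict Implicit.
Unset Printing Implicit Defensive.

Import Order.TTheory GRing.Theory Num.Theory.
Import numFieldNormedType.Exports.

Local Open Scope classical_set_scope.
Local Open Scope ring_scope.

Section RateFunction.
Context {R : realType}.

(* [g] is only meaningful on [0, +oo[; nothing is assumed about its values at
   negative arguments.  Concavity of [g] is convexity of [- g]. *)
Record rate_function (g : R -> R) : Prop := RateFunction {
  rate_ge0 : forall p, 0 <= p -> 0 <= g p ;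
  rate_at0 : g 0 = 0 ;
  rate_nondecreasing : forall p q, 0 <= p -> p <= q -> g p <= g q ;
  rate_unbounded : g p @[p --> +oo] --> +oo ;
  rate_concave : convex_function (`[0, +oo[%classic : set R) (fun p => - g p) ;
  rate_per_power_convex :
    convex_function (`]0, +oo[%classic : set R) (fun p => g p / p) ;
  rate_per_power_nonincreasing :
    forall p q, 0 < p -> p <= q -> g q / q <= g p / p ;
  rate_per_power_cvg0 : g p / p @[p --> +oo] --> 0 }.

End RateFunction.

Section Arrivals.
Context {R : realType} {d : measure_display} {T : measurableType d}.
Variable P : probability T R.

Record density_on (C : R) (f : R -> R) : Prop := DensityOn {
  density_measurable : measurable_fun setT f ;
  density_ge0 : forall x, 0 <= f x ;
  density_support : forall x, x < 0 \/ C < x -> f x = 0 }.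

Definition has_density (X : T -> R) (f : R -> R) : Prop :=
  forall A : set R, measurable A ->
    P (X @^-1` A) = (\int[lebesgue_measure]_(x in A) (f x)%:E)%E.

Definition mutually_independent (I : eqType) (X : I -> T -> R) : Prop :=
  forall (s : seq I) (A : I -> set R),
    uniq s -> (forall i, measurable (A i)) ->
    P (\bigcap_(i in [set` s]) (X i @^-1` A i)) =
    (\prod_(i <- s) P (X i @^-1` A i))%E.

(* The two arrival processes as a single family: the independence of this
   family says that each process is independent in time and that the two
   processes are independent of each other. *)
Definition joint_family (E Rv : nat -> T -> R) (i : nat + nat) : T -> R :=
  match i with inl j => E j | inr j => Rv j end.

Definition mean (X : T -> R) : R := fine 'E_P[X].

Definition cond_mean (X : T -> R) (A : set T) : R :=
  (\int[P]_(om in A) X om) / fine (P A).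

(* E[X | X >= gamma] <= gamma + E[X]; levels that are reached with probability
   zero, where the conditional expectation is undefined, are left out. *)
Definition bounded_mean_residual (X : T -> R) (C : R) : Prop :=
  forall gamma, 0 <= gamma -> gamma < C ->
    (0 < P [set om | (gamma <= X om)%R])%E ->
    cond_mean X [set om | gamma <= X om] <= gamma + mean X.

End Arrivals.

Section Slots.
Context {R : realType}.

(* Energy stored just after the arrival of slot [i] in a battery of capacity
   [C] that is empty before slot 0, where [arr j] arrives at the beginning of
   slot [j] and [use j] is drawn during slot [j]. *)
Fixpoint battery (C : R) (arr use : nat -> R) (i : nat) : R :=
  match i with
  | 0%N => Num.min C (arr 0%N)
  | j.+1 => Num.min C (battery C arr use j - use j + arr j.+1)
  end.

(* Number of slots needed to reach a goal, [Q n] meaning that it is reached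
   within [n] slots; it is +oo when the goal is never reached. *)
Definition slots_needed (Q : set nat) : \bar R :=
  ereal_inf [set (n%:R)%:E | n in Q].

Definition slot (w : R) (i : nat) : set R :=
  `[i%:R * w, i.+1%:R * w[%classic.

(* A path of arrivals [e] (transmitter) and [r] (receiver).  Offline, the
   transmit power [p] is any nonnegative function of continuous time and the
   receiver is on during an arbitrary measurable set [on] of times, chosen with
   full knowledge of [e] and [r].  All energy arrives at the beginning of a
   slot, so energy causality amounts to not drawing, over a slot, more than is
   stored at its beginning. *)
Definition offline_transmits (w Ct Cr Pr : R) (g : R -> R) (B0 : R)
    (e r : nat -> R) (n : nat) : Prop :=
  exists (p : R -> R) (on : set R) (u v : nat -> R),
    [/\ measurable_fun setT p /\ measurable on,
        forall t, 0 <= p t,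
        forall i, (i < n)%N ->
          (\int[lebesgue_measure]_(t in slot w i) (p t)%:E)%E = (u i)%:E /\
          u i <= battery Ct e u i,
        forall i, (i < n)%N ->
          (Pr%:E * lebesgue_measure (on `&` slot w i))%E = (v i)%:E /\
          v i <= battery Cr r v i
      & (B0%:E <=
         \int[lebesgue_measure]_(t in on `&` `[0%R, (n%:R * w)%R[) (g (p t))%:E)%E].

Definition offline_slots (w Ct Cr Pr : R) (g : R -> R) (B0 : R)
    (e r : nat -> R) : \bar R :=
  slots_needed [set n | offline_transmits w Ct Cr Pr g B0 e r n].

(* Slots s, ..., t - 1 are those elapsed since a reset at the beginning of
   slot s. *)
Definition threshold_met (w Ct Pr c : R) (e r : nat -> R) (s t : nat) : Prop :=
  Ct / c <= \sum_(s <= i < t) e i /\ Pr * w <= \sum_(s <= i < t) r i.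

(* A round starting with slot s ends with slot t - 1; its length is t - s. *)
Definition is_round (w Ct Pr c : R) (e r : nat -> R) (s t : nat) : Prop :=
  [/\ (s <= t)%N, threshold_met w Ct Pr c e r s t
    & forall t', (s <= t' < t)%N -> ~ threshold_met w Ct Pr c e r s t'].

(* All the energy accumulated since the reset is spent at constant power in
   the last slot of the round. *)
Definition round_bits (w Ct : R) (g : R -> R) (e : nat -> R) (s t : nat) : R :=
  w * g (battery Ct (fun i => e (s + i)%N) (fun=> 0) (t - s).-1 / w).

Definition online_transmits (w Ct Pr c : R) (g : R -> R) (B0 : R)
    (e r : nat -> R) (n : nat) : Prop :=
  exists (K : nat) (reset : nat -> nat),
    [/\ reset 0%N = 0%N,
        reset K = n,
        forall j, (j < K)%N -> is_round w Ct Pr c e r (reset j) (reset j.+1)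
      & B0 <= \sum_(j < K) round_bits w Ct g e (reset j) (reset j.+1)].

Definition online_slots (w Ct Pr c : R) (g : R -> R) (B0 : R)
    (e r : nat -> R) : \bar R :=
  slots_needed [set n | online_transmits w Ct Pr c g B0 e r n].

End Slots.

Definition expected_ratio (R : realType) (d : measure_display)
    (T : measurableType d) (P : probability T R) (w Ct Cr Pr c : R)
    (g : R -> R) (B0 : R) (E Rv : nat -> T -> R) : \bar R :=
  (\int[P]_om (online_slots w Ct Pr c g B0 (E ^~ om) (Rv ^~ om)
               / offline_slots w Ct Cr Pr g B0 (E ^~ om) (Rv ^~ om)))%E.

(* Main.v *)
(* Let G and L be the bits sent by a dump of Ct and of Ct / c, and let M be the least
   integer >= B0 / G. By Jensen's inequality for g, made pathwise by a supporting line,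
   no offline schedule finishes before slot M. The online schedule is compared with
   slot M by cases on what the first M slots brought; since a run started later ends
   later, its rounds may be restarted afresh at slot M at the price of a mean round.
   If the thresholds were met by M, one round is already done and the remaining ones,
   at most (G / L) M of them, suffice. If the transmitter got less than Ct / c, or if
   its energy cannot carry B0 bits while the receiver can afford at most one slot,
   then offline needs M + 1 slots, which pays for rounding up. If the receiver alone
   is late and a single dump of the stored energy suffices, its residual wait remains.
   The delicate case is a late receiver with B0 bits worth several dumps. After the
   first dump, which is full, the number of rounds is counted as if all dumps were
   full, with one spare round if one is not. The mean excess of a round over the
   receiver's passage time, together with the probability of a dump that is not full,
   is controlled by the passage of the transmitter to Ct, because the receiver's
   waiting time is new better than used. Markov's inequality bounds the probability
   of this case, and concavity of g relates B0 - G to G - L.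
   The mean passage times themselves are given by Wald's identity, with overshoot at
   most the capacity in general and at most one mean under the residual condition. *)
Require Import Defs.
From HB Require Import structures.
From mathcomp Require Import all_boot all_order all_algebra.
From mathcomp Require Import all_classical all_reals all_analysis.
From mathcomp Require Import measurable_realfun ring lra.

Set Implicit Arguments.
Unset Strict Implicit.
Unset Printing Implicit Defensive.

Import Order.TTheory GRing.Theory Num.Theory.
Import numFieldNormedType.Exports.

Local Open Scope classical_set_scope.
Local Open Scope ring_scope.

(** In every case but the delicate one the time beyond slot M, divided by the offline bound, has
    mean at most rho * N, where rho = G / L and N = N2 + X is the mean round, N2 the receiver's mean
    passage and X the excess. As rh > 0, nothing is met at slot count 0, so X + 1 <= b, the bound on
    the passage to Ct / c; this absorbs the leading 1, since 1 + rho * N <= rho * (N2 + b). The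
    obstacle is rounding. In the delicate case offline may finish at M, whereas a dump of G followed
    by k + 1 threshold dumps, k + 1 being the ceiling of rho * (y - 1) with y = B0 / G, may be more
    than rho * M rounds. But then M <= k + 1, so k + 1 full dumps suffice and the extra round is
    owed only if one is not full. With q the chance of such a dump, q * N2 + X + 1 <= tau moves this
    debt to the passage to Ct, whose bound exceeds b by (1 - 1/c) * Ct / E[E_0]. Markov's inequality
    cancels the factor Ct / E[E_0], concavity the factor 1 - 1/c. Independence enters only as
    invariance of the path law under gluing two copies; stopping times are handled by summing over
    their values. *)

(** * The measurable space of arrival paths *)

Section PathSpace.
Context {R : realType}.

(* Sample paths: coordinate [inl i] is the arrival of slot [i] at the transmitter,
   [inr i] the one at the receiver. *)
Definition cylinders : set (set (nat + nat -> R)) :=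
  [set C | exists (s : seq (nat + nat)) (A : nat + nat -> set R),
    (forall i, measurable (A i)) /\
    C = [set om | forall i, i \in s -> A i (om i)]].

Definition path := g_sigma_algebraType cylinders.

Lemma cylinders_setI : setI_closed cylinders.
Proof.
move=> _ _ [s [A [mA ->]]] [t [B [mB ->]]].
exists (s ++ t), (fun i => (if i \in s then A i else setT) `&`
                            (if i \in t then B i else setT)); split.
  by move=> i; apply: measurableI; case: ifP => // _; exact: measurableT.
apply/seteqP; split=> om /=.
  move=> [sA tB] i _; split; case: ifPn => // ?; [exact: sA|exact: tB].
move=> h; split=> i ii; have := h i; rewrite mem_cat ii ?orbT => /(_ isT) [].
  by [].
by move=> _; exact.
Qed.

Lemma measurable_coord (i : nat + nat) : measurable_fun setT (fun om : path => om i).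
Proof.
move=> _ B mB; rewrite setTI; apply: sub_sigma_algebra.
exists [:: i], (fun=> B); split => //; apply/seteqP; split=> om /=.
  by move=> Bi j; rewrite inE => /eqP ->.
by apply; rewrite inE.
Qed.

Lemma measurable_fun_path d (T : measurableType d) (X : T -> path) :
  (forall i, measurable_fun setT (fun x => X x i)) -> measurable_fun setT X.
Proof.
move=> mX; have mE : @measurable _ path = <<s cylinders >> by [].
apply: (measurability _ mE).
move=> _ [_ [s [A [mA ->]]] <-].
rewrite setTI (_ : _ @^-1` _ = \big[setI/setT]_(i <- s) ((fun x => X x i) @^-1` A i)).
  apply: bigsetI_measurable => i _; rewrite -[_ @^-1` _]setTI; exact: mX.
apply/seteqP; split=> x /=.
  by rewrite -bigcap_seq => h i /h.
by rewrite -bigcap_seq => h i /h.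
Qed.

Lemma path_measure_unique (m1 m2 : {measure set path -> \bar R}) :
  (m1 setT < +oo)%E ->
  (forall C, cylinders C -> m1 C = m2 C) ->
  forall A, measurable A -> m1 A = m2 A.
Proof.
move=> m1oo m12; have mE : @measurable _ path = <<s cylinders >> by [].
move=> A; apply: (@measure_unique _ R path cylinders (fun=> setT) mE) => //.
- exact: cylinders_setI.
- move=> _; exists [::], (fun=> setT); split => //.
  by apply/seteqP; split.
- by apply/seteqP; split => // x _; exists 0%N.
Qed.

End PathSpace.
Arguments path : clear implicits.

Definition reindex_path {R : realType} (D : pred (nat + nat)) (al : nat + nat -> nat + nat)
    (om : path R * path R) : path R :=
  fun i => if D i then om.1 (al i) else om.2 (al i).

Lemma measurable_reindex_path {R : realType} D al :
  measurable_fun setT (@reindex_path R D al).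
Proof.
apply: measurable_fun_path => i; rewrite /reindex_path; case: (D i).
  exact: (measurableT_comp (measurable_coord _) measurable_fst).
exact: (measurableT_comp (measurable_coord _) measurable_snd).
Qed.

(** * The law of the arrivals and its invariance under gluing *)

Section Law.
Context {R : realType} {d : measure_display} {T : measurableType d}.
Variables (P : probability T R) (X : nat + nat -> {mfun T >-> R}).

Definition trajectory (om : T) : path R := fun i => X i om.

Lemma measurable_trajectory : measurable_fun setT trajectory.
Proof. by apply: measurable_fun_path => i; exact: measurable_funPT. Qed.

HB.instance Definition _ :=
  isMeasurableFun.Build _ _ _ _ trajectory measurable_trajectory.

Definition law : probability (path R) R := distribution P trajectory.

Arguments law : simpl never.

Hypothesis indep : mutually_independent P (X : nat + nat -> T -> R).

Lemma mutually_independent_reindex (al : nat + nat -> nat + nat) (s : seq (nat + nat))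
    (A : nat + nat -> set R) :
  uniq s -> {in s &, injective al} -> (forall i, measurable (A i)) ->
  P [set om | forall i, i \in s -> A i (X (al i) om)] =
  (\prod_(i <- s) P (X (al i) @^-1` A i))%E.
Proof.
move=> us ial mA.
(* [al] is injective only on [s], so its inverse there is read off from positions in the list. *)
pose A' j := A (nth (inl 0%N) s (index j (map al s))).
have A'E i : i \in s -> A' (al i) = A i.
  move=> si; rewrite /A'; congr (A _).
  have hi : (index (al i) [seq al i | i <- s] < size s)%N.
    by rewrite -(size_map al) index_mem map_f.
  apply: ial => //; first exact: mem_nth.
  by rewrite -(nth_map _ (inl 0%N)) // nth_index // map_f.
have uals : uniq (map al s) by rewrite map_inj_in_uniq.
have := indep uals (fun j => mA _ : measurable (A' j)).
rewrite big_map => h.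
transitivity (P (\bigcap_(i in [set` [seq al i | i <- s]]) X i @^-1` A' i)).
  congr (P _); apply/seteqP; split => om /=.
    by move=> h1 j /= /mapP[i si ->]; rewrite /= A'E//; exact: h1.
  move=> h1 i si; have := h1 (al i); rewrite /= A'E// => /(_ _); apply.
  exact: map_f.
rewrite h big_seq [RHS]big_seq; apply: eq_bigr => i si.
by rewrite A'E.
Qed.

(* Two independent copies of the path may be glued along any injective reindexing.
   Gluing the slots before [n] of one copy to the restarted other copy gives
   renewal; gluing the left half of one to the right half of the other gives the
   independence of transmitter and receiver. *)
Lemma law_reindex (D : pred (nat + nat)) (al : nat + nat -> nat + nat) :
  {in D &, injective al} -> {in predC D &, injective al} ->
  (forall i A, measurable A -> P (X (al i) @^-1` A) = P (X i @^-1` A)) ->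
  forall A, measurable A -> (law \x law)%E (reindex_path D al @^-1` A) = law A.
Proof.
move=> iD iDc alE.
pose mfr : {mfun _ >-> _} := HB.pack (@reindex_path R D al)
  (isMeasurableFun.Build _ _ _ _ (@reindex_path R D al) (measurable_reindex_path D al)).
move=> A mA.
rewrite -[LHS]/(pushforward (law \x law)%E mfr A).
apply/esym; apply: path_measure_unique => //.
  by rewrite [X in (X < _)%E](_ : _ = 1%E) ?ltry//; exact: (@probability_setT _ _ _ law).
move=> _ [s [B [mB ->]]]; apply/esym.
have cylm (u : seq (nat + nat)) :
    measurable ([set om | forall i, i \in u -> B i (om (al i))] : set (path R)).
  rewrite (_ : mkset _ =
    \big[setI/setT]_(i <- u) ((fun om : path R => om (al i)) @^-1` B i)); last first.
    by rewrite -bigcap_seq; apply/seteqP; split=> om /= h i /h.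
  by apply: bigsetI_measurable => i _; rewrite -[_ @^-1` _]setTI; exact: measurable_coord.
pose s1 := [seq i <- undup s | D i]; pose s2 := [seq i <- undup s | ~~ D i].
pose S1 := [set om : path R | forall i, i \in s1 -> B i (om (al i))].
pose S2 := [set om : path R | forall i, i \in s2 -> B i (om (al i))].
transitivity ((law \x law)%E (S1 `*` S2)).
  rewrite -[LHS]/((law \x law)%E (reindex_path D al @^-1`
    [set om | forall i, i \in s -> B i (om i)])); congr (_ _).
  apply/seteqP; split => -[om1 om2]; rewrite /= /reindex_path/=.
    move=> h; split => i; rewrite mem_filter mem_undup /= => /andP[Di si];
      have := h _ si; first by rewrite Di.
    by rewrite (negbTE Di).
  move=> [h1 h2] i si; case: ifPn => Di.
    by apply: h1; rewrite mem_filter mem_undup Di.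
  by apply: h2; rewrite mem_filter mem_undup /= Di.
transitivity (law S1 * law S2)%E.
  by apply: (@product_measure1E _ _ _ _ _ law law); exact: cylm.
have u1 : uniq s1 by rewrite filter_uniq ?undup_uniq.
have u2 : uniq s2 by rewrite filter_uniq ?undup_uniq.
have E1 : law S1 =
    (\prod_(i <- s1) P (X i @^-1` B i))%E.
  rewrite -[LHS]/(P [set om | forall i, i \in s1 -> B i (X (al i) om)]).
  rewrite mutually_independent_reindex//; first by apply: eq_bigr => i _; rewrite alE.
  by move=> i j; rewrite !mem_filter => /andP[Di _] /andP[Dj _]; exact: iD.
have E2 : law S2 =
    (\prod_(i <- s2) P (X i @^-1` B i))%E.
  rewrite -[LHS]/(P [set om | forall i, i \in s2 -> B i (X (al i) om)]).
  rewrite mutually_independent_reindex//; first by apply: eq_bigr => i _; rewrite alE.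
  by move=> i j; rewrite !mem_filter => /andP[Di _] /andP[Dj _]; exact: iDc.
have E : law [set om : path R | forall i, i \in s -> B i (om i)] =
    (\prod_(i <- undup s) P (X i @^-1` B i))%E.
  rewrite -[LHS]/(P [set om | forall i, i \in s -> B i (X i om)]).
  rewrite (_ : mkset _ = [set om | forall i, i \in undup s -> B i (X (id i) om)]).
    by rewrite mutually_independent_reindex// undup_uniq.
  by apply/seteqP; split => om /= h i; have := h i; rewrite mem_undup.
apply: etrans (esym E); rewrite E1 E2 !big_filter [in RHS](bigID D).
exact: erefl.
Qed.

End Law.

(** * Shifts of paths and the renewal property *)

Definition time (i : nat + nat) : nat := match i with inl n => n | inr n => n end.

Definition delay (n : nat) (i : nat + nat) : nat + nat :=
  match i with inl j => inl (n + j)%N | inr j => inr (n + j)%N end.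

Definition shift {R : realType} (n : nat) (om : path R) : path R :=
  fun i => om (delay n i).

Lemma measurable_shift {R : realType} n : measurable_fun setT (@shift R n).
Proof. by apply: measurable_fun_path => i; exact: measurable_coord. Qed.

Lemma shiftD {R : realType} m n (om : path R) : shift n (shift m om) = shift (m + n) om.
Proof. by apply/funext => -[i|i]; rewrite /shift /= addnA. Qed.

Lemma shift0 {R : realType} (om : path R) : shift 0 om = om.
Proof. by apply/funext => -[]. Qed.

(** Takes the place of a filtration: the event is decided by the slots before [n], its measurability
    being a separate requirement. *)
Definition adapted {R : realType} (n : nat) (A : set (path R)) :=
  forall om om' : path R, (forall i, (time i < n)%N -> om i = om' i) -> A om -> A om'.

Definition before (n : nat) : pred (nat + nat) := fun i => (time i < n)%N.

(** Together with [before n], this keeps the slots before [n] of the first path and makes slot j of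
    the second path slot n + j of the glued one, so that [shift n] recovers the second path
    exactly. *)
Definition past_future (n : nat) (i : nat + nat) : nat + nat :=
  if before n i then i else
  match i with inl j => inl (j - n)%N | inr j => inr (j - n)%N end.

Definition is_left (i : nat + nat) : bool := if i is inl _ then true else false.

Section Renewal.
Local Open Scope ereal_scope.
Context {R : realType}.
Variable nu : probability (path R) R.

Definition reindex_invariant D al :=
  forall A, measurable A -> (nu \x nu) (@reindex_path R D al @^-1` A) = nu A.

Lemma integral_reindex D al (F : path R -> \bar R) : reindex_invariant D al ->
  measurable_fun [set: path R] F -> (forall om, 0 <= F om) ->
  \int[nu]_om F om =
  \int[nu]_om1 \int[nu]_om2 F (reindex_path D al (om1, om2)).
Proof.
move=> inv mF F0.
have mr := @measurable_reindex_path R D al.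
transitivity (\int[pushforward (nu \x nu) (reindex_path D al)]_om F om).
  apply: eq_measure_integral => A mA _; exact/esym/inv.
rewrite ge0_integral_pushforward// preimage_setT.
rewrite fubini_tonelli1//; first exact: measurableT_comp.
by move=> x; exact: F0.
Qed.

Hypothesis inv_past : forall n, reindex_invariant (before n) (past_future n).

Lemma shift_reindex n (om1 om2 : path R) :
  shift n (reindex_path (before n) (past_future n) (om1, om2)) = om2.
Proof.
apply/funext => -[i|i]; rewrite /shift /reindex_path /past_future /before /=;
  by rewrite ltnNge leq_addr /= addKn.
Qed.

(** On the glued path the indicator sees only the first copy and the shifted functional only the
    second, so Tonelli separates them. Applied for each value [n] of a stopping time and summed, it
    replaces the strong Markov property. *)
Lemma renewal n (A : set (path R)) (Psi : path R -> \bar R) :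
  measurable A -> adapted n A -> measurable_fun [set: path R] Psi -> (forall om, 0 <= Psi om) ->
  \int[nu]_om ((\1_A om)%:E * Psi (shift n om)) = nu A * \int[nu]_om Psi om.
Proof.
move=> mA adA mPsi Psi0.
have m1A : measurable_fun setT (fun om : path R => (\1_A om)%:E : \bar R).
  by apply/measurable_EFinP; exact: measurable_indic.
rewrite (integral_reindex (inv_past n)); last 2 first.
- apply: emeasurable_funM => //.
  exact: (measurableT_comp mPsi (measurable_shift n)).
- by move=> om; apply: mule_ge0; [rewrite lee_fin|exact: Psi0].
have Aeq om1 om2 : A (reindex_path (before n) (past_future n) (om1, om2)) = A om1.
  apply/propext; split; apply: adA => i ti; rewrite /reindex_path /past_future /before;
  by rewrite ti.
transitivity (\int[nu]_om1 ((\1_A om1)%:E * \int[nu]_om2 Psi om2)).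
  apply: eq_integral => om1 _.
  rewrite -ge0_integralZl//.
  apply: eq_integral => om2 _; rewrite shift_reindex.
  congr (_%:E * _); rewrite !indicE.
  suff -> : (reindex_path (before n) (past_future n) (om1, om2) \in A) = (om1 \in A) by [].
  by apply/idP/idP; rewrite !inE Aeq.
rewrite ge0_integralZr//; last exact: integral_ge0.
  by rewrite integral_indic// setIT.
Qed.

Lemma integral_shift n (Psi : path R -> \bar R) :
  measurable_fun [set: path R] Psi -> (forall om, 0 <= Psi om) ->
  \int[nu]_om Psi (shift n om) = \int[nu]_om Psi om.
Proof.
move=> mPsi Psi0; have := @renewal n setT _ measurableT _ mPsi Psi0.
rewrite probability_setT mul1e => <- //.
by apply: eq_integral => om _; rewrite indicE in_setT mul1e.
Qed.

Lemma probability_renewal n (A B : set (path R)) : measurable A -> adapted n A ->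
  measurable B -> nu (A `&` shift n @^-1` B) = nu A * nu B.
Proof.
move=> mA adA mB.
have mS : measurable (@shift R n @^-1` B).
  by rewrite -[_ @^-1` _]setTI; exact: measurable_shift.
have := @renewal n A (fun om => (\1_B om)%:E) mA adA.
rewrite [X in _ = _ * X]integral_indic// setIT => <-//.
  rewrite -[X in nu X]setIT -integral_indic//; last exact: measurableI.
  by apply: eq_integral => om _; rewrite indicI.
by apply/measurable_EFinP; exact: measurable_indic.
Qed.

End Renewal.

Lemma nneseries_le_ub {R : realType} (u : nat -> \bar R) (x : \bar R) :
  (forall n, 0 <= u n)%E -> (forall N, (\sum_(i < N) u i <= x)%E) ->
  (\sum_(i <oo) u i <= x)%E.
Proof.
move=> u0 ux; apply: lime_le; first by apply: is_cvg_nneseries => n _ _.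
by apply: nearW => N; rewrite big_mkord.
Qed.

Lemma nneseries_ge_term {R : realType} (u : nat -> \bar R) n :
  (forall n, 0 <= u n)%E -> (u n <= \sum_(i <oo) u i)%E.
Proof.
move=> u0; apply: (le_trans _ (nneseries_lim_ge n.+1 _)) => //.
by rewrite big_nat_recr//= leeDr// sume_ge0.
Qed.

(** * Passage times of a walk and Wald's identity *)

Section Walk.
Context {R : realType}.
Variable inc : path R -> R.

Definition walk (n : nat) (om : path R) : R := \sum_(i < n) inc (shift i om).

Lemma walkD m n om : walk (m + n) om = walk m om + walk n (shift m om).
Proof.
rewrite /walk big_split_ord; congr (_ + _).
by apply: eq_bigr => i _; rewrite shiftD.
Qed.

Lemma walk0 om : walk 0 om = 0. Proof. by rewrite /walk big_ord0. Qed.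

Lemma walkS n om : walk n.+1 om = walk n om + inc (shift n om).
Proof. by rewrite /walk big_ord_recr. Qed.

Lemma walkSl n om : walk n.+1 om = inc om + walk n (shift 1 om).
Proof. by rewrite -add1n walkD walkS walk0 add0r shift0. Qed.

Hypothesis minc : measurable_fun [set: path R] inc.
Hypothesis inc_local : forall om om' : path R,
  (forall i, (time i < 1)%N -> om i = om' i) -> inc om = inc om'.
Hypothesis inc_ge0 : forall om, 0 <= inc om.

Lemma measurable_walk n : measurable_fun [set: path R] (walk n).
Proof.
apply: measurable_sum => i; exact: (measurableT_comp minc (measurable_shift i)).
Qed.

Lemma walk_local n om om' : (forall i, (time i < n)%N -> om i = om' i) ->
  walk n om = walk n om'.
Proof.
move=> h; apply: eq_bigr => i _; apply: inc_local => j; rewrite ltnS leqn0 => /eqP j0.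
apply: h; case: j j0 => j /= ->; by rewrite addn0.
Qed.

Lemma walk_ge0 n om : 0 <= walk n om.
Proof. by apply: sumr_ge0. Qed.

Lemma walk_nondecreasing m n om : (m <= n)%N -> walk m om <= walk n om.
Proof. by move=> mn; rewrite -(subnKC mn) walkD lerDl walk_ge0. Qed.

Definition below (th : R) n : set (path R) := [set om | walk n om < th].

Lemma measurable_below th n : measurable (below th n).
Proof.
rewrite /below -[mkset _]setTI.
exact: (measurable_fun_ltr (measurable_walk n) (measurable_cst th)) measurableT [set true] _.
Qed.

Lemma adapted_below th n : adapted n (below th n).
Proof. by move=> om om' h; rewrite /below/= (walk_local h). Qed.

Variable nu : probability (path R) R.
Hypothesis inv_past : forall n, reindex_invariant nu (before n) (past_future n).

(* Mean of the first [n] with [th <= walk n], as the sum of its tails. *)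
Definition passage (th : R) : \bar R := (\sum_(n <oo) nu (below th n))%E.

Local Open Scope ereal_scope.

(** The walk frozen once it reaches [th], cut off after [N] increments so that its mean is finite
    before the passage time is known to be. *)
Definition stopped th N om : R :=
  (\sum_(i < N) (walk i om < th)%R%:R * inc (shift i om))%R.

Lemma measurable_stopped th N : measurable_fun [set: path R] (stopped th N).
Proof.
apply: measurable_sum => i; apply: measurable_funM.
  rewrite (_ : (fun _ => _) = \1_(below th i)).
    exact: measurable_indic (measurable_below th i).
  apply/funext => om; rewrite indicE; congr (_ %:R)%R.
  suff -> : (om \in below th i) = (walk i om < th)%R by [].
  by apply/idP/idP; rewrite inE.
exact: (measurableT_comp minc (measurable_shift i)).
Qed.

(** Wald's identity: whether increment i is counted depends on the slots before i only, hence is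
    independent of that increment. *)
Lemma integral_stopped th N : \int[nu]_om (stopped th N om)%:E =
  (\sum_(i < N) nu (below th i)) * \int[nu]_om (inc om)%:E.
Proof.
rewrite ge0_sume_distrl//.
under eq_integral => om _ do rewrite /stopped -sumEFin.
rewrite ge0_integral_sum//.
- apply: eq_bigr => i _.
  rewrite -(renewal inv_past (measurable_below th i) (@adapted_below th i))//.
  + apply: eq_integral => om _; rewrite EFinM; congr (_%:E * _).
    rewrite indicE; suff -> : (om \in below th i) = (walk i om < th)%R by [].
    by apply/idP/idP; rewrite inE.
  + exact/measurable_EFinP.
- move=> i; apply/measurable_EFinP; apply: measurable_funM.
  rewrite (_ : (fun _ => _) = \1_(below th i)).
    exact: measurable_indic (measurable_below th i).
  apply/funext => om; rewrite indicE.
    suff -> : (om \in below th i) = (walk i om < th)%R by [].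
    by apply/idP/idP; rewrite inE.
  exact: (measurableT_comp minc (measurable_shift i)).
- by move=> i om _; rewrite lee_fin mulr_ge0.
Qed.

Lemma passage_ge0 th : 0 <= passage th.
Proof. by apply: nneseries_ge0 => n _ _. Qed.

Lemma passage_le th (m b : R) : (0 < m)%R -> \int[nu]_om (inc om)%:E = m%:E ->
  (forall N, \int[nu]_om (stopped th N om)%:E <= b%:E) ->
  passage th <= (b / m)%:E.
Proof.
move=> m0 mE h; apply: nneseries_le_ub => // N.
have := h N; rewrite integral_stopped mE.
by rewrite -lee_pdivlMr// -EFinM.
Qed.

Lemma stopped_le_walk th N om : (stopped th N om <= walk N om)%R.
Proof.
apply: ler_sum => i _; case: (_ < _)%R; rewrite ?mul1r ?mul0r//.
Qed.

(** An increment is counted only when the walk before it is below [th], so the overshoot is at most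
    one increment. *)
Lemma stopped_le th C N om : (0 <= th)%R -> (0 <= C)%R -> (forall om, inc om <= C)%R ->
  (stopped th N om <= th + C)%R.
Proof.
move=> th0 C0 incC; elim: N => [|N IH]; first by rewrite /stopped big_ord0 addr_ge0.
rewrite /stopped big_ord_recr/= -/(stopped th N om).
case: ltP => [Sth|_]; last by rewrite mul0r addr0.
by rewrite mul1r lerD// (le_trans (stopped_le_walk _ _ _))// ltW.
Qed.

Lemma passage_le_bounded th C m : (0 <= th)%R -> (0 <= C)%R -> (0 < m)%R ->
  (forall om, inc om <= C)%R -> \int[nu]_om (inc om)%:E = m%:E ->
  passage th <= ((th + C) / m)%:E.
Proof.
move=> th0 C0 m0 incC mE; apply: passage_le => // N.
rewrite -[leRHS]mule1 -(@probability_setT _ _ _ nu) -integral_cst//.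
apply: ge0_le_integral => //.
- by move=> om _; rewrite lee_fin sumr_ge0// => i _; rewrite mulr_ge0.
- by apply/measurable_EFinP; exact: measurable_stopped.
- by move=> om _; rewrite lee_fin; exact: stopped_le.
Qed.

End Walk.

(* The competitive ratio is not known to be measurable; monotonicity survives since
   the integral of a nonnegative function is a supremum over simple functions below it. *)
Lemma ge0_le_integral_nonmeasurable d (T : measurableType d) (R : realType)
    (mu : {measure set T -> \bar R}) (f1 f2 : T -> \bar R) :
  (forall x, 0 <= f1 x)%E -> (forall x, f1 x <= f2 x)%E ->
  (\int[mu]_x f1 x <= \int[mu]_x f2 x)%E.
Proof.
move=> f10 f12; have f20 x : (0 <= f2 x)%E by exact: le_trans (f12 x).
rewrite !ge0_integralTE//; apply: ereal_sup_le => _ [h hf <-] /=.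
by exists h => //= x; apply: le_trans (f12 x); exact: hf.
Qed.

(** * Overshoot under the residual condition *)

Section Residual.
Local Open Scope ereal_scope.
Context {R : realType}.
Variables (inc : path R -> R) (nu : probability (path R) R) (m : R).
Hypothesis minc : measurable_fun [set: path R] inc.
Hypothesis inc_local : forall om om' : path R,
  (forall i, (time i < 1)%N -> om i = om' i) -> inc om = inc om'.
Hypothesis inc_ge0 : forall om, (0 <= inc om)%R.
Hypothesis inv_past : forall n, reindex_invariant nu (before n) (past_future n).
Hypothesis m_ge0 : (0 <= m)%R.
Hypothesis mean_residual : forall gamma : R, (0 < gamma)%R ->
  \int[nu]_(om in [set om | (gamma <= inc om)%R]) (inc om)%:E <=
  (gamma + m)%:E * nu [set om | (gamma <= inc om)%R].

Lemma stopped0 th N om : (th <= 0)%R -> stopped inc th N om = 0%R.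
Proof.
move=> th0; apply: big1 => i _; rewrite ltNge (le_trans th0) ?mul0r//.
exact: walk_ge0.
Qed.

Lemma stoppedSl th N om : (0 < th)%R ->
  stopped inc th N.+1 om = (inc om + stopped inc (th - inc om) N (shift 1 om))%R.
Proof.
move=> th0; rewrite /stopped big_ord_recl/= walk0 th0 mul1r shift0; congr (_ + _)%R.
apply: eq_bigr => i _; rewrite shiftD -add1n; congr ((_ : bool)%:R * _)%R.
by rewrite add1n walkSl ltrBrDl.
Qed.

(** Induction on [N] for all levels at once, with the first increment x isolated by gluing at slot
    1. If x >= th nothing more is counted and the residual condition at level [th] pays for x;
    otherwise the walk restarts towards th - x, and x + (th - x + m) is again th + m. *)
Lemma integral_stopped_residual (th : R) N : (0 < th)%R ->
  \int[nu]_om (stopped inc th N om)%:E <= (th + m)%:E.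
Proof.
elim: N th => [th th0|N IH th th0].
  under eq_integral do rewrite /stopped big_ord0.
  by rewrite integral0 lee_fin addr_ge0// ltW.
have mS := measurable_stopped minc.
have mge g : measurable ([set om : path R | (g <= inc om)%R]).
  rewrite -[mkset _]setTI.
  exact: (measurable_fun_ler (measurable_cst g) minc) measurableT [set true] _.
rewrite (integral_reindex (inv_past 1)); last 2 first.
- by apply/measurable_EFinP; exact: mS.
- by move=> om; rewrite lee_fin sumr_ge0// => i _; rewrite mulr_ge0.
set H := [set om : path R | (th <= inc om)%R].
have mH : measurable H by exact: mge.
apply: (@le_trans _ _ (\int[nu]_om ((inc om)%:E * (\1_H om)%:E +
    (th + m)%:E * (\1_(~` H) om)%:E))).
  apply: ge0_le_integral_nonmeasurable => om1.
    apply: integral_ge0 => om2 _; rewrite lee_fin sumr_ge0// => i _; rewrite mulr_ge0//.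
  have E om2 : (stopped inc th N.+1 (reindex_path (before 1) (past_future 1) (om1, om2)))%:E =
      (inc om1)%:E + (stopped inc (th - inc om1) N om2)%:E.
    rewrite stoppedSl// shift_reindex EFinD.
    suff -> : inc (reindex_path (before 1) (past_future 1) (om1, om2)) = inc om1 by [].
    by apply: inc_local => i i1; rewrite /reindex_path /past_future /before i1.
  under eq_integral do rewrite E.
  rewrite ge0_integralD//; last 3 first.
  - by move=> om2 _; rewrite lee_fin.
  - by move=> om2 _; rewrite lee_fin sumr_ge0// => i _; rewrite mulr_ge0.
  - by apply/measurable_EFinP; exact: mS.
  rewrite integral_cst// [X in _ * X]probability_setT mule1 !indicE in_setC.
  have -> : (om1 \in H) = (th <= inc om1)%R by apply/idP/idP; rewrite inE.
  case: (leP th (inc om1)) => h /=; rewrite ?mule1 ?mule0 ?adde0 ?add0e.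
    under eq_integral do rewrite stopped0 ?subr_le0//.
    by rewrite integral0 adde0.
  apply: (@le_trans _ _ ((inc om1)%:E + (th - inc om1 + m)%:E)).
    by rewrite leeD2l// IH// subr_gt0.
  by rewrite -EFinD lee_fin; lra.
rewrite ge0_integralD//; last 4 first.
- by move=> om _; rewrite mule_ge0// lee_fin.
- apply: emeasurable_funM; apply/measurable_EFinP => //; exact: measurable_indic.
- by move=> om _; rewrite mule_ge0// lee_fin// addr_ge0// ltW.
- apply: emeasurable_funM => //; apply/measurable_EFinP; apply: measurable_indic.
  exact: measurableC.
have -> : \int[nu]_om ((inc om)%:E * (\1_H om)%:E) = \int[nu]_(om in H) (inc om)%:E.
  rewrite [RHS]integral_mkcond; apply: eq_integral => om _.
  by rewrite epatch_indic.
rewrite ge0_integralZl//; last 2 first.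
- by apply/measurable_EFinP; apply: measurable_indic; exact: measurableC.
- by rewrite lee_fin addr_ge0// ltW.
rewrite integral_indic ?setIT//; last exact: measurableC.
apply: (@le_trans _ _ ((th + m)%:E * nu H + (th + m)%:E * nu (~` H))).
  by rewrite leeD2r//; exact: mean_residual.
have fH : nu H \is a fin_num by exact: fin_num_measure.
rewrite (probability_setC nu mH) -(fineK fH) -EFinB -!EFinM -EFinD lee_fin; lra.
Qed.

Lemma passage_le_residual th : (0 < m)%R -> \int[nu]_om (inc om)%:E = m%:E -> (0 < th)%R ->
  passage inc nu th <= (th / m + 1)%:E.
Proof.
move=> m0 mE th0; have -> : (th / m + 1 = (th + m) / m)%R by rewrite mulrDl divff ?gt_eqF.
by apply: passage_le => // N; exact: integral_stopped_residual.
Qed.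

End Residual.

Lemma nneseries1 {R : realType} : (\sum_(i <oo) (1%:E : \bar R) = +oo)%E.
Proof.
apply/eqyP => A A0; pose n := (Num.truncn A).+1.
apply: (@le_trans _ _ (\sum_(0 <= i < n) (1%:E : \bar R))%E).
  by rewrite big_mkord sumEFin sumr_const card_ord lee_fin ltW// truncnS_gt.
by apply: nneseries_lim_ge => i _ _; rewrite lee_fin.
Qed.

(** * The two independent walks: excess of a round and dumps that are not full *)

Section TwoWalks.
Local Open Scope ereal_scope.
Context {R : realType}.
Variables (ie ir : path R -> R) (nu : probability (path R) R).
Hypothesis mie : measurable_fun [set: path R] ie.
Hypothesis mir : measurable_fun [set: path R] ir.
Hypothesis ie_local : forall om om' : path R,
  (forall i, (time i < 1)%N -> om i = om' i) -> ie om = ie om'.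
Hypothesis ir_local : forall om om' : path R,
  (forall i, (time i < 1)%N -> om i = om' i) -> ir om = ir om'.
Hypothesis ie_left : forall om om' : path R,
  (forall j, om (inl j) = om' (inl j)) -> ie om = ie om'.
Hypothesis ir_right : forall om om' : path R,
  (forall j, om (inr j) = om' (inr j)) -> ir om = ir om'.
Hypothesis ie_ge0 : forall om, (0 <= ie om)%R.
Hypothesis ir_ge0 : forall om, (0 <= ir om)%R.
Hypothesis inv_past : forall n, reindex_invariant nu (before n) (past_future n).
Hypothesis inv_left : reindex_invariant nu is_left id.

(** With both paths drawn from [nu] the result has law [nu] again, so the transmitter's path can be
    held fixed while the receiver's is averaged. *)
Definition join (om1 om2 : path R) : path R := reindex_path is_left id (om1, om2).

Lemma walk_join_left n om1 om2 : walk ie n (join om1 om2) = walk ie n om1.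
Proof. by apply: eq_bigr => i _; apply: ie_left. Qed.

Lemma walk_join_right n om1 om2 : walk ir n (join om1 om2) = walk ir n om2.
Proof. by apply: eq_bigr => i _; apply: ir_right. Qed.

Lemma measurable_join2 om1 : measurable_fun setT (join om1).
Proof.
apply: measurable_fun_path => i; rewrite /join/= /reindex_path/=.
by case: (is_left i) => //; exact: measurable_coord.
Qed.

Lemma probability_join (A : set (path R)) : measurable A ->
  nu A = \int[nu]_om1 nu (join om1 @^-1` A).
Proof.
move=> mA; rewrite -[A in LHS]setIT -integral_indic//.
rewrite [LHS](integral_reindex inv_left)//.
  apply: eq_integral => om1 _.
  transitivity (nu (join om1 @^-1` A `&` setT)); last exact: (congr1 nu (setIT _)).
  rewrite -integral_indic//.
  by rewrite -[_ @^-1` _]setTI; exact: measurable_join2.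
by apply/measurable_EFinP; exact: measurable_indic.
Qed.

Lemma measurable_probability_join (A : set (path R)) : measurable A ->
  measurable_fun setT (fun om1 => nu (join om1 @^-1` A)).
Proof.
move=> mA.
rewrite (_ : (fun _ => _) =
  fubini_F nu ((fun om => (\1_A om)%:E) \o @reindex_path R is_left id)).
  apply: measurable_fun_fubini_tonelli_F => //.
  apply: measurableT_comp; last exact: measurable_reindex_path.
  by apply/measurable_EFinP; exact: measurable_indic.
  by move=> x; rewrite lee_fin.
apply/funext => om1; rewrite /fubini_F.
transitivity (nu (join om1 @^-1` A `&` setT)); first exact: (congr1 nu (esym (setIT _))).
rewrite -integral_indic//.
by rewrite -[_ @^-1` _]setTI; exact: measurable_join2.
Qed.

Variables th C rh : R.

Let se n om := walk ie n om.
Let sr n om := walk ir n om.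
Let mbe := measurable_below mie.
Let mbr := measurable_below mir.

Lemma indep_below i :
  nu (below ie th i `&` ~` below ir rh i) = nu (below ie th i) * nu (~` below ir rh i).
Proof.
have mI : measurable (below ie th i `&` ~` below ir rh i).
  by apply: measurableI; [exact: mbe|exact: measurableC].
rewrite probability_join//.
transitivity (\int[nu]_om1 ((\1_(below ie th i) om1)%:E * nu (~` below ir rh i))).
  apply: eq_integral => om1 _; rewrite indicE.
  case: (boolP (om1 \in _)) => h /=; rewrite ?mul1e ?mul0e.
    congr (nu _); apply/seteqP; split=> om2; rewrite /= /below/= walk_join_right.
      by case.
    by move: h; rewrite inE /below/= walk_join_left.
  rewrite [X in nu X](_ : _ = set0) ?measure0//.
  apply/seteqP; split => om2 //=; rewrite /below/= walk_join_left => -[h1 _].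
  by move: h; rewrite notin_setE.
rewrite ge0_integralZr//; first by rewrite integral_indic ?setIT//; exact: mbe.
by apply/measurable_EFinP; apply: measurable_indic; exact: mbe.
Qed.

(* New better than used: after a wait of [n], the receiver needs in expectation
   at most as long as a fresh one. *)
Lemma passage_NBU n : passage ir nu rh < +oo ->
  nu (~` below ir rh n) * passage ir nu rh <= \sum_(i < n) nu (below ir rh i).
Proof.
set T2 := passage ir nu rh => T2oo.
have T2fin : T2 \is a fin_num by rewrite ge0_fin_numE// passage_ge0.
have pfin : nu (below ir rh n) \is a fin_num by exact: fin_num_measure.
(* If the walk is below [rh] at n + i, then it is below [rh] at n, and so is the walk restarted at n
   after i more slots; these two events are independent. *)
have H : T2 <= \sum_(i < n) nu (below ir rh i) + nu (below ir rh n) * T2.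
  rewrite {1}/T2 /passage (@nneseries_split _ _ 0%N n)// add0n big_mkord leeD2l//.
  rewrite -nneseries_addn// -(fineK pfin) -nneseriesZl//.
  apply: lee_nneseries => // i _.
  rewrite fineK// [(i + n)%N]addnC -(probability_renewal inv_past (n := n))//.
  - apply: le_measure; rewrite ?inE//=.
      apply: measurableI => //.
      by rewrite -[_ @^-1` _]setTI; apply: measurable_shift => //; exact: mbr.
    move=> om; rewrite /below/= walkD => h; split.
      by apply: le_lt_trans h; rewrite lerDl walk_ge0.
    by apply: le_lt_trans h; rewrite lerDr walk_ge0.
  - exact: adapted_below.
rewrite probability_setC; last exact: mbr.
move: H; rewrite -/T2 -(fineK T2fin) -(fineK pfin).
have sfin : \sum_(i < n) nu (below ir rh i) \is a fin_num.
  by apply/sum_fin_numP => i _ _; exact: fin_num_measure.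
by rewrite -(fineK sfin) -EFinB -!EFinM -EFinD !lee_fin; lra.
Qed.

(** The same event as a first dump of less than [C]: the thresholds are first met no later than at
    this n, when the energy is no larger. *)
Definition not_full : set (path R) :=
  [set om | exists n, [/\ (th <= se n om)%R, (se n om < C)%R & (rh <= sr n om)%R]].

Lemma measurable_not_full : measurable not_full.
Proof.
rewrite (_ : not_full = \bigcup_n (~` below ie th n `&` below ie C n `&` ~` below ir rh n)).
  apply: bigcupT_measurable => n; apply: measurableI; last by apply: measurableC.
  by apply: measurableI => //; apply: measurableC.
apply/seteqP; split => om.
  move=> [n [h1 h2 h3]]; exists n => //; split; last by apply/negP; rewrite -leNgt.
  by split => //; apply/negP; rewrite -leNgt.
move=> [n _ [[/negP h1 h2] /negP h3]]; exists n.
by rewrite leNgt h1 leNgt h3.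
Qed.

Hypothesis rh_gt0 : (0 < rh)%R.
Hypothesis th_le_C : (th <= C)%R.
Hypothesis T2oo : passage ir nu rh < +oo.

Lemma not_full_pathwise om1 :
  nu (join om1 @^-1` not_full) * passage ir nu rh +
    \sum_(i <oo) (\1_(below ie th i) om1)%:E * nu (~` below ir rh i) <=
  \sum_(i <oo) (\1_(below ie C i.+1) om1)%:E.
Proof.
have T2fin : passage ir nu rh \is a fin_num by rewrite ge0_fin_numE// passage_ge0.
have mnb i : measurable (~` below ir rh i) by apply: measurableC; exact: mbr.
(* If [C] is never reached the right side is infinite; if the walk jumps over [th, C), no receiver
   path makes the dump short. The case with content is a visit to [th, C). *)
have [[N0 CN0]|noC] := pselect (exists n, (C <= se n om1)%R); last first.
  rewrite [leRHS](_ : _ = +oo) ?leey// -nneseries1.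
  apply: eq_eseriesr => i _.
  rewrite indicE mem_set// /below/= ltNge; apply/negP => h; apply: noC.
  by exists i.+1.
have [[m [tm mC]]|noA] := pselect (exists n, (th <= se n om1)%R /\ (se n om1 < C)%R); last first.
  rewrite [X in nu X](_ : _ = set0) ?measure0 ?mul0e ?add0e.
    (* At i = 0 the receiver is still below rh > 0, so the first term vanishes and the series can be
       matched with the tails at i + 1. *)
    rewrite (nneseries_recl (P := xpredT))//; last first.
      by move=> k _; rewrite mule_ge0// lee_fin.
    rewrite [X in _ * nu X](_ : _ = set0); last first.
      by apply/seteqP; split => // om; rewrite /below/= walk0 => /(_ rh_gt0).
    rewrite measure0 mule0 add0e -nneseries_addn; last first.
      by move=> k; rewrite mule_ge0// lee_fin.
    apply: lee_nneseries => i _; first by rewrite mule_ge0// lee_fin.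
    rewrite addn1; apply: (@le_trans _ _ ((\1_(below ie th i.+1) om1)%:E * 1)).
      by apply: lee_wpmul2l; rewrite ?lee_fin// probability_le1.
    rewrite mule1 lee_fin !indicE ler_nat.
    case: (boolP (om1 \in below ie th i.+1)) => //; rewrite inE /below/= => h.
    by rewrite mem_set// /below/= (lt_le_trans h).
  apply/seteqP; split => // om2 [n]; rewrite /se !walk_join_left => -[h1 h2 _].
  by apply: noA; exists n.
have exC : exists n, (C <= se n om1)%R by exists N0.
have [] := ex_minnP exC => N CN Nmin.
have N0' : (0 < N)%N.
  rewrite lt0n; apply/eqP => N0E; move: CN; rewrite N0E leNgt => /negP; apply.
  by rewrite /se walk0 (le_lt_trans _ mC)// walk_ge0.
have ltN n : (n < N)%N -> (se n om1 < C)%R.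
  by move=> nN; rewrite ltNge; apply/negP => /Nmin; rewrite leqNgt nN.
have geN n : (se n om1 < C)%R -> (n < N)%N.
  move=> h; rewrite ltnNge; apply/negP => Nn; move: h; rewrite ltNge => /negP; apply.
  by rewrite (le_trans CN)// walk_nondecreasing.
(* The last index with the walk below [C]. A dump that is not full occurs by k, so the receiver has
   passed by then; and the walk is below [th] only before m <= k. *)
pose k := N.-1.
have kN : N = k.+1 by rewrite /k prednK.
have mk : (m <= k)%N by rewrite -ltnS -kN; exact: geN.
(* Complementary probabilities, so the two sums add up to k, the number of i with the walk below [C]
   at i + 1. *)
apply: (@le_trans _ _ (\sum_(i < k) nu (below ir rh i) +
    \sum_(i < k) nu (~` below ir rh i))).
  apply: leeD.
    apply: (le_trans _ (passage_NBU k T2oo)).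
    apply: lee_wpmul2r; first exact: passage_ge0.
    apply: le_measure; rewrite ?inE//.
      rewrite -[_ @^-1` _]setTI; apply: measurable_join2 => //.
      exact: measurable_not_full.
    move=> om2 [n []]; rewrite /se /sr !walk_join_left walk_join_right => _ /geN nN rn.
    apply/negP; rewrite /below/= -leNgt (le_trans rn)// walk_nondecreasing//.
    by rewrite -ltnS -kN.
  rewrite (nneseries_split 0%N k); last by move=> i _; rewrite mule_ge0// lee_fin.
  rewrite add0n big_mkord eseries0 ?adde0.
    by apply: lee_sum => i _; rewrite indicE; case: (_ \in _); rewrite ?mul1e ?mul0e.
  move=> i ki _; rewrite indicE memNset ?mul0e// /below/= => h.
  have : (m <= i)%N by rewrite (leq_trans mk).
  move=> /(walk_nondecreasing ie_ge0 om1); rewrite leNgt => /negP; apply.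
  exact: lt_le_trans h tm.
rewrite -big_split/= (nneseries_split 0%N k); last by move=> i _; rewrite lee_fin.
rewrite add0n big_mkord -[leLHS]adde0; apply: leeD; last first.
  by apply: nneseries_ge0 => n _ _; rewrite lee_fin.
apply: lee_sum => i _.
rewrite probability_setC; last exact: mbr.
rewrite addeC subeK; last exact: fin_num_measure.
by rewrite indicE mem_set// /below/= ltN// kN ltnS.
Qed.

(** The mean of the positive part of T1 - T2, where T1 is the passage of [ie] to [th] and T2 that of
    [ir] to [rh], written as a sum of tails. *)
Definition waiting_excess : \bar R :=
  \sum_(i <oo) nu (below ie th i `&` ~` below ir rh i).

(* Along each path of [ie], new-better-than-used bounds the first term by the tails of
   the receiver's wait before the passage of [ie] to [C]; the excess sums the
   complementary probabilities. *)
Lemma not_full_bound : (0 < C)%R ->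
  nu not_full * passage ir nu rh + waiting_excess + 1 <= passage ie nu C.
Proof.
move=> C0; have mnb i : measurable (~` below ir rh i) by apply: measurableC; exact: mbr.
have -> : passage ie nu C = 1 + \sum_(i <oo) nu (below ie C i.+1).
  rewrite /passage (nneseries_recl (P := xpredT))//; congr (_ + _).
    rewrite (_ : below _ _ _ = setT) ?probability_setT//.
    by apply/seteqP; split => // om _; rewrite /below/= walk0.
  rewrite -nneseries_addn//.
  by apply: eq_eseriesr => i _; rewrite addn1.
rewrite addeC leeD2l//.
have mi i c : measurable_fun [set: path R] (fun om1 => (\1_(below ie c i) om1)%:E).
  by apply/measurable_EFinP; apply: measurable_indic; exact: mbe.
have -> : \sum_(i <oo) nu (below ie C i.+1) =
    \int[nu]_om1 \sum_(i <oo) (\1_(below ie C i.+1) om1)%:E.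
  rewrite integral_nneseries//.
  by apply: eq_eseriesr => i _; rewrite integral_indic ?setIT//; exact: mbe.
have mP := measurable_probability_join measurable_not_full.
have T2fin : passage ir nu rh \is a fin_num by rewrite ge0_fin_numE// passage_ge0.
have -> : nu not_full * passage ir nu rh + waiting_excess =
   \int[nu]_om1 (nu (join om1 @^-1` not_full) * passage ir nu rh +
    \sum_(i <oo) (\1_(below ie th i) om1)%:E * nu (~` below ir rh i)).
  rewrite ge0_integralD//.
  - congr (_ + _).
      rewrite ge0_integralZr//; last exact: passage_ge0.
      by rewrite -probability_join//; exact: measurable_not_full.
    rewrite integral_nneseries//.
    + apply: eq_eseriesr => i _; rewrite indep_below ge0_integralZr//.
      by rewrite integral_indic ?setIT//; exact: mbe.
    + by move=> i; exact: emeasurable_funM.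
    + by move=> i om _; rewrite mule_ge0// lee_fin.
  - by move=> om _; rewrite mule_ge0// passage_ge0.
  - exact: emeasurable_funM.
  - by move=> om _; apply: nneseries_ge0 => n _ _; rewrite mule_ge0// lee_fin.
  - apply: ge0_emeasurable_sum => i.
      by move=> om _ _; rewrite mule_ge0// lee_fin.
    by move=> _; exact: emeasurable_funM.
apply: ge0_le_integral_nonmeasurable; last exact: not_full_pathwise.
move=> om; rewrite adde_ge0//; first by rewrite mule_ge0// passage_ge0.
by apply: nneseries_ge0 => n _ _; rewrite mule_ge0// lee_fin.
Qed.

(** The term i = 0 contributes 1 to the passage time but nothing to the excess, because rh > 0. *)
Lemma waiting_excess_le : (0 < th)%R -> waiting_excess + 1 <= passage ie nu th.
Proof.
move=> th0; have mnb i : measurable (~` below ir rh i) by apply: measurableC; exact: mbr.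
rewrite /waiting_excess /passage (nneseries_recl (P := xpredT))//.
rewrite [in leRHS](nneseries_recl (P := xpredT))//.
rewrite [X in nu X + _](_ : _ = set0); last first.
  by apply/seteqP; split => // om [_]; rewrite /below/= walk0 => /(_ rh_gt0).
rewrite measure0 add0e addeC; apply: leeD.
  rewrite (_ : below _ _ _ = setT) ?probability_setT//.
  by apply/seteqP; split => // om _; rewrite /below/= walk0.
apply: lee_nneseries => // i _; apply: le_measure; rewrite ?inE//.
by apply: measurableI => //; exact: mbe.
Qed.

Definition both_reached i om := ((th <= se i om) && (rh <= sr i om))%R.

(** Tail form of max(T1, T2) = T2 + (T1 - T2)^+, the time at which both thresholds are met. *)
Lemma passage_met :
  \sum_(i <oo) nu [set om | ~~ both_reached i om] = passage ir nu rh + waiting_excess.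
Proof.
have mnb i : measurable (~` below ir rh i) by apply: measurableC; exact: mbr.
rewrite -nneseriesD//; apply: eq_eseriesr => i _.
rewrite -measureU//.
- congr (nu _); apply/seteqP; split => om; rewrite /both_reached /below/= negb_and -!ltNge.
    move=> /orP[h|h]; last by left.
    by have [h'|h'] := ltP (sr i om) rh; [left|right; split=> //; apply/negP; rewrite -leNgt].
  by move=> [-> |[-> _]]//; rewrite orbT.
- exact: measurableI.
- by apply/seteqP; split => // om [h [_ ]].
Qed.

End TwoWalks.

(** * Mean time of several rounds *)

Section Rounds.
Local Open Scope ereal_scope.
Context {R : realType}.
Variables (ie ir : path R -> R) (nu : probability (path R) R).
Hypothesis mie : measurable_fun [set: path R] ie.
Hypothesis mir : measurable_fun [set: path R] ir.
Hypothesis ie_local : forall om om' : path R,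
  (forall i, (time i < 1)%N -> om i = om' i) -> ie om = ie om'.
Hypothesis ir_local : forall om om' : path R,
  (forall i, (time i < 1)%N -> om i = om' i) -> ir om = ir om'.
Hypothesis ie_ge0 : forall om, (0 <= ie om)%R.
Hypothesis ir_ge0 : forall om, (0 <= ir om)%R.
Hypothesis inv_past : forall n, reindex_invariant nu (before n) (past_future n).
Variables th C rh : R.
Hypothesis th_gt0 : (0 < th)%R.

Notation metp := (both_reached ie ir th rh).

(** Looking back one slot is enough since [metp] is monotone in t; for t = 0 the predecessor is 0
    itself and the event is empty. *)
Definition first_met t : set (path R) := [set om | metp t om && ~~ metp t.-1 om].

Lemma met_local t om om' : (forall i, (time i < t)%N -> om i = om' i) ->
  metp t om = metp t om'.
Proof.
by move=> h; rewrite /metp (walk_local ie_local h) (walk_local ir_local h).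
Qed.

Lemma met_nondecreasing m n om : (m <= n)%N -> metp m om -> metp n om.
Proof.
move=> mn /andP[h1 h2]; apply/andP; split.
  by apply: le_trans h1 _; apply: walk_nondecreasing.
by apply: le_trans h2 _; apply: walk_nondecreasing.
Qed.

Lemma measurable_met t : measurable_fun [set: path R] (metp t).
Proof.
by apply: measurable_and; apply: measurable_fun_ler => //; exact: measurable_walk.
Qed.

Lemma measurable_not_met t : measurable [set om | ~~ metp t om].
Proof.
rewrite -[mkset _]setTI.
exact: (measurable_neg (measurable_met t)) measurableT [set true] _.
Qed.

Lemma measurable_first_met t : measurable (first_met t).
Proof.
rewrite /first_met -[mkset _]setTI.
exact: (measurable_and (measurable_met t) (measurable_neg (measurable_met t.-1)))
  measurableT [set true] _.
Qed.

Lemma adapted_first_met t : adapted t (first_met t).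
Proof.
move=> om om' h; rewrite /first_met/= (met_local h).
rewrite (@met_local t.-1 om om')// => i it; apply: h.
by rewrite (leq_trans it)// leq_pred.
Qed.

Lemma first_met_gt0 t om : first_met t om -> (0 < t)%N.
Proof.
case: t => //; rewrite /first_met/= /both_reached walk0.
by rewrite leNgt th_gt0.
Qed.

Lemma first_met_inj t t' om : first_met t om -> first_met t' om -> t = t'.
Proof.
wlog tt : t t' / (t < t')%N.
  by move=> h ht ht'; case: (ltngtP t t') => // l; [exact: h|exact/esym/h].
move=> /andP[ht _] /andP[_ /negP[]]; apply: met_nondecreasing ht.
by rewrite -ltnS prednK// (leq_ltn_trans _ tt).
Qed.

Lemma first_met_exists om n : metp n om -> exists2 t, (t <= n)%N & first_met t om.
Proof.
move=> hn; have [|t ht tmin] := ex_minnP (P := metp ^~ om) _; first by exists n.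
exists t; first exact: tmin.
apply/andP; split => //; apply/negP => /tmin.
case: t ht {tmin} => [|t] ht /=; last by rewrite ltnn.
by move: ht; rewrite /both_reached walk0 leNgt th_gt0.
Qed.

Definition full_at t := first_met t `&` ~` below ie C t.
Definition short_at t := first_met t `&` below ie C t.

Definition wait om : \bar R := \sum_(i <oo) (\1_[set om | ~~ metp i om] om)%:E.

(* Time taken by [j] rounds, plus a spare one if [b] holds or if one of the [j]
   rounds ended with less than [C]. *)
Fixpoint rounds_time (b : bool) (j : nat) (om : path R) : \bar R :=
  if j is j'.+1 then
    wait om + \sum_(t <oo) ((\1_(full_at t) om)%:E * rounds_time b j' (shift t om) +
                            (\1_(short_at t) om)%:E * rounds_time true j' (shift t om))
  else if b then wait om else 0.

Lemma wait_ge0 om : 0 <= wait om.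
Proof. by apply: nneseries_ge0 => n _ _; rewrite lee_fin. Qed.

Lemma rounds_time_ge0 b j om : 0 <= rounds_time b j om.
Proof.
elim: j b om => [|j IH] b om /=; first by case: b => //; exact: wait_ge0.
rewrite adde_ge0 ?wait_ge0//; apply: nneseries_ge0 => n _ _.
by rewrite adde_ge0// mule_ge0// lee_fin.
Qed.

Lemma measurable_wait : measurable_fun [set: path R] wait.
Proof.
apply: ge0_emeasurable_sum => i; first by move=> om _ _; rewrite lee_fin.
by move=> _; apply/measurable_EFinP; apply: measurable_indic; exact: measurable_not_met.
Qed.

Lemma measurable_full_at t : measurable (full_at t).
Proof.
apply: measurableI; first exact: measurable_first_met.
by apply: measurableC; exact: measurable_below.
Qed.

Lemma measurable_short_at t : measurable (short_at t).
Proof.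
by apply: measurableI; [exact: measurable_first_met|exact: measurable_below].
Qed.

Lemma adapted_full_at t : adapted t (full_at t).
Proof.
move=> om om' h [h1 h2]; split; first exact: adapted_first_met h1.
by move=> h3; apply: h2; apply: (adapted_below ie_local _ h3) => i it; rewrite h.
Qed.

Lemma adapted_short_at t : adapted t (short_at t).
Proof.
move=> om om' h [h1 h2]; split; first exact: adapted_first_met h1.
exact: (adapted_below ie_local _ h2).
Qed.

Lemma measurable_indic_shift (A : set (path R)) t (Psi : path R -> \bar R) :
  measurable A -> measurable_fun [set: path R] Psi ->
  measurable_fun [set: path R] (fun om => (\1_A om)%:E * Psi (shift t om)).
Proof.
move=> mA mPsi; apply: emeasurable_funM.
  by apply/measurable_EFinP; exact: measurable_indic.
exact: (measurableT_comp mPsi (measurable_shift t)).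
Qed.

Lemma measurable_rounds_time b j : measurable_fun [set: path R] (rounds_time b j).
Proof.
elim: j b => [|j IH] b; first by case: b => //=; exact: measurable_wait.
apply: emeasurable_funD; first exact: measurable_wait.
apply: ge0_emeasurable_sum => i.
  move=> om _ _; rewrite adde_ge0// mule_ge0// ?lee_fin//; exact: rounds_time_ge0.
move=> _; apply: emeasurable_funD; apply: measurable_indic_shift => //.
  exact: measurable_full_at.
exact: measurable_short_at.
Qed.

Lemma integral_wait : \int[nu]_om wait om = \sum_(i <oo) nu [set om | ~~ metp i om].
Proof.
rewrite integral_nneseries//.
- by apply: eq_eseriesr => i _; rewrite integral_indic ?setIT//; exact: measurable_not_met.
- by move=> i; apply/measurable_EFinP; apply: measurable_indic; exact: measurable_not_met.
Qed.

Lemma sum_first_met (A : nat -> set (path R)) : (forall t, measurable (A t)) ->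
  (forall t, A t `<=` first_met t) -> \sum_(t <oo) nu (A t) = nu (\bigcup_t A t).
Proof.
move=> mA Af; rewrite measure_bigcup//; first by apply: eq_eseriesl => i; rewrite in_setT.
move=> t t' _ _ [om [/Af h /Af h']]; exact: first_met_inj h h'.
Qed.

Let F := \sum_(t <oo) nu (full_at t).
Let Q := \sum_(t <oo) nu (short_at t).

Lemma full_short_le1 : F + Q <= 1.
Proof.
rewrite /F /Q -nneseriesD//.
apply: (@le_trans _ _ (\sum_(t <oo) nu (first_met t))); last first.
  rewrite (sum_first_met measurable_first_met); last by move=> t om.
  by apply: probability_le1; apply: bigcupT_measurable => t; exact: measurable_first_met.
apply: lee_nneseries => [t _|t _]; first by rewrite adde_ge0.
have mf := measurable_full_at t; have ms := measurable_short_at t.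
have mm := measurable_first_met t.
rewrite -measureU//; last by apply/seteqP; split => // om [[_ h] [_ h']].
apply: le_measure; rewrite ?inE//; last by move=> om [[]|[]].
exact: measurableU.
Qed.

Lemma short_le : Q <= nu (not_full ie ir th C rh).
Proof.
have ms := measurable_short_at.
rewrite /Q (sum_first_met ms); last by move=> t om [].
have mb : measurable (\bigcup_t short_at t) by exact: bigcupT_measurable.
have mn := measurable_not_full mie mir th C rh.
apply: le_measure; rewrite ?inE//.
by move=> om [t _ [/andP[/andP[h1 h2] _] h3]]; exists t.
Qed.

(** How a round of length t ends is decided before slot t, so renewal applies for each t and the
    remaining rounds contribute their unconditional mean. *)
Lemma integral_rounds_timeS b j (A B : R) :
  \int[nu]_om rounds_time b j om <= A%:E ->
  \int[nu]_om rounds_time true j om <= B%:E ->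
  \int[nu]_om rounds_time b j.+1 om <= \int[nu]_om wait om + (A%:E * F + B%:E * Q).
Proof.
move=> leA leB.
have m1 t := measurable_indic_shift t (measurable_full_at t) (measurable_rounds_time b j).
have m2 t := measurable_indic_shift t (measurable_short_at t) (measurable_rounds_time true j).
have p1 t om : 0 <= (\1_(full_at t) om)%:E * rounds_time b j (shift t om).
  by rewrite mule_ge0// ?lee_fin// rounds_time_ge0.
have p2 t om : 0 <= (\1_(short_at t) om)%:E * rounds_time true j (shift t om).
  by rewrite mule_ge0// ?lee_fin// rounds_time_ge0.
rewrite /= ge0_integralD//; last 4 first.
- by move=> om _; exact: wait_ge0.
- exact: measurable_wait.
- by move=> om _; apply: nneseries_ge0 => n _ _; rewrite adde_ge0.
- apply: ge0_emeasurable_sum => i; first by move=> om _ _; rewrite adde_ge0.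
  by move=> _; exact: emeasurable_funD.
rewrite leeD2l// integral_nneseries//; last 2 first.
- by move=> i; exact: emeasurable_funD.
- by move=> i om _; rewrite adde_ge0.
have A0 : 0 <= A%:E.
  by apply: le_trans leA; apply: integral_ge0 => om _; exact: rounds_time_ge0.
have B0 : 0 <= B%:E.
  by apply: le_trans leB; apply: integral_ge0 => om _; exact: rounds_time_ge0.
rewrite -!nneseriesZl// -nneseriesD//; last 2 first.
- by move=> i _ _; rewrite mule_ge0.
- by move=> i _ _; rewrite mule_ge0.
apply: lee_nneseries => [t _ _|t _].
  by apply: integral_ge0 => om _; rewrite adde_ge0.
rewrite ge0_integralD//; apply: leeD.
  rewrite renewal//; last 4 first.
  - exact: measurable_full_at.
  - exact: adapted_full_at.
  - exact: measurable_rounds_time.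
  - by move=> om; exact: rounds_time_ge0.
  by rewrite muleC lee_wpmul2r.
rewrite renewal//; last 4 first.
- exact: measurable_short_at.
- exact: adapted_short_at.
- exact: measurable_rounds_time.
- by move=> om; exact: rounds_time_ge0.
by rewrite muleC lee_wpmul2r.
Qed.

Variable N : R.
Hypothesis waitE : \int[nu]_om wait om = N%:E.
Variable q : R.
Hypothesis qE : nu (not_full ie ir th C rh) = q%:E.

Lemma full_short_fin : exists f q' : R, [/\ F = f%:E, Q = q'%:E, (0 <= f)%R, (0 <= q')%R &
  (f + q' <= 1)%R /\ (q' <= q)%R].
Proof.
have F0 : 0 <= F by apply: nneseries_ge0.
have Q0 : 0 <= Q by apply: nneseries_ge0.
have Ffin : F \is a fin_num.
  rewrite ge0_fin_numE// (@le_lt_trans _ _ 1) ?ltry//.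
  by apply: le_trans full_short_le1; rewrite leeDl.
have Qfin : Q \is a fin_num.
  rewrite ge0_fin_numE// (@le_lt_trans _ _ 1) ?ltry//.
  by apply: le_trans full_short_le1; rewrite leeDr.
exists (fine F), (fine Q); rewrite !fineK// !fine_ge0//; split => //; split.
  by rewrite -lee_fin EFinD !fineK// full_short_le1.
by rewrite -lee_fin fineK// -qE short_le.
Qed.

Lemma wait_mean_ge0 : (0 <= N)%R.
Proof. by rewrite -lee_fin -waitE; apply: integral_ge0 => om _; exact: wait_ge0. Qed.

Lemma rounds_time_true_le j : \int[nu]_om rounds_time true j om <= (j.+1%:R * N)%:E.
Proof.
have [f [q' [Fe Qe f0 q0 [fq1 _]]]] := full_short_fin.
elim: j => [|j IH]; first by rewrite mul1r -waitE.
apply: le_trans (integral_rounds_timeS IH IH) _.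
rewrite waitE Fe Qe -!EFinM -!EFinD lee_fin.
have : (j.+1%:R * N * (f + q') <= j.+1%:R * N)%R.
  by rewrite ler_piMr// mulr_ge0// wait_mean_ge0.
by rewrite -[j.+2%:R]natr1 mulrDl mul1r mulrDr; lra.
Qed.

Lemma rounds_time_false_le j : exists Qj : R, [/\ (0 <= Qj <= 1)%R, (Qj <= j%:R * q)%R &
  \int[nu]_om rounds_time false j om <= ((j%:R + Qj) * N)%:E].
Proof.
have [f [q' [Fe Qe f0 q0 [fq1 q'q]]]] := full_short_fin.
have N0 := wait_mean_ge0.
elim: j => [|j [Qj [/andP[Qj0 Qj1] Qjq IH]]].
  by exists 0%R; rewrite lexx ler01 mul0r integral0 addr0 mul0r.
(* One minus this is (1 - q') * (1 - Qj): among independent rounds, each short with probability q',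
   it is the probability that some round is short. Both bounds, 1 and the union bound, are needed
   later. *)
exists (Qj + q' * (1 - Qj))%R; split.
- apply/andP; split; nra.
- rewrite -natr1 mulrDl mul1r; nra.
- apply: le_trans (integral_rounds_timeS IH (rounds_time_true_le j)) _.
  rewrite waitE Fe Qe -!EFinM -!EFinD lee_fin -natr1.
  have j0 : (0 <= j%:R :> R)%R by [].
  have : (f * ((j%:R + Qj) * N) <= (1 - q') * ((j%:R + Qj) * N))%R.
    by apply: ler_wpM2r; [rewrite mulr_ge0// addr_ge0|lra].
  lra.
Qed.

End Rounds.

(** * Runs of the online algorithm on a fixed arrival sequence *)

Section Runs.
Context {R : realType}.
Variables (w Ct Pr c : R) (g : R -> R) (e r : nat -> R).
Hypothesis w_gt0 : 0 < w.
Hypothesis Ct_gt0 : 0 < Ct.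
Hypothesis c_ge1 : 1 <= c.
Hypothesis g_mono : forall p q : R, 0 <= p -> p <= q -> g p <= g q.
Hypothesis e_ge0 : forall i, 0 <= e i.
Hypothesis r_ge0 : forall i, 0 <= r i.

Notation is_round := (is_round w Ct Pr c e r).
Notation round_bits := (round_bits w Ct g e).
Notation threshold_met := (threshold_met w Ct Pr c e r).

Definition bits_of_energy (u : R) : R := w * g (u / w).

(** Unlike in [online_transmits], the starting slot is arbitrary, so that rounds can be prepended
    and runs with different starts compared. *)
Inductive run : nat -> nat -> nat -> R -> Prop :=
| run_nil s : run 0 s s 0
| run_cons K s t n B : is_round s t -> run K t n B ->
    run K.+1 s n (round_bits s t + B).

Lemma run_online K n B B0 : run K 0 n B -> B0 <= B ->
  online_transmits w Ct Pr c g B0 e r n.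
Proof.
move=> rn B0B.
have resets s : run K s n B -> exists reset : nat -> nat,
    [/\ reset 0%N = s, reset K = n,
      forall j, (j < K)%N -> is_round (reset j) (reset j.+1)
      & B = \sum_(j < K) round_bits (reset j) (reset j.+1)].
  elim => {K s n B rn B0B} [s|K s t n B rt _ [reset [r0 rK rj ->]]].
    by exists (fun=> s); split => //; rewrite big_ord0.
  exists (fun j => if j is j'.+1 then reset j' else s); split => //.
    by case => [_|j jK]; rewrite ?r0//; exact: rj.
  by rewrite big_ord_recl /= r0.
have [reset [r0 rK rj rB]] := resets _ rn.
by exists K, reset; split => //; rewrite -rB.
Qed.

Lemma threshold_mono s0 s t t' : (s0 <= s)%N -> (t <= t')%N -> (s <= t)%N ->
  threshold_met s t -> threshold_met s0 t'.
Proof.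
move=> s0s tt' st [h1 h2].
have le_sum (f : nat -> R) : (forall i, 0 <= f i) ->
    \sum_(s <= i < t) f i <= \sum_(s0 <= i < t') f i.
  move=> f0; rewrite (big_cat_nat s0s (leq_trans st tt'))/=.
  rewrite [X in _ <= _ + X](big_cat_nat st tt')/=.
  by rewrite addrCA lerDl addr_ge0// sumr_ge0.
by split; [exact: le_trans (le_sum _ e_ge0)|exact: le_trans (le_sum _ r_ge0)].
Qed.

Lemma round_exists s t : (s <= t)%N -> threshold_met s t ->
  exists2 t', (t' <= t)%N & is_round s t'.
Proof.
move=> st ht; pose Q t := `[< (s <= t)%N /\ threshold_met s t >].
have exQ : exists t, Q t by exists t; apply/asboolP.
have [t' /asboolP[st' ht'] tmin] := ex_minnP exQ.
exists t'; first by apply: tmin; exact/asboolP.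
split => // u /andP[su ut'] hu.
by have := tmin u (asboolT (conj su hu)); rewrite leqNgt ut'.
Qed.

(** An earlier reset has accumulated at least as much, so each round ends no later. A round that
    ends earlier may dump less, so only the number of rounds survives and [B'] is left free. *)
Lemma run_mono K s n B s0 : run K s n B -> (s0 <= s)%N ->
  exists n0 B', (n0 <= n)%N /\ run K s0 n0 B'.
Proof.
move=> rn; elim: rn s0 => {K s n B} [s s0 h|K s t n B rt _ IH s0 s0s].
  by exists s0, 0; split => //; exact: run_nil.
have [st ht _] := rt.
have [t' t't rt'] := round_exists (leq_trans s0s st) (threshold_mono s0s (leqnn t) st ht).
have [n0 [B' [n0n rn0]]] := IH _ t't.
by exists n0, (round_bits s0 t' + B'); split => //; exact: run_cons rt' rn0.
Qed.

Lemma battery_idle (arr : nat -> R) n : (forall i, 0 <= arr i) ->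
  battery Ct arr (fun=> 0) n = Num.min Ct (\sum_(i < n.+1) arr i).
Proof.
move=> arr0; elim: n => [|n IH] /=; first by rewrite big_ord_recr big_ord0/= add0r.
rewrite IH subr0 [in RHS]big_ord_recr/=.
have := arr0 n.+1; set S := \sum_(i < n.+1) arr i => a0.
have [h|h] := leP Ct S; last by [].
rewrite !min_l//; first by rewrite (le_trans h)// lerDl.
by rewrite lerDl.
Qed.

Lemma round_ltn s t : is_round s t -> (s < t)%N.
Proof.
move=> [st [h _] _]; rewrite ltn_neqAle st andbT; apply/eqP => E.
move: h; rewrite E big_geq// leNgt divr_gt0//.
by rewrite (lt_le_trans _ c_ge1).
Qed.

Lemma round_bitsE s t : (s < t)%N ->
  round_bits s t = bits_of_energy (Num.min Ct (\sum_(s <= i < t) e i)).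
Proof.
move=> st; rewrite /Defs.round_bits battery_idle//.
rewrite /bits_of_energy; congr (_ * g (Num.min _ _ / _)).
rewrite prednK ?subn_gt0// -[in RHS](add0n s) big_addn big_mkord.
by apply: eq_bigr => i _; rewrite addnC.
Qed.

Lemma bits_of_energy_mono u v : 0 <= u -> u <= v -> bits_of_energy u <= bits_of_energy v.
Proof.
move=> u0 uv; apply: ler_wpM2l; first exact: ltW.
by apply: g_mono; [rewrite divr_ge0// ltW|rewrite ler_wpM2r// invr_ge0 ltW].
Qed.

Lemma round_bits_ge s t u : is_round s t -> 0 <= u -> u <= Ct ->
  u <= \sum_(s <= i < t) e i -> bits_of_energy u <= round_bits s t.
Proof.
move=> rt u0 uC us; rewrite round_bitsE ?round_ltn//.
by apply: bits_of_energy_mono => //; rewrite le_min uC us.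
Qed.

Lemma round_bits_ge_threshold s t : is_round s t -> bits_of_energy (Ct / c) <= round_bits s t.
Proof.
move=> rt; have c0 : 0 < c by exact: lt_le_trans c_ge1.
apply: round_bits_ge => //; first by rewrite divr_ge0// ltW.
  by rewrite ler_pdivrMr// ler_peMr// ltW.
by case: rt => _ [].
Qed.

Lemma run_bits_ge K s n B : run K s n B -> K%:R * bits_of_energy (Ct / c) <= B.
Proof.
elim => {K s n B} [s|K s t n B rt _ IH]; first by rewrite mul0r.
by rewrite -natr1 mulrDl mul1r addrC lerD// round_bits_ge_threshold.
Qed.

End Runs.

(** * Pathwise bounds on the online number of slots *)

Section PathRuns.
Context {R : realType}.
Variables (w Ct Pr c : R) (g : R -> R) (ie ir : path R -> R).
Hypothesis w_gt0 : 0 < w.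
Hypothesis Ct_gt0 : 0 < Ct.
Hypothesis Pr_gt0 : 0 < Pr.
Hypothesis c_ge1 : 1 <= c.
Hypothesis g_mono : forall p q : R, 0 <= p -> p <= q -> g p <= g q.
Hypothesis ie_ge0 : forall om, 0 <= ie om.
Hypothesis ir_ge0 : forall om, 0 <= ir om.

Let th := Ct / c.
Let rh := Pr * w.
Let c_gt0 : 0 < c := lt_le_trans ltr01 c_ge1.
Let th_gt0 : 0 < th := divr_gt0 Ct_gt0 c_gt0.
Let rh_gt0 : 0 < rh := mulr_gt0 Pr_gt0 w_gt0.

Definition steps (inc : path R -> R) (om : path R) (i : nat) : R := inc (shift i om).

Variable om : path R.
Notation e := (steps ie om).
Notation r := (steps ir om).
Notation run := (run w Ct Pr c g e r).
Notation is_round := (is_round w Ct Pr c e r).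
Notation bits := (bits_of_energy w g).
Notation met := (both_reached ie ir th rh).
Notation first_met := (first_met ie ir th rh).

Let e_ge0 i : 0 <= e i. Proof. exact: ie_ge0. Qed.
Let r_ge0 i : 0 <= r i. Proof. exact: ir_ge0. Qed.

Lemma sum_steps inc s n : \sum_(s <= i < s + n) steps inc om i = walk inc n (shift s om).
Proof.
rewrite -{1}[s]add0n big_addn addKn big_mkord; apply: eq_bigr => i _.
by rewrite /steps shiftD addnC.
Qed.

Lemma met_threshold s n : met n (shift s om) <-> threshold_met w Ct Pr c e r s (s + n).
Proof.
rewrite /threshold_met !sum_steps /both_reached; split; first by move=> /andP.
by move=> [h1 h2]; apply/andP.
Qed.

Lemma first_met_round s t : first_met t (shift s om) -> is_round s (s + t).
Proof.
move=> /[dup] /(first_met_gt0 th_gt0) t0 /andP[h1 /negP h2]; split.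
- exact: leq_addr.
- exact/met_threshold.
move=> u /andP[su ut] hu; apply: h2.
apply: (@met_nondecreasing _ _ _ ie_ge0 ir_ge0 th rh (u - s)).
  by rewrite -ltnS prednK// ltn_subLR.
by apply/met_threshold; rewrite subnKC.
Qed.

Lemma first_met_wait t om' : first_met t om' -> ((t%:R)%:E <= wait ie ir th rh om')%E.
Proof.
move=> /[dup] /(first_met_gt0 th_gt0) t0 /andP[_ h2].
apply: (le_trans _ (nneseries_lim_ge t _)) => //.
rewrite big_mkord -[t in leLHS]card_ord -sumr_const -sumEFin.
apply: lee_sum => i _; rewrite lee_fin indicE mem_set//=; apply/negP => h.
move/negP: h2; apply; apply: met_nondecreasing h => //.
by rewrite -ltnS prednK.
Qed.

Hypothesis recurrent : forall s, exists n, met n (shift s om).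

(** With the spare round always granted, [rounds_time true K'] pays for K'.+1 rounds. *)
Definition rounds_cost (K : nat) (om' : path R) : \bar R :=
  if K is K'.+1 then rounds_time ie ir th Ct rh true K' om' else 0%E.

(** The disjunction says how the bits are to be counted: with the spare round there are j + 1
    rounds, each worth at least a threshold dump; without it all j dumps were full. *)
Lemma rounds_time_run b j s : exists (n K : nat) (B : R),
  [/\ run K s n B,
      ((n%:R)%:E <= (s%:R)%:E + rounds_time ie ir th Ct rh b j (shift s om))%E &
      K = j.+1 \/ [/\ ~~ b, K = j & j%:R * bits Ct <= B]].
Proof.
have first s' : exists t, first_met t (shift s' om).
  have [n hn] := recurrent s'.
  by have [t _ ht] := first_met_exists th_gt0 hn; exists t.
elim: j b s => [|j IH] b s.
  case: b => /=.
    have [t ht] := first s.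
    exists (s + t)%N, 1%N, (round_bits w Ct g e s (s + t) + 0); split; last by left.
      by apply: run_cons; [exact: first_met_round|exact: run_nil].
    by rewrite natrD EFinD leeD2l// first_met_wait.
  by exists s, 0%N, 0; split; [exact: run_nil|rewrite adde0|right; rewrite mul0r].
have [t ht] := first s.
have [hC|hC] := leP Ct (walk ie t (shift s om)).
  have [n [K [B [rn nle hK]]]] := IH b (s + t)%N.
  exists n, K.+1, (round_bits w Ct g e s (s + t) + B); split.
  - exact: run_cons (first_met_round ht) rn.
  - apply: (le_trans nle); rewrite natrD EFinD -addeA leeD2l//=.
    apply: leeD; first exact: first_met_wait.
    apply: (le_trans _ (nneseries_ge_term t _)).
      rewrite [X in (_ <= X%:E * _ + _)%E]indicE mem_set; last first.
        by split => //; apply/negP; rewrite /below/= -leNgt.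
      by rewrite mul1e shiftD leeDl// mule_ge0 ?lee_fin//; exact: rounds_time_ge0.
    by move=> i; rewrite adde_ge0// mule_ge0 ?lee_fin//; exact: rounds_time_ge0.
  - case: hK => [->|[nb -> jB]]; first by left.
    right; split => //; rewrite -natr1 mulrDl mul1r addrC lerD//.
    by apply: round_bits_ge (first_met_round ht) _ _ _ => //; [exact: ltW|rewrite sum_steps].
have [n [K [B [rn nle hK]]]] := IH true (s + t)%N.
exists n, K.+1, (round_bits w Ct g e s (s + t) + B); split.
- exact: run_cons (first_met_round ht) rn.
- apply: (le_trans nle); rewrite natrD EFinD -addeA leeD2l//=.
  apply: leeD; first exact: first_met_wait.
  apply: (le_trans _ (nneseries_ge_term t _)).
    rewrite [X in (_ <= _ + X%:E * _)%E]indicE mem_set; last by split.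
    by rewrite mul1e shiftD leeDr// mule_ge0 ?lee_fin//; exact: rounds_time_ge0.
  by move=> i; rewrite adde_ge0// mule_ge0 ?lee_fin//; exact: rounds_time_ge0.
- by case: hK => [->|[]]; left.
Qed.

Lemma rounds_cost_run K s : exists (n : nat) (B : R),
  run K s n B /\ ((n%:R)%:E <= (s%:R)%:E + rounds_cost K (shift s om))%E.
Proof.
case: K => [|K]; first by exists s, 0; split; [exact: run_nil|rewrite adde0].
have [n [K' [B [rn nle [KE|[//]]]]]] := rounds_time_run true K s.
by exists n, B; rewrite -{1}KE; split.
Qed.

Variable B0 : R.

Lemma run_online_slots K n B : run K 0 n B -> B0 <= B ->
  (online_slots w Ct Pr c g B0 e r <= (n%:R)%:E)%E.
Proof.
by move=> rn B0B; apply: ereal_inf_lbound; exists n => //; exact: run_online rn B0B.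
Qed.

(** The run is built from slot [M], where it is independent of the first [M] slots, and then
    compared with the run from slot 0 by [run_mono]. *)
Lemma online_le_rounds K M : B0 <= K%:R * bits th ->
  (online_slots w Ct Pr c g B0 e r <= (M%:R)%:E + rounds_cost K (shift M om))%E.
Proof.
move=> hK; have [n [B [rn nle]]] := rounds_cost_run K M.
have [n0 [B' [n0n rn0]]] := run_mono e_ge0 r_ge0 rn (leq0n M).
apply: (le_trans (run_online_slots rn0 _)).
  by apply: (le_trans hK); apply: run_bits_ge rn0.
by apply: le_trans nle; rewrite lee_fin ler_nat.
Qed.

Lemma online_le_after_round K M : B0 <= K.+1%:R * bits th -> met M om ->
  (online_slots w Ct Pr c g B0 e r <= (M%:R)%:E + rounds_cost K (shift M om))%E.
Proof.
move=> hK hM; have [n [B [rn nle]]] := rounds_cost_run K M.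
have hM' : threshold_met w Ct Pr c e r 0 M.
  by rewrite -[M]add0n; apply/met_threshold; rewrite shift0.
have [t tM rt] := round_exists (leq0n M) hM'.
have [n0 [B' [n0n rn0]]] := run_mono e_ge0 r_ge0 rn tM.
have rn1 := run_cons rt rn0.
apply: (le_trans (run_online_slots rn1 _)).
  by apply: (le_trans hK); apply: run_bits_ge rn1.
by apply: le_trans nle; rewrite lee_fin ler_nat.
Qed.

Definition receiver_wait (om' : path R) : \bar R :=
  (\sum_(i <oo) (\1_(below ir rh i) om')%:E)%E.

(** The transmitter is ready at [M], so only the receiver delays the dump; forgetting what it had
    stored by then leaves a fresh wait from [M]. *)
Lemma receiver_wait_first M t : th <= walk ie M om -> first_met t om ->
  ((t%:R)%:E <= (M%:R)%:E + receiver_wait (shift M om))%E.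
Proof.
move=> eM /[dup] /(first_met_gt0 th_gt0) t0 /andP[_ h2].
have [tM|Mt] := leqP t M.
  apply: (@le_trans _ _ (M%:R)%:E); first by rewrite lee_fin ler_nat.
  by rewrite leeDl// nneseries_ge0// => i _ _; rewrite lee_fin.
rewrite -(subnKC (ltnW Mt)) natrD EFinD leeD2l//.
apply: (le_trans _ (nneseries_lim_ge (t - M) _)); last by move=> i _ _; rewrite lee_fin.
rewrite big_mkord -[(t - M)%N in leLHS]card_ord -sumr_const -sumEFin.
apply: lee_sum => i _; rewrite lee_fin indicE mem_set//= /below/= ltNge.
apply/negP => h; move/negP: h2; apply.
have Mi : (M + i <= t.-1)%N by rewrite -ltnS prednK// -ltn_subRL.
apply: (met_nondecreasing ie_ge0 ir_ge0 Mi); apply/andP; split.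
  by apply: (le_trans eM); apply: walk_nondecreasing => //; exact: leq_addr.
by rewrite walkD (le_trans h)// lerDr walk_ge0.
Qed.

Lemma online_le_receiver_wait M : th <= walk ie M om -> walk ir M om < rh ->
  B0 <= bits (Num.min Ct (walk ie M om)) ->
  (online_slots w Ct Pr c g B0 e r <= (M%:R)%:E + receiver_wait (shift M om))%E.
Proof.
move=> eM rM hB; have [n hn] := recurrent 0; rewrite shift0 in hn.
have [t _ ht] := first_met_exists th_gt0 hn.
apply: le_trans (receiver_wait_first eM ht).
have rt : is_round 0 t by rewrite -[t]add0n; apply: first_met_round; rewrite shift0.
apply: (run_online_slots (run_cons rt (run_nil w Ct Pr c g e r t))).
rewrite addr0 (le_trans hB)//; apply: round_bits_ge rt _ _ _ => //.
- by rewrite le_min (ltW Ct_gt0) walk_ge0.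
- by rewrite ge_min lexx.
rewrite -[t]add0n sum_steps shift0 ge_min; apply/orP; right.
apply: walk_nondecreasing => //; rewrite leqNgt; apply/negP => tM.
move: ht => /andP[/andP[_ h] _]; move: rM; rewrite ltNge => /negP; apply.
by apply: (le_trans h); apply: walk_nondecreasing => //; exact: ltnW.
Qed.

(** A receiver that is late at [M] makes the first round end at some t > M. The explicit constraint
    M < t lets an event decided by the first [M] slots be added later while staying adapted to t. *)
Definition after_first (M : nat) (Phi : path R -> \bar R) (om' : path R) : \bar R :=
  (\sum_(t <oo) (\1_(first_met t `&` [set _ | (M < t)%N]) om')%:E * Phi (shift t om'))%E.

Lemma online_le_after_first M Phi : th <= walk ie M om -> walk ir M om < rh ->
  Ct <= walk ie M om -> (forall om', 0 <= Phi om')%E ->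
  (forall s, exists (n K : nat) (B : R), [/\ run K s n B,
      ((n%:R)%:E <= (s%:R)%:E + Phi (shift s om))%E & B0 <= bits Ct + B]) ->
  (online_slots w Ct Pr c g B0 e r <=
    (M%:R)%:E + receiver_wait (shift M om) + after_first M Phi om)%E.
Proof.
move=> eM rM CM Phi0 hPhi; have [n hn] := recurrent 0; rewrite shift0 in hn.
have [t _ ht] := first_met_exists th_gt0 hn.
have rt : is_round 0 t by rewrite -[t]add0n; apply: first_met_round; rewrite shift0.
have Mt : (M < t)%N.
  rewrite ltnNge; apply/negP => tM.
  move: ht => /andP[/andP[_ h] _]; move: rM; rewrite ltNge => /negP; apply.
  by apply: (le_trans h); apply: walk_nondecreasing.
have [n' [K [B [rn nle hB]]]] := hPhi t.
apply: (le_trans (run_online_slots (run_cons rt rn) _)).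
  apply: (le_trans hB); rewrite lerD2r; apply: round_bits_ge rt _ _ _ => //; first exact: ltW.
  rewrite -[t]add0n sum_steps shift0 (le_trans CM)//.
  by apply: walk_nondecreasing => //; exact: ltnW.
apply: (le_trans nle); apply: leeD; first exact: receiver_wait_first.
apply: (le_trans _ (nneseries_ge_term t _)).
  by rewrite indicE mem_set ?mul1e//; split.
by move=> i; rewrite mule_ge0// lee_fin.
Qed.

End PathRuns.

(** * Supporting lines of the rate function *)

Section Rate.
Context {R : realType}.
Variable g : R -> R.
Hypothesis g_rate : rate_function g.

Lemma rate_concave_three (y a x : R) : 0 <= y -> y < a -> a < x ->
  (g x - g a) / (x - a) <= (g a - g y) / (a - y).
Proof.
move=> y0 ya ax.
have xy : 0 < x - y by rewrite subr_gt0 (lt_trans ya).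
have ay : 0 < a - y by rewrite subr_gt0.
have xa : 0 < x - a by rewrite subr_gt0.
have t0 : 0 <= (a - y) / (x - y) by rewrite divr_ge0// ltW.
have t1 : (a - y) / (x - y) <= 1 by rewrite ler_pdivrMr// mul1r lerD2r ltW.
have hx : x \in (`[0, +oo[%classic : set R).
  by rewrite inE/= in_itv/= andbT (le_trans y0)// ltW// (lt_trans ya).
have hy : y \in (`[0, +oo[%classic : set R) by rewrite inE/= in_itv/= andbT.
have : - g ((a - y) / (x - y) * x + (1 - (a - y) / (x - y)) * y) <=
    (a - y) / (x - y) * - g x + (1 - (a - y) / (x - y)) * - g y.
  exact: (rate_concave g_rate (Itv01 t0 t1) hx hy).
have -> : (a - y) / (x - y) * x + (1 - (a - y) / (x - y)) * y = a.
  by field; rewrite gt_eqF.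
have -> : 1 - (a - y) / (x - y) = (x - a) / (x - y).
  by field; rewrite gt_eqF.
move=> h; rewrite ler_pdivrMr// mulrAC ler_pdivlMr//.
have : (a - y) * - g x + (x - a) * - g y >= (x - y) * - g a.
  have -> : (a - y) * - g x + (x - a) * - g y =
      (x - y) * ((a - y) / (x - y) * - g x + (x - a) / (x - y) * - g y).
    by field; rewrite gt_eqF.
  by rewrite ler_pM2l.
by lra.
Qed.

Lemma rate_supporting_line (a : R) : 0 < a -> exists m : R, [/\ 0 <= m,
  m * a <= g a & forall x, 0 <= x -> g x <= g a + m * (x - a)].
Proof.
(* The infimum of the chord slopes on the left of a, that is the left derivative. Monotonicity of g
   makes it nonnegative, and the line evaluated at 0, where g vanishes, gives m * a <= g a. *)
move=> a0; pose S := [set (g a - g y) / (a - y) | y in [set y : R | 0 <= y < a]].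
have S0 : nonempty S by exists ((g a - g 0) / (a - 0)), 0 => //=; rewrite lexx a0.
have lbS : lbound S 0.
  move=> _ [y /andP[y0 ya] <-]; rewrite divr_ge0 ?subr_ge0 ?(ltW ya)//.
  exact: (rate_nondecreasing g_rate y0 (ltW ya)).
have hlb : has_lbound S by exists 0.
have m0 : 0 <= inf S by exact: lb_le_inf.
have line x : 0 <= x -> g x <= g a + inf S * (x - a).
  move=> x0; have [xa|ax|->] := ltgtP x a.
  - have : inf S <= (g a - g x) / (a - x) by apply: ge_inf => //; exists x => //=; rewrite x0.
    by rewrite ler_pdivlMr ?subr_gt0//; lra.
  - have : (g x - g a) / (x - a) <= inf S.
      apply: lb_le_inf => // _ [y /andP[y0 ya] <-]; exact: rate_concave_three.
    by rewrite ler_pdivrMr ?subr_gt0//; lra.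
  - by rewrite subrr mulr0 addr0.
exists (inf S); split => //.
by have := line 0 (lexx _); rewrite (rate_at0 g_rate); lra.
Qed.

(** If g p = 0, then g(q)/q <= 0 for all q >= p, against unboundedness. *)
Lemma rate_gt0 (p : R) : 0 < p -> 0 < g p.
Proof.
move=> p0; rewrite lt_neqAle (rate_ge0 g_rate (ltW p0)) andbT; apply/eqP => gp.
have := rate_unbounded g_rate => /cvgryPge /(_ 1) [A [_ hA]].
pose x := Num.max (A + 1) p.
have Ax : A < x by rewrite lt_max ltrDl ltr01.
have px : p <= x by rewrite le_max lexx orbT.
have := hA _ Ax; have := rate_per_power_nonincreasing g_rate p0 px.
rewrite -gp mul0r ler_pdivrMr ?(lt_le_trans p0)// mul0r => h1 h2.
by have := le_trans h2 h1; rewrite ler10.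
Qed.

End Rate.

(** * Upper bounds on what an offline schedule can transmit *)

Section Offline.
Context {R : realType}.
Variables (w Ct Cr Pr : R) (g : R -> R).
Hypothesis w_gt0 : 0 < w.
Hypothesis Pr_gt0 : 0 < Pr.
Hypothesis g_rate : rate_function g.

(** Energy stored plus energy already spent never exceeds what has arrived; overflow only loses. *)
Lemma battery_budget (C : R) (arr use : nat -> R) n :
  (forall i, (i < n)%N -> 0 <= use i /\ use i <= battery C arr use i) ->
  \sum_(i < n) use i <= \sum_(i < n) arr i.
Proof.
move=> h; suff hb : forall i, (i < n)%N ->
    battery C arr use i + \sum_(j < i) use j <= \sum_(j < i.+1) arr j.
  case: n h hb => [|n] h hb; first by rewrite !big_ord0.
  have := hb n (ltnSn n); have [_] := h n (ltnSn n).
  by rewrite [\sum_(i < n.+1) use i]big_ord_recr/=; lra.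
elim=> [_|i IH iN]; first by rewrite big_ord0 addr0 big_ord_recr big_ord0/= add0r ge_min lexx orbT.
have := IH (ltnW iN).
rewrite /= [\sum_(j < i.+1) use j]big_ord_recr [\sum_(j < i.+2) arr j]big_ord_recr/=.
have : Num.min C (battery C arr use i - use i + arr i.+1) <= battery C arr use i - use i + arr i.+1.
  by rewrite ge_min lexx orbT.
by lra.
Qed.

Lemma battery_le_capacity (C : R) (arr use : nat -> R) i : battery C arr use i <= C.
Proof. by case: i => [|i] /=; rewrite ge_min lexx. Qed.

Lemma battery_le_arrived (C : R) (arr use : nat -> R) n i :
  (forall j, (j < n)%N -> 0 <= use j) -> (forall j, 0 <= arr j) -> (i < n)%N ->
  battery C arr use i <= \sum_(j < n) arr j.
Proof.
move=> u0 a0 iN; apply: (@le_trans _ _ (\sum_(j < i.+1) arr j)).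
  elim: i iN => [|i IH] iN; first by rewrite big_ord_recr big_ord0/= add0r ge_min lexx orbT.
  rewrite [in leRHS]big_ord_recr/= ge_min; apply/orP; right; rewrite lerD2r.
  by rewrite (le_trans _ (IH (ltnW iN)))// gerBl u0// ltnW.
rewrite -(subnKC iN) big_split_ord/= lerDl; exact: sumr_ge0.
Qed.

Lemma slot_cat n : `[0%R, (n.+1%:R * w)%R[%classic =
  `[0%R, (n%:R * w)%R[%classic `|` slot w n :> set R.
Proof.
have h0 : 0 <= n%:R * w by rewrite mulr_ge0// ltW.
have h1 : n%:R * w <= n.+1%:R * w by rewrite ler_wpM2r ?ler_nat// ltW.
apply/seteqP; split => x; rewrite /slot/= !in_itv/=.
  move=> /andP[x0 xn]; have [xn'|xn'] := ltP x (n%:R * w); [left|right].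
    by rewrite x0.
  by [].
move=> [/andP[x0 xn]|/andP[x0 xn]]; first by rewrite x0 (lt_le_trans xn).
by rewrite (le_trans h0 x0) xn.
Qed.

(** An affine majorant of g reduces an arbitrary power profile to two totals, the receiver's on-time
    and the energy drawn, which is all that Jensen's inequality would use. *)
Lemma offline_bits (B0 : R) (e r : nat -> R) n :
  offline_transmits w Ct Cr Pr g B0 e r n ->
  exists u v : nat -> R,
    [/\ forall i, (i < n)%N -> 0 <= u i /\ u i <= battery Ct e u i,
        forall i, (i < n)%N -> 0 <= v i /\ v i <= battery Cr r v i,
        forall i, (i < n)%N -> v i <= Pr * w &
        forall k m : R, 0 <= k -> 0 <= m ->
          (forall x, 0 <= x -> g x <= k + m * x) ->
          B0 <= k * (\sum_(i < n) v i / Pr) + m * \sum_(i < n) u i].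
Proof.
move=> [p [on [u [v [[mp mon] p0 hu hv hB]]]]].
have mslot i : measurable (slot w i) by exact: measurable_itv.
have lv i : (i < n)%N -> lebesgue_measure (on `&` slot w i) = (v i / Pr)%:E.
  move=> /hv[E _]; have := congr1 (fun z => (Pr^-1)%:E * z)%E E.
  by rewrite muleA -EFinM mulVf ?gt_eqF// mul1e => ->; rewrite -EFinM mulrC.
exists u, v; split.
- move=> i iN; have [E h] := hu _ iN; split => //.
  by rewrite -lee_fin -E; apply: integral_ge0 => t _; rewrite lee_fin.
- move=> i iN; have [E h] := hv _ iN; split => //.
  by rewrite -lee_fin -E mule_ge0// lee_fin ltW.
- move=> i iN; have [E _] := hv _ iN; rewrite -lee_fin -E EFinM.
  apply: lee_wpmul2l; first by rewrite lee_fin ltW.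
  apply: (@le_trans _ _ (lebesgue_measure (slot w i))).
    apply: le_measure; last by move=> x [].
      apply/mem_set. apply: measurableI; [exact: mon|exact: mslot].
    by apply/mem_set; exact: mslot.
  rewrite /slot lebesgue_measure_itv/= lte_fin ltr_pM2r// ltr_nat ltnSn -EFinB lee_fin.
  by rewrite -natr1; lra.
move=> k m k0 m0 hg; rewrite -lee_fin; apply: (le_trans hB).
have mh D : measurable_fun D (fun t => (k + m * p t)%:E).
  apply/measurable_EFinP; apply: measurable_funD => //; apply: measurable_funM => //.
  exact: measurable_funTS.
have h0 t : (0 <= (k + m * p t)%:E)%E by rewrite lee_fin addr_ge0// mulr_ge0.
have mon' i : measurable (on `&` slot w i) by exact: measurableI.
apply: (@le_trans _ _
  (\int[lebesgue_measure]_(t in on `&` `[0%R, (n%:R * w)%R[) (k + m * p t)%:E)%E).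
  rewrite [leLHS]integral_mkcond [leRHS]integral_mkcond; apply: ge0_le_integral_nonmeasurable => t.
    by apply: erestrict_ge0 => x _; rewrite lee_fin (rate_ge0 g_rate).
  by apply: lee_restrict => x _; rewrite lee_fin hg.
have main i : (i <= n)%N ->
    (\int[lebesgue_measure]_(t in on `&` `[0%R, (i%:R * w)%R[) (k + m * p t)%:E <=
     (k * (\sum_(j < i) v j / Pr) + m * \sum_(j < i) u j)%:E)%E.
  elim: i => [_|i IH iN].
    by rewrite mul0r set_itvco0 setI0 integral_set0 !big_ord0 !mulr0 addr0.
  rewrite slot_cat setIUr ge0_integral_setU//; last 4 first.
  - by apply: measurableI; [exact: mon|exact: measurable_itv].
  - exact: mon'.
  - exact: mh.
  - apply/disj_setPS => t [[_ h1] [_ h2]]; move: h1 h2; rewrite /slot/= !in_itv/=.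
    by move=> /andP[_ h1] /andP[h2 _]; move: (lt_le_trans h1 h2); rewrite ltxx.
  rewrite !big_ord_recr/=.
  have -> : (k * (\sum_(j < i) v j / Pr + v i / Pr) + m * (\sum_(j < i) u j + u i))%:E =
    ((k * (\sum_(j < i) v j / Pr) + m * \sum_(j < i) u j)%:E +
     (k%:E * (v i / Pr)%:E + m%:E * (u i)%:E))%E.
    by rewrite -!EFinM -!EFinD; congr (_%:E); ring.
  apply: leeD; first exact: IH (ltnW iN).
  under eq_integral do rewrite EFinD EFinM.
  rewrite ge0_integralD//; last 3 first.
  - exact: mon'.
  - by move=> t _; rewrite mule_ge0// lee_fin.
  - apply: emeasurable_funM => //; apply/measurable_EFinP; exact: measurable_funTS.
  rewrite integral_cst; last exact: mon'.
  apply: leeD; first by rewrite [X in (k%:E * X <= _)%E](lv _ iN).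
  rewrite ge0_integralZl//; last 3 first.
  - exact: mon'.
  - by apply/measurable_EFinP; exact: measurable_funTS.
  - by move=> t _; rewrite lee_fin.
  apply: lee_wpmul2l; first by rewrite lee_fin.
  have [<- _] := hu _ iN.
  apply: ge0_subset_integral; [exact: mon'|exact: mslot| |by move=> t _; rewrite lee_fin|].
    by apply/measurable_EFinP; exact: measurable_funTS.
  by move=> t [].
exact: main.
Qed.

(** [al] caps the draw of every slot, and the line is taken at al / w. It serves twice: al = Ct
    bounds all schedules, al = Ct / c those of a transmitter that got at most the threshold. *)
Lemma offline_le_slots (B0 al : R) (e r : nat -> R) n : 0 < al ->
  (forall i, 0 <= e i) -> (Ct <= al \/ \sum_(i < n) e i <= al) ->
  offline_transmits w Ct Cr Pr g B0 e r n -> B0 <= n%:R * bits_of_energy w g al.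
Proof.
move=> al0 e0 hal /offline_bits[u [v [hu hv vw hB]]].
have aw : 0 < al / w by rewrite divr_gt0.
have [m [m0 ma hm]] := rate_supporting_line g_rate aw.
have k0 : 0 <= g (al / w) - m * (al / w) by rewrite subr_ge0.
have line x : 0 <= x -> g x <= g (al / w) - m * (al / w) + m * x.
  by move=> /hm; lra.
apply: (le_trans (hB _ _ k0 m0 line)).
have uN : \sum_(i < n) u i <= n%:R * al.
  rewrite -[n in n%:R]card_ord mulr_natl -sumr_const; apply: ler_sum => i _.
  have [u0 ub] := hu i (ltn_ord i); apply: (le_trans ub).
  case: hal => h; first exact: le_trans (battery_le_capacity _ _ _ _) h.
  by apply: le_trans h; apply: battery_le_arrived => // j jn; case: (hu j jn).
have vN : \sum_(i < n) v i / Pr <= n%:R * w.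
  rewrite -[n in n%:R]card_ord mulr_natl -sumr_const; apply: ler_sum => i _.
  by rewrite ler_pdivrMr// mulrC vw.
apply: (le_trans (lerD (ler_wpM2l k0 vN) (ler_wpM2l m0 uN))).
by rewrite /bits_of_energy le_eqVlt; apply/orP; left; apply/eqP; field; rewrite gt_eqF.
Qed.

(** The receiver can be on for a total time of at most w, so nothing beats spending all the energy
    at constant power during one slot length. *)
Lemma offline_le_total (B0 : R) (e r : nat -> R) n :
  0 < \sum_(i < n) e i -> \sum_(i < n) r i <= Pr * w ->
  offline_transmits w Ct Cr Pr g B0 e r n ->
  B0 <= bits_of_energy w g (\sum_(i < n) e i).
Proof.
set S := \sum_(i < n) e i => S0 rw /offline_bits[u [v [hu hv vw hB]]].
have aw : 0 < S / w by rewrite divr_gt0.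
have [m [m0 ma hm]] := rate_supporting_line g_rate aw.
have k0 : 0 <= g (S / w) - m * (S / w) by rewrite subr_ge0.
have line x : 0 <= x -> g x <= g (S / w) - m * (S / w) + m * x.
  by move=> /hm; lra.
apply: (le_trans (hB _ _ k0 m0 line)).
have uN : \sum_(i < n) u i <= S by exact: battery_budget hu.
have vN : \sum_(i < n) v i / Pr <= w.
  rewrite -mulr_suml ler_pdivrMr// mulrC; apply: le_trans rw; exact: battery_budget hv.
apply: (le_trans (lerD (ler_wpM2l k0 vN) (ler_wpM2l m0 uN))).
by rewrite /bits_of_energy le_eqVlt; apply/orP; left; apply/eqP; field; rewrite gt_eqF.
Qed.

Lemma offline_slots_ge (B0 : R) (e r : nat -> R) (M : nat) :
  (forall n, offline_transmits w Ct Cr Pr g B0 e r n -> (M <= n)%N) ->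
  ((M%:R)%:E <= offline_slots w Ct Cr Pr g B0 e r)%E.
Proof.
move=> h; apply: le_ereal_inf_tmp => _ [n hn <-]; rewrite lee_fin ler_nat; exact: h.
Qed.

End Offline.

(** * Real inequalities behind the final bound *)

Section RealBounds.
Context {R : realType}.

Lemma nat_ceil (x : R) : 0 < x -> exists n : nat, n%:R < x /\ x <= n.+1%:R.
Proof.
move=> x0; have ex : exists n : nat, x <= n%:R.
  by exists (Num.truncn x).+1; rewrite ltW// truncnS_gt.
have [[|n] hn nmin] := ex_minnP ex; first by move: hn; rewrite leNgt x0.
exists n; split => //; rewrite ltNge; apply/negP => /nmin; by rewrite ltnn.
Qed.

(* [M] slots are the offline minimum, [P] is the probability that the receiver alone
   delayed several dumps, [Phi] the mean time to make up for them and [y * G] the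
   number of bits, [G] being the bits of a full dump; [Q] bounds the probability
   that one of [k1] rounds is not full. *)
Lemma expected_ratio_arith (rho M N N2 X a b tau z D P Phi : R) :
  1 <= rho -> 1 <= M -> 0 <= X -> N = N2 + X -> N2 <= a -> X + 1 <= b ->
  0 <= N2 -> 0 <= P <= 1 -> 0 <= D -> 0 <= z -> tau = b + z * D ->
  (P = 0 \/ N2 + Phi <= rho * M * N \/
   exists q Q k1 y, [/\ 0 <= Q <= 1, Q <= k1 * q, Phi <= (k1 + Q) * N &
     [/\ q * N2 + X + 1 <= tau, 0 <= k1 <= rho * (y - 1), y <= M, M - 1 <= y &
         P * (y * D) <= M /\ (y - 1) * z * rho <= (M - 1) * (rho - 1)]]) ->
  1 + (1 - P) * (rho * N) + M^-1 * (P * (N2 + Phi)) <= rho * (a + b).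
Proof.
move=> rho1 M1 X0 NE N2a Xb N20 /andP[P0 P1] D0 z0 tauE H.
have M0 : 0 < M by lra.
(* The 1 is paid by X + 1 <= b, as rho >= 1. *)
have base : 1 + rho * N <= rho * (N2 + b) by rewrite NE; nra.
have ab : rho * (N2 + b) <= rho * (a + b) by rewrite ler_pM2l ?lerD2r; lra.
have N0 : 0 <= N by rewrite NE addr_ge0.
case: H => [->|[hPhi|[q [Q [k1 [y [/andP[Q0 Q1] Qq hPhi [hq /andP[k0 ky] yM My [hP hz]]]]]]]]].
- by rewrite mul0r mulr0 addr0 subr0 mul1r (le_trans base).
- have : M^-1 * (P * (N2 + Phi)) <= P * (rho * N).
    rewrite ler_pdivrMl//; have := ler_wpM2l P0 hPhi; lra.
  by lra.
have kM : k1 <= rho * (M - 1) by apply: (le_trans ky); rewrite ler_pM2l; lra.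
have kz : k1 * z <= (M - 1) * (rho - 1).
  by apply: le_trans hz; rewrite mulrAC; apply: ler_wpM2r => //; rewrite mulrC.
(* Since k1 <= rho * (M - 1), the overrun beyond rho * M mean rounds is at most Q * N2; then Q <= k1
   * q and q * N2 <= tau - 1 - X split it along tau = b + z * D. *)
have Phi_le : N2 + Phi - rho * M * N <= k1 * (b - 1 - X) + k1 * (z * D).
  have e1 : N2 + Phi - rho * M * N <= Q * N2.
    have : k1 * N <= rho * (M - 1) * N by exact: ler_wpM2r.
    have : 0 <= (rho - 1) * N by rewrite mulr_ge0// subr_ge0.
    have : 0 <= (1 - Q) * X by rewrite mulr_ge0// subr_ge0.
    move: hPhi; rewrite NE; lra.
  apply: (le_trans e1).
  have : Q * N2 <= k1 * q * N2 by exact: ler_wpM2r.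
  have : k1 * (q * N2) <= k1 * (tau - 1 - X) by apply: ler_wpM2l => //; lra.
  rewrite tauE; lra.
have d0 : 0 <= b - 1 - X by lra.
have H1 : P * (k1 * (b - 1 - X)) <= M * (rho * (b - 1 - X)).
  have : P * (k1 * (b - 1 - X)) <= k1 * (b - 1 - X).
    by rewrite ler_piMl// mulr_ge0.
  have : k1 * (b - 1 - X) <= (rho * M) * (b - 1 - X) by apply: ler_wpM2r => //; lra.
  lra.
(* M - 1 <= y turns [kz] into k1 * z <= y * (rho - 1), and P * (y * D) <= M then removes y and D. *)
have H2 : P * (k1 * (z * D)) <= M * (rho - 1).
  have r0 : 0 <= rho - 1 by lra.
  have PD0 : 0 <= P * D by rewrite mulr_ge0.
  have : P * D * (k1 * z) <= P * D * (y * (rho - 1)).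
    by apply: ler_wpM2l => //; apply: (le_trans kz); exact: ler_wpM2r.
  have : P * (y * D) * (rho - 1) <= M * (rho - 1) by exact: ler_wpM2r.
  lra.
have H3 : P * (N2 + Phi) <= M * (P * (rho * N)) + M * (rho * (b - 1 - X)) + M * (rho - 1).
  have := ler_wpM2l P0 Phi_le; lra.
have : M^-1 * (P * (N2 + Phi)) <= P * (rho * N) + rho * (b - 1 - X) + (rho - 1).
  by rewrite ler_pdivrMl//; lra.
move: ab; rewrite NE; lra.
Qed.

Lemma ratio_le (Son Soff V : \bar R) (M D : nat) :
  (0 < M)%N -> (M <= D)%N -> (0 <= V)%E -> (0 <= Son)%E ->
  (Son <= (M%:R)%:E + V)%E -> ((D%:R)%:E <= Soff)%E ->
  (Son / Soff <= 1 + (D%:R^-1)%:E * V)%E.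
Proof.
move=> M0 MD V0 Son0 hon hoff.
have D0 : (0 : R) < D%:R by rewrite ltr0n (leq_trans M0).
have DV : (Soff^-1 <= (D%:R^-1)%:E)%E.
  case: Soff hoff => [x|_|]; last by rewrite leeNy_eq.
    rewrite lee_fin => Dx; rewrite inver gt_eqF ?(lt_le_trans D0)// lee_fin lef_pV2 ?posrE//.
    exact: lt_le_trans Dx.
  by rewrite invey lee_fin invr_ge0 ltW.
have Soff0 : (0 <= Soff^-1)%E by rewrite inve_ge0 (le_trans _ hoff)// lee_fin ltW.
apply: (@le_trans _ _ (Son * (D%:R^-1)%:E)%E); first by apply: lee_wpmul2l.
apply: (@le_trans _ _ (((M%:R)%:E + V) * (D%:R^-1)%:E)%E).
  by apply: lee_wpmul2r => //; rewrite lee_fin invr_ge0 ltW.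
rewrite ge0_muleDl//; apply: leeD; last by rewrite muleC.
by rewrite -EFinM lee_fin ler_pdivrMr// mul1r ler_nat.
Qed.

Lemma le_nneseries_eq0 (u : R) (v : nat -> \bar R) : 0 <= u ->
  (forall n, u%:E <= v n)%E -> (\sum_(n <oo) v n < +oo)%E -> u = 0.
Proof.
move=> u0 uv voo; apply/eqP; rewrite eq_le u0 andbT leNgt; apply/negP => u1.
have : (\sum_(n <oo) u%:E <= \sum_(n <oo) v n)%E.
  by apply: lee_nneseries => [n _ _|n _]; [rewrite lee_fin|exact: uv].
have -> : (\sum_(n <oo) u%:E = +oo)%E.
  transitivity (\sum_(n <oo) (u%:E * 1%:E))%E.
    by apply: eq_eseriesr => i _; rewrite mule1.
  by rewrite nneseriesZl// nneseries1 gt0_muley ?lte_fin.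
by move=> h; move: (le_lt_trans h voo).
Qed.

(** One supporting line at Ct / w bounds the growth of g above this point and its drop below it; the
    common slope is eliminated. *)
Lemma supporting_line_gap (w Ct c : R) (g : R -> R) (M : R) : rate_function g ->
  0 < w -> 0 < Ct -> 1 <= c -> 1 <= M ->
  (bits_of_energy w g (M * Ct) - bits_of_energy w g Ct) * (1 - c^-1) <=
  (M - 1) * (bits_of_energy w g Ct - bits_of_energy w g (Ct / c)).
Proof.
move=> g_rate w0 C0 c1 M1; have c0 : 0 < c by lra.
have aw : 0 < Ct / w by rewrite divr_gt0.
have [m [m0 ma hm]] := rate_supporting_line g_rate aw.
have h1 : g (M * Ct / w) <= g (Ct / w) + m * (M * Ct / w - Ct / w).
  by apply: hm; rewrite divr_ge0 ?mulr_ge0; lra.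
have h2 : g (Ct / c / w) <= g (Ct / w) + m * (Ct / c / w - Ct / w).
  by apply: hm; rewrite divr_ge0 ?divr_ge0; lra.
have z0 : 0 <= 1 - c^-1 by rewrite subr_ge0 invf_le1.
suff h : (g (M * Ct / w) - g (Ct / w)) * (1 - c^-1) <= (M - 1) * (g (Ct / w) - g (Ct / c / w)).
  by have := ler_wpM2l (ltW w0) h; rewrite /bits_of_energy; lra.
have h1' : g (M * Ct / w) - g (Ct / w) <= m * (Ct / w) * (M - 1) by lra.
have h2' : m * (Ct / w) * (1 - c^-1) <= g (Ct / w) - g (Ct / c / w).
  have -> : m * (Ct / w) * (1 - c^-1) = m * (Ct / w - Ct / c / w) by field; rewrite !gt_eqF.
  by lra.
apply: (le_trans (ler_wpM2r z0 h1')); rewrite mulrAC [leLHS]mulrC.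
by apply: ler_wpM2l => //; lra.
Qed.

End RealBounds.

(** * Boolean events, and costs incurred after a fixed slot *)

Section BoolEvents.
Context {R : realType}.
Variable nu : probability (path R) R.

Lemma measurable_bool_set (b : path R -> bool) :
  measurable_fun [set: path R] b -> measurable [set om | b om].
Proof. by move=> mb; rewrite -[mkset _]setTI; exact: mb measurableT [set true] _. Qed.

Lemma indic_bool_set (b : path R -> bool) om : \1_[set om | b om] om = (b om)%:R :> R.
Proof.
rewrite indicE; suff -> : (om \in [set om | b om]) = b om by [].
by apply/idP/idP; rewrite inE.
Qed.

Lemma probability_bool_split (b1 b2 : path R -> bool) :
  measurable_fun [set: path R] b1 -> measurable_fun [set: path R] b2 ->
  nu [set om | b1 om] = (nu [set om | b1 om && b2 om] + nu [set om | b1 om && ~~ b2 om])%E.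
Proof.
move=> mb1 mb2.
have m1 : measurable [set om | b1 om && b2 om].
  by apply: measurable_bool_set; exact: measurable_and.
have m2 : measurable [set om | b1 om && ~~ b2 om].
  by apply: measurable_bool_set; apply: measurable_and => //; exact: measurable_neg.
rewrite -measureU//; last first.
  by apply/seteqP; split => // om [/andP[_ h] /andP[_ /negP]].
congr (nu _); apply/seteqP; split => om /=.
  by move=> ->; case: (b2 om); [left|right].
by move=> [/andP[]|/andP[]].
Qed.

End BoolEvents.

Section EventCost.
Local Open Scope ereal_scope.
Context {R : realType}.
Variable nu : probability (path R) R.
Hypothesis inv_past : forall n, reindex_invariant nu (before n) (past_future n).

(** The event is to be decided before [M] and the cost starts at [M], so its mean factorises by
    renewal; [ka] stands for the inverse of an offline lower bound. *)
Definition event_cost (M : nat) (b : path R -> bool) (ka : R) (cost : path R -> \bar R) om :=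
  ka%:E * ((\1_[set om | b om] om)%:E * cost (shift M om)).

Lemma event_cost_ge0 M (b : path R -> bool) (ka : R) (cost : path R -> \bar R) om :
  (0 <= ka)%R -> (forall om, 0 <= cost om) -> 0 <= event_cost M b ka cost om.
Proof. by move=> k0 c0; rewrite /event_cost mule_ge0 ?lee_fin// mule_ge0 ?lee_fin. Qed.

Lemma measurable_event_cost M (b : path R -> bool) (ka : R) (cost : path R -> \bar R) :
  measurable_fun [set: path R] b -> measurable_fun [set: path R] cost ->
  measurable_fun [set: path R] (event_cost M b ka cost).
Proof.
move=> mb mc; apply: emeasurable_funM => //; apply: measurable_indic_shift => //.
exact: measurable_bool_set.
Qed.

Lemma integral_event_cost M (b : path R -> bool) (ka : R) (cost : path R -> \bar R)
    (C be : R) : measurable_fun [set: path R] b ->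
  measurable_fun [set: path R] cost -> (forall om, 0 <= cost om) -> (0 <= ka)%R ->
  adapted M [set om | b om] -> \int[nu]_om cost om <= C%:E -> (ka * C <= be)%R ->
  \int[nu]_om event_cost M b ka cost om <= nu [set om | b om] * be%:E.
Proof.
move=> mb mc c0 k0 adb hC hbe; have mB := measurable_bool_set mb.
have mc' := measurable_indic_shift M mB mc.
rewrite ge0_integralZl//; last by move=> om _; rewrite mule_ge0 ?lee_fin.
rewrite renewal// muleCA; apply: lee_wpmul2l => //.
apply: (@le_trans _ _ (ka%:E * C%:E)); first by apply: lee_wpmul2l.
by rewrite -EFinM lee_fin.
Qed.

Lemma indicator_true (b : path R -> bool) om : b om -> (\1_[set om | b om] om)%:E = 1 :> \bar R.
Proof. by rewrite indic_bool_set => ->. Qed.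

End EventCost.

(** * The ratio on path space: case distinction and expectation *)

Section PathTheorem.
Context {R : realType}.
Variables (nu : probability (path R) R) (ie ir : path R -> R).
Variables (w Ct Cr Pr B0 c : R) (g : R -> R).
Hypothesis w_gt0 : 0 < w.
Hypothesis Ct_gt0 : 0 < Ct.
Hypothesis Pr_gt0 : 0 < Pr.
Hypothesis B0_gt0 : 0 < B0.
Hypothesis c_ge1 : 1 <= c.
Hypothesis g_rate : rate_function g.
Hypothesis mie : measurable_fun [set: path R] ie.
Hypothesis mir : measurable_fun [set: path R] ir.
Hypothesis ie_local : forall om om' : path R,
  (forall i, (time i < 1)%N -> om i = om' i) -> ie om = ie om'.
Hypothesis ir_local : forall om om' : path R,
  (forall i, (time i < 1)%N -> om i = om' i) -> ir om = ir om'.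
Hypothesis ie_left : forall om om' : path R,
  (forall j, om (inl j) = om' (inl j)) -> ie om = ie om'.
Hypothesis ir_right : forall om om' : path R,
  (forall j, om (inr j) = om' (inr j)) -> ir om = ir om'.
Hypothesis ie_ge0 : forall om, 0 <= ie om.
Hypothesis ir_ge0 : forall om, 0 <= ir om.
Hypothesis ie_le : forall om, ie om <= Ct.
Hypothesis inv_past : forall n, reindex_invariant nu (before n) (past_future n).
Hypothesis inv_left : reindex_invariant nu is_left id.

Let th := Ct / c.
Let rh := Pr * w.
Let c_gt0 : 0 < c := lt_le_trans ltr01 c_ge1.
Let th_gt0 : 0 < th := divr_gt0 Ct_gt0 c_gt0.
Let rh_gt0 : 0 < rh := mulr_gt0 Pr_gt0 w_gt0.
Let th_le : th <= Ct. Proof. by rewrite ler_pdivrMr// ler_peMr// ltW. Qed.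
Let g_mono : forall p q : R, 0 <= p -> p <= q -> g p <= g q := rate_nondecreasing g_rate.

Variables (mE a b tau : R).
Hypothesis mE_gt0 : 0 < mE.
Hypothesis mEE : (\int[nu]_om (ie om)%:E = mE%:E)%E.
Hypothesis a_bound : (passage ir nu rh <= a%:E)%E.
Hypothesis b_bound : (passage ie nu th <= b%:E)%E.
Hypothesis tau_bound : (passage ie nu Ct <= tau%:E)%E.
Hypothesis tauE : tau = b + (1 - c^-1) * (Ct / mE).

Notation bits := (bits_of_energy w g).
Notation met := (both_reached ie ir th rh).
Notation first_met := (first_met ie ir th rh).
Notation se := (walk ie).
Notation sr := (walk ir).

Definition recurrent_paths : set (path R) :=
  \bigcap_(s in setT) \bigcup_(n in setT) (shift s @^-1` [set om | met n om]).

Definition path_ratio (om : path R) : \bar R :=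
  (online_slots w Ct Pr c g B0 (steps ie om) (steps ir om) /
   offline_slots w Ct Cr Pr g B0 (steps ie om) (steps ir om))%E.

Let G := bits Ct.
Let L := bits th.
Let rho := G / L.
Let y := B0 / G.

Let G_gt0 : 0 < G. Proof. by rewrite mulr_gt0// (rate_gt0 g_rate)// divr_gt0. Qed.
Let L_gt0 : 0 < L. Proof. by rewrite mulr_gt0// (rate_gt0 g_rate)// divr_gt0. Qed.
Let L_le_G : L <= G.
Proof. by apply: bits_of_energy_mono => //; exact: ltW. Qed.
Let rho_ge1 : 1 <= rho. Proof. by rewrite ler_pdivlMr// mul1r. Qed.
Let y_gt0 : 0 < y. Proof. exact: divr_gt0. Qed.
Let xE : rho * y = B0 / L.
Proof. by rewrite /rho /y; field; rewrite !gt_eqF. Qed.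

Let measurable_met_shift s n : measurable (@shift R s @^-1` [set om | met n om]).
Proof.
rewrite -[_ @^-1` _]setTI; apply: measurable_shift => //.
by apply: measurable_bool_set; exact: measurable_met.
Qed.

Lemma measurable_recurrent_paths : measurable recurrent_paths.
Proof. by apply: bigcapT_measurable => s; exact: bigcupT_measurable. Qed.

Lemma recurrentP om : recurrent_paths om -> forall s, exists n, met n (shift s om).
Proof. by move=> h s; have [n _ hn] := h s I; exists n. Qed.

Let T2fin : passage ir nu rh \is a fin_num.
Proof. by rewrite ge0_fin_numE ?passage_ge0// (le_lt_trans a_bound) ?ltry. Qed.

Let T2oo : (passage ir nu rh < +oo)%E. Proof. by rewrite (le_lt_trans a_bound) ?ltry. Qed.

Let T1oo : (passage ie nu th < +oo)%E. Proof. by rewrite (le_lt_trans b_bound) ?ltry. Qed.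

Notation excess := (waiting_excess ie ir nu th rh).

Let excess_ge0 : (0 <= excess)%E. Proof. by apply: nneseries_ge0. Qed.

Let excess_le : (excess + 1 <= passage ie nu th)%E.
Proof. exact: waiting_excess_le. Qed.

Let excess_fin : excess \is a fin_num.
Proof.
rewrite ge0_fin_numE//; apply: (le_lt_trans _ T1oo); apply: le_trans excess_le.
by rewrite leeDl.
Qed.

Let N2 := fine (passage ir nu rh).
Let X := fine excess.
Let N := N2 + X.

Let wait_mean : (\int[nu]_om wait ie ir th rh om = N%:E)%E.
Proof.
by rewrite integral_wait// passage_met// EFinD !fineK.
Qed.

(** Never meeting the thresholds lies in every event of not having met them by n, and the
    probabilities of these are summable because the mean wait is finite. Renewal carries this to
    every starting slot. *)
Lemma recurrent_paths_full : nu (~` recurrent_paths) = 0%E.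
Proof.
have mn s : measurable (~` \bigcup_(n in setT) (shift s @^-1` [set om | met n om])).
  by apply: measurableC; exact: bigcupT_measurable.
rewrite setC_bigcap; apply/eqP; rewrite eq_le measure_ge0 andbT.
have hs s : nu (~` \bigcup_(n in setT) (shift s @^-1` [set om | met n om])) = 0%E.
  set A := ~` _; pose A0 := ~` \bigcup_(n in setT) [set om | met n om].
  have mA0 : measurable A0.
    apply: measurableC; apply: bigcupT_measurable => n.
    by apply: measurable_bool_set; exact: measurable_met.
  have -> : A = setT `&` shift s @^-1` A0.
    rewrite setTI /A /A0; apply/seteqP; split=> om h;
    by move=> [n _ hn]; apply: h; exists n.
  rewrite (probability_renewal inv_past)// [X in (X * _)%E]probability_setT mul1e.
  have fA0 : nu A0 \is a fin_num by exact: fin_num_measure.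
  rewrite -(fineK fA0); congr (_%:E).
  apply: (@le_nneseries_eq0 _ _ (fun n => nu [set om | ~~ met n om])).
  - by rewrite fine_ge0.
  - move=> n; rewrite fineK//; apply: le_measure; rewrite ?inE//.
      exact: measurable_not_met.
    by move=> om h /=; apply/negP => hm; apply: h; exists n.
  - by rewrite -integral_wait// wait_mean ltry.
have mU := bigcupT_measurable _ mn.
apply: (le_trans (measure_sigma_subadditive nu mn mU (@subset_refl _ _))).
rewrite le_eqVlt; apply/orP; left; apply/eqP; apply: eseries0 => s _ _; exact: hs.
Qed.

(** The ceilings of y = B0 / G and of rho * y = B0 / L, less one. The strict inequality K < rho * y
    gives K / M <= rho, and the same with both K and M increased by one. *)
Variables (m K : nat).
Hypothesis m_lt : m%:R < y.
Hypothesis m_ge : y <= m.+1%:R.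
Hypothesis K_lt : K%:R < rho * y.
Hypothesis K_ge : rho * y <= K.+1%:R.
Let M := m.+1.

Let B0_rounds : B0 <= K.+1%:R * L.
Proof. by move: K_ge; rewrite xE ler_pdivrMr. Qed.

Let offline_ge om : ((M%:R)%:E <=
  offline_slots w Ct Cr Pr g B0 (steps ie om) (steps ir om))%E.
Proof.
apply: offline_slots_ge => n hn.
have := offline_le_slots w_gt0 Pr_gt0 g_rate Ct_gt0 (fun i => ie_ge0 _) (or_introl (lexx Ct)) hn.
rewrite -/G -ler_pdivrMr// -/y => yn.
by rewrite /M -(ltr_nat R) (lt_le_trans m_lt).
Qed.

Let offline_gt om :
  ~ offline_transmits w Ct Cr Pr g B0 (steps ie om) (steps ir om) M ->
  ((M.+1%:R)%:E <= offline_slots w Ct Cr Pr g B0 (steps ie om) (steps ir om))%E.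
Proof.
move=> hM; apply: offline_slots_ge => n hn; rewrite ltn_neqAle.
apply/andP; split; first by apply/eqP => E; apply: hM; rewrite E.
have := offline_le_slots w_gt0 Pr_gt0 g_rate Ct_gt0 (fun i => ie_ge0 _) (or_introl (lexx Ct)) hn.
rewrite -/G -ler_pdivrMr// -/y => yn.
by rewrite /M -(ltr_nat R) (lt_le_trans m_lt).
Qed.

Let enough_energy om := th <= se M om.
Let enough_receiver om := rh <= sr M om.
Let deliverable om := B0 <= bits (se M om).
Let dumpable om := B0 <= bits (Num.min Ct (se M om)).

(** [done_by_M], [low_energy], [undeliverable], [one_dump] and [several_dumps] partition the paths
    and are decided by the first [M] slots. *)
Let done_by_M om := enough_energy om && enough_receiver om.
Let low_energy om := ~~ enough_energy om.
Let starved om := enough_energy om && ~~ enough_receiver om.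
Let undeliverable om := starved om && ~~ deliverable om.
Let one_dump om := (starved om && deliverable om) && dumpable om.
Let several_dumps om := (starved om && deliverable om) && ~~ dumpable om.

Let measurable_bits (f : path R -> R) : measurable_fun [set: path R] f ->
  (forall om, 0 <= f om) -> measurable_fun [set: path R] (fun om => bits (f om)).
Proof.
(* g is monotone only on [0, +oo[; extended by g 0 to the left it is monotone on the line, hence
   measurable. *)
move=> mf f0; pose g0 x := g (Num.max 0 x).
have mg0 : measurable_fun [set: R] g0.
  apply: nondecreasing_measurable => // p q pq; apply: g_mono.
    by rewrite le_max lexx.
  by rewrite ge_max !le_max lexx pq orbT.
rewrite (_ : (fun _ => _) = (fun om => w * g0 (f om / w))); last first.
  apply/funext => om; rewrite /bits_of_energy /g0 max_r// divr_ge0//; exact: ltW.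
apply: measurable_funM => //; apply: (measurableT_comp mg0).
exact: measurable_funM.
Qed.

Let m_energy : measurable_fun [set: path R] enough_energy.
Proof. by apply: measurable_fun_ler => //; exact: measurable_walk. Qed.

Let m_receiver : measurable_fun [set: path R] enough_receiver.
Proof. by apply: measurable_fun_ler => //; exact: measurable_walk. Qed.

Let m_deliverable : measurable_fun [set: path R] deliverable.
Proof.
apply: measurable_fun_ler => //; apply: measurable_bits; first exact: measurable_walk.
by move=> om; exact: walk_ge0.
Qed.

Let m_dumpable : measurable_fun [set: path R] dumpable.
Proof.
apply: measurable_fun_ler => //; apply: measurable_bits.
  by apply: measurable_minr => //; exact: measurable_walk.
by move=> om; rewrite le_min ltW ?walk_ge0.
Qed.

Let m_starved : measurable_fun [set: path R] starved.
Proof. by apply: measurable_and => //; exact: measurable_neg. Qed.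

Let m_sd : measurable_fun [set: path R] (fun om => starved om && deliverable om).
Proof. exact: measurable_and. Qed.

Let m_done : measurable_fun [set: path R] done_by_M.
Proof. exact: measurable_and. Qed.

Let m_low : measurable_fun [set: path R] low_energy.
Proof. exact: measurable_neg. Qed.

Let m_undeliverable : measurable_fun [set: path R] undeliverable.
Proof. by apply: measurable_and => //; exact: measurable_neg. Qed.

Let m_one : measurable_fun [set: path R] one_dump.
Proof. exact: measurable_and. Qed.

Let m_several : measurable_fun [set: path R] several_dumps.
Proof. by apply: measurable_and => //; exact: measurable_neg. Qed.

Let adapted_walks (P : R -> R -> bool) : adapted M [set om | P (se M om) (sr M om)].
Proof.
by move=> om om' h; rewrite /= (walk_local ie_local h) (walk_local ir_local h).
Qed.

Let prob (e : path R -> bool) : R := fine (nu [set om | e om]).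

Let probE (e : path R -> bool) : measurable_fun [set: path R] e ->
  nu [set om | e om] = (prob e)%:E.
Proof.
by move=> me; rewrite fineK// fin_num_measure//; exact: measurable_bool_set.
Qed.

Let prob_ge0 (e : path R -> bool) : 0 <= prob e. Proof. by rewrite fine_ge0. Qed.

Let prob_split2 (e1 e2 : path R -> bool) : measurable_fun [set: path R] e1 ->
  measurable_fun [set: path R] e2 ->
  prob e1 = prob (fun om => e1 om && e2 om) + prob (fun om => e1 om && ~~ e2 om).
Proof.
move=> me1 me2.
have m1 : measurable_fun [set: path R] (fun om => e1 om && e2 om) by exact: measurable_and.
have m2 : measurable_fun [set: path R] (fun om => e1 om && ~~ e2 om).
  exact: (measurable_and me1 (measurable_neg me2)).
apply: EFin_inj; rewrite EFinD -(probE me1) -(probE m1) -(probE m2).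
exact: probability_bool_split.
Qed.

Let prob_split : prob done_by_M + prob low_energy + prob undeliverable + prob one_dump +
  prob several_dumps = 1.
Proof.
have h0 : prob (fun=> true) = 1.
  by apply: EFin_inj; rewrite -probE// (_ : mkset _ = setT) ?probability_setT//; apply/seteqP.
have h1 := prob_split2 (measurable_cst true) m_energy.
have h2 := prob_split2 m_energy m_receiver.
have h3 := prob_split2 m_starved m_deliverable.
have h4 := prob_split2 m_sd m_dumpable.
move: h1 h2 h3 h4; rewrite h0 /=.
rewrite -/low_energy -/starved -/done_by_M -/undeliverable -/one_dump -/several_dumps.
by move=> h1 h2 h3 h4; lra.
Qed.

Notation rcost := (rounds_cost w Ct Pr c ie ir).
Notation rwait := (receiver_wait w Pr ir).

Let rcost_ge0 j om : (0 <= rcost j om)%E.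
Proof. by case: j => [|j] //=; exact: rounds_time_ge0. Qed.

Let m_rcost j : measurable_fun [set: path R] (rcost j).
Proof. by case: j => [|j]; [exact: measurable_cst|apply: measurable_rounds_time]. Qed.

Let not_full_prob : nu (not_full ie ir th Ct rh) = (fine (nu (not_full ie ir th Ct rh)))%:E.
Proof. by rewrite fineK// fin_num_measure//; exact: measurable_not_full. Qed.

Let integral_rcost j : (\int[nu]_om rcost j om <= (j%:R * N)%:E)%E.
Proof.
case: j => [|j]; first by rewrite integral0 mul0r.
exact: (rounds_time_true_le mie mir ie_local ir_local ie_ge0 ir_ge0 inv_past
  wait_mean not_full_prob).
Qed.

Let rwait_ge0 om : (0 <= rwait om)%E.
Proof. by apply: nneseries_ge0 => n _ _; rewrite lee_fin. Qed.

Let m_rwait : measurable_fun [set: path R] rwait.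
Proof.
apply: ge0_emeasurable_sum => i; first by move=> om _ _; rewrite lee_fin.
by move=> _; apply/measurable_EFinP; apply: measurable_indic; exact: measurable_below.
Qed.

Let integral_rwait : (\int[nu]_om rwait om = N2%:E)%E.
Proof.
rewrite integral_nneseries//.
  rewrite fineK//; apply: eq_eseriesr => i _; rewrite integral_indic ?setIT//.
  exact: measurable_below.
by move=> i; apply/measurable_EFinP; apply: measurable_indic; exact: measurable_below.
Qed.

Let N2_ge0 : 0 <= N2. Proof. by rewrite fine_ge0// passage_ge0. Qed.
Let X_ge0 : 0 <= X. Proof. by rewrite fine_ge0. Qed.
Let N_ge0 : 0 <= N. Proof. exact: addr_ge0. Qed.

Definition dumps_cost (Phi : path R -> \bar R) om : \bar R :=
  (\sum_(t <oo) (\1_([set om | several_dumps om] `&` first_met t `&`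
      [set _ | (M < t)%N]) om)%:E * Phi (shift t om))%E.

Let m_dumps_event t : measurable
  ([set om | several_dumps om] `&` first_met t `&` [set _ | (M < t)%N]).
Proof.
apply: measurableI; last first.
  by case: (ltnP M t) => h; [rewrite (_ : mkset _ = setT)|rewrite (_ : mkset _ = set0)] => //;
    apply/seteqP; split.
apply: measurableI; first exact: measurable_bool_set.
exact: measurable_first_met.
Qed.

Let adapted_dumps_event t : adapted t
  ([set om | several_dumps om] `&` first_met t `&` [set _ | (M < t)%N]).
Proof.
move=> om om' h [[h1 h2] Mt]; split => //; split; last exact: adapted_first_met h2.
pose P u v := ((th <= u) && ~~ (rh <= v) && (B0 <= bits u)) && ~~ (B0 <= bits (Num.min Ct u)).
apply: (@adapted_walks P om om' _ h1) => i iM; apply: h.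
exact: ltn_trans Mt.
Qed.

Let integral_dumps_cost (Phi : path R -> \bar R) (C : R) :
  measurable_fun [set: path R] Phi -> (forall om, 0 <= Phi om)%E ->
  (\int[nu]_om Phi om <= C%:E)%E ->
  (\int[nu]_om dumps_cost Phi om <= (prob several_dumps * C)%:E)%E.
Proof.
move=> mPhi Phi0 hC.
have C0 : 0 <= C.
  by rewrite -lee_fin; apply: le_trans hC; apply: integral_ge0 => om _.
rewrite integral_nneseries//; last 2 first.
- by move=> t; exact: measurable_indic_shift.
- by move=> t om _; rewrite mule_ge0// lee_fin.
apply: (@le_trans _ _ (\sum_(t <oo) (C%:E * nu ([set om | several_dumps om] `&`
    first_met t `&` [set _ | (M < t)%N])))%E).
  apply: lee_nneseries => [t _ _|t _].
    by apply: integral_ge0 => om _; rewrite mule_ge0// lee_fin.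
  by rewrite renewal// muleC lee_wpmul2r.
rewrite nneseriesZl// mulrC EFinM; apply: lee_wpmul2l; first by rewrite lee_fin.
rewrite (sum_first_met nu ie_ge0 ir_ge0 (th := th) (rh := rh) m_dumps_event); last first.
  by move=> t om [[]].
rewrite -probE//; apply: le_measure; rewrite ?inE//.
- by apply: bigcupT_measurable.
- exact: measurable_bool_set.
- by move=> om [t _ [[]]].
Qed.

Let m_dumps_cost (Phi : path R -> \bar R) : measurable_fun [set: path R] Phi ->
  (forall om, 0 <= Phi om)%E -> measurable_fun [set: path R] (dumps_cost Phi).
Proof.
move=> mPhi Phi0; apply: ge0_emeasurable_sum => t.
  by move=> om _ _; rewrite mule_ge0// lee_fin.
by move=> _; exact: measurable_indic_shift.
Qed.

Let dumps_cost_ge0 (Phi : path R -> \bar R) om :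
  (forall om, 0 <= Phi om)%E -> (0 <= dumps_cost Phi om)%E.
Proof. by move=> Phi0; apply: nneseries_ge0 => t _ _; rewrite mule_ge0// lee_fin. Qed.

(** [Phi] is a time allowance sufficient, from any slot, for what is left to send after one full
    dump. *)
Let tail_cost (Phi : path R -> \bar R) (PhiR : R) : Prop :=
  [/\ measurable_fun [set: path R] Phi, forall om, (0 <= Phi om)%E,
     (\int[nu]_om Phi om <= PhiR%:E)%E &
     forall om, recurrent_paths om -> several_dumps om -> forall s,
       exists (n J : nat) (B : R),
       [/\ run w Ct Pr c g (steps ie om) (steps ir om) J s n B,
           ((n%:R)%:E <= (s%:R)%:E + Phi (shift s om))%E & B0 <= G + B]].

Let se_le om : se M om <= M%:R * Ct.
Proof.
rewrite -[M in M%:R]card_ord mulr_natl -sumr_const.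
by apply: ler_sum => i _; exact: ie_le.
Qed.

(** As g(p)/p decreases, energy u >= Ct spent over one slot length carries at most G * u / Ct bits.
    Hence B0 bits take at least y * Ct, the level at which Markov's inequality is applied. *)
Let several_dumpsP om : several_dumps om ->
  [/\ th <= se M om, sr M om < rh, Ct < se M om, 1 < y & y * Ct <= se M om].
Proof.
move=> /andP[/andP[/andP[h1 h2] h3] h4].
have seC : Ct < se M om.
  rewrite ltNge; apply/negP => h; move/negP: h4; apply.
  by rewrite /dumpable min_r.
have B0G : G < B0 by move: h4; rewrite /dumpable min_l ?(ltW seC)// -ltNge.
split => //; first by rewrite ltNge.
  by rewrite ltr_pdivlMr// mul1r.
have u0 : 0 < se M om by exact: lt_trans seC.
have Cw : 0 < Ct / w by rewrite divr_gt0.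
have le2 : Ct / w <= se M om / w by rewrite ler_pM2r ?invr_gt0// ltW.
have := rate_per_power_nonincreasing g_rate Cw le2.
rewrite ler_pdivrMr ?divr_gt0// => hg.
have : B0 <= w * (g (Ct / w) / (Ct / w) * (se M om / w)).
  by apply: (le_trans h3); rewrite /bits_of_energy ler_pM2l.
have -> : w * (g (Ct / w) / (Ct / w) * (se M om / w)) = G * se M om / Ct.
  by rewrite /G /bits_of_energy; field; rewrite !gt_eqF.
rewrite ler_pdivlMr// => h.
by have -> : y * Ct = B0 * Ct / G; [rewrite /y mulrAC|rewrite ler_pdivrMr// [leRHS]mulrC].
Qed.

Let prob_several_le : prob several_dumps * (y * (Ct / mE)) <= M%:R.
Proof.
have mB : measurable [set om | several_dumps om] by exact: measurable_bool_set.
have h : ((prob several_dumps * (y * Ct))%:E <= (M%:R * mE)%:E)%E.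
  have -> : ((M%:R * mE)%:E = \int[nu]_om (se M om)%:E)%E.
    rewrite /walk; under eq_integral do rewrite -sumEFin.
    rewrite ge0_integral_sum//; last first.
    - by move=> i om _; rewrite lee_fin.
    - move=> i; apply/measurable_EFinP; exact: (measurableT_comp mie (measurable_shift i)).
    rewrite (eq_bigr (fun=> mE%:E)); last first.
      move=> i _; rewrite -mEE.
      apply: (@integral_shift R nu inv_past i (fun om => (ie om)%:E)).
        exact/measurable_EFinP.
      by move=> om; rewrite lee_fin.
    by rewrite sumEFin sumr_const card_ord mulr_natl.
  rewrite EFinM -probE// muleC.
  rewrite -[X in (_ * nu X)%E]setIT -integral_indic// -ge0_integralZl//; last 2 first.
  - by apply/measurable_EFinP; exact: measurable_indic.
  - by rewrite lee_fin mulr_ge0// ltW.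
  apply: ge0_le_integral_nonmeasurable => om.
    by rewrite mule_ge0// lee_fin// mulr_ge0// ltW.
  rewrite indic_bool_set -EFinM lee_fin; case: (boolP (several_dumps om)) => /= [|_].
    by move=> /several_dumpsP[]; rewrite mulr1.
  by rewrite mulr0 walk_ge0.
move: h; rewrite lee_fin => h.
have -> : prob several_dumps * (y * (Ct / mE)) = prob several_dumps * (y * Ct) / mE.
  by field; rewrite gt_eqF.
by rewrite ler_pdivrMr.
Qed.

Let dumps_alternative : exists (Phi : path R -> \bar R) (PhiR : R),
  tail_cost Phi PhiR /\
  (prob several_dumps = 0 \/ N2 + PhiR <= rho * M%:R * N \/
   exists q Q k1 y', [/\ 0 <= Q <= 1, Q <= k1 * q, PhiR <= (k1 + Q) * N &
     [/\ q * N2 + X + 1 <= tau, 0 <= k1 <= rho * (y' - 1), y' <= M%:R, M%:R - 1 <= y' &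
         prob several_dumps * (y' * (Ct / mE)) <= M%:R /\
         (y' - 1) * (1 - c^-1) * rho <= (M%:R - 1) * (rho - 1)]]).
Proof.
have [[om0 om0P]|none] := pselect (exists om, several_dumps om); last first.
  exists (fun=> 0%E), 0; split; last first.
    left; rewrite /prob (_ : mkset _ = set0) ?measure0//.
    by apply/seteqP; split => // om h; apply: none; exists om.
  split=> //; first by rewrite integral0.
  by move=> om _ h; case: none; exists om.
(* A single path of the event yields inequalities between constants: 1 < y here, and below that B0
   is at most the bits of M * Ct. *)
have [_ _ CM y1 yM] := several_dumpsP om0P.
have ry : 0 < rho * (y - 1) by rewrite mulr_gt0 ?subr_gt0// (lt_le_trans ltr01).
(* rho * (y - 1) = (B0 - G) / L, so k + 1 threshold dumps complete a full first dump. *)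
have [k [k_lt k_ge]] := nat_ceil ry.
have short : B0 <= G + k.+1%:R * L.
  have : rho * (y - 1) * L <= k.+1%:R * L by rewrite ler_pM2r.
  have -> : rho * (y - 1) * L = B0 - G by rewrite /rho /y; field; rewrite !gt_eqF.
  by rewrite lerBlDl.
have k_ge0 : 0 <= k%:R :> R by [].
(* In the easy case rounding up is harmless: all k + 2 rounds fit into rho * M mean rounds. *)
have [easy|hard] := leP k.+2%:R (rho * M%:R).
  exists (rcost k.+1), (k.+1%:R * N); split; last first.
    right; left; have : k.+2%:R * N <= rho * M%:R * N by exact: ler_wpM2r.
    have -> : k.+2%:R * N = N2 + X + k.+1%:R * N by rewrite -[k.+2%:R]natr1 mulrDl mul1r addrC.
    by move: X_ge0; lra.
  split; [exact: m_rcost|exact: rcost_ge0|exact: integral_rcost|].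
  move=> om rec _ s.
  have [n [B [rn nle]]] := rounds_cost_run w_gt0 Ct_gt0 c_ge1 g_mono ie_ge0 ir_ge0
    (recurrentP rec) k.+1 s.
  exists n, k.+1, B; split => //; apply: (le_trans short); rewrite lerD2l.
  exact: (run_bits_ge w_gt0 Ct_gt0 c_ge1 g_mono (fun i => ie_ge0 _) rn).
have [Q [Q01 Qq hQ]] := rounds_time_false_le mie mir ie_local ir_local ie_ge0 ir_ge0 inv_past
  wait_mean not_full_prob k.
exists (rounds_time ie ir th Ct rh false k), ((k%:R + Q) * N); split.
  split=> //.
  - exact: measurable_rounds_time.
  - by move=> om; exact: rounds_time_ge0.
  move=> om rec _ s.
  have [n [J [B [rn nle hJ]]]] := rounds_time_run w_gt0 Ct_gt0 c_ge1 g_mono ie_ge0 ir_ge0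
    (recurrentP rec) false k s.
  exists n, J, B; split => //.
  case: hJ => [JE|[_ JE kB]].
    apply: (le_trans short); rewrite lerD2l -JE.
    exact: (run_bits_ge w_gt0 Ct_gt0 c_ge1 g_mono (fun i => ie_ge0 _) rn).
  (* M <= rho * M < k + 2. Hence the first dump and k further full ones carry (k + 1) * G >= B0
     bits. *)
  have Mk : (M <= k.+1)%N.
    rewrite -ltnS -(ltr_nat R); apply: le_lt_trans hard.
    by rewrite ler_peMl// ltW.
  have : y * G <= k.+1%:R * G.
    by rewrite ler_pM2r//; apply: (le_trans m_ge); rewrite ler_nat.
  rewrite /y divfK ?gt_eqF// -natr1 mulrDl mul1r => h.
  by apply: (le_trans h); rewrite addrC lerD2l.
right; right; exists (fine (nu (not_full ie ir th Ct rh))), Q, k%:R, y; split => //; split.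
- have := not_full_bound mie mir ir_local ie_left ir_right ie_ge0 ir_ge0 inv_past inv_left
    rh_gt0 th_le T2oo Ct_gt0.
  move=> /le_trans /(_ tau_bound).
  rewrite -(fineK T2fin) -(fineK excess_fin) not_full_prob -EFinM -!EFinD lee_fin.
  by [].
- by rewrite k_ge0 ltW.
- exact: m_ge.
- by rewrite /M -natr1 addrK ltW.
split; first exact: prob_several_le.
have M1 : 1 <= M%:R :> R by rewrite ler1n.
have gap := supporting_line_gap g_rate w_gt0 Ct_gt0 c_ge1 M1.
have BM : B0 <= bits (M%:R * Ct).
  move: om0P => /andP[/andP[_ h] _]; apply: (le_trans h).
  by apply: (bits_of_energy_mono w_gt0 g_mono); [exact: walk_ge0|exact: se_le].
have z0 : 0 <= 1 - c^-1 by rewrite subr_ge0 invf_le1.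
have h1 : (B0 - G) * (1 - c^-1) <= (M%:R - 1) * (G - L).
  by apply: le_trans gap; apply: ler_wpM2r => //; rewrite lerD2r.
have -> : (y - 1) * (1 - c^-1) * rho = (B0 - G) * (1 - c^-1) / L.
  by rewrite /y /rho; field; rewrite !gt_eqF.
have -> : (M%:R - 1) * (rho - 1) = (M%:R - 1) * (G - L) / L.
  by rewrite /rho; field; rewrite !gt_eqF.
by rewrite ler_pM2r ?invr_gt0.
Qed.

(** With low energy: if K < M, the K + 1 rounds number at most M and need no better offline bound;
    otherwise M slots carry at most M * L < B0 bits offline, so one more slot is required. *)
Let k2 : R := if (K < M)%N then M%:R^-1 else M.+1%:R^-1.

Let bound (Phi : path R -> \bar R) om : \bar R :=
  (1 + (event_cost M done_by_M M%:R^-1 (rcost K) om +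
   (event_cost M low_energy k2 (rcost K.+1) om +
   (event_cost M undeliverable M.+1%:R^-1 (rcost K.+1) om +
   (event_cost M one_dump M%:R^-1 rwait om +
   (event_cost M several_dumps M%:R^-1 rwait om + (M%:R^-1)%:E * dumps_cost Phi om))))))%E.

Let k2_ge0 : 0 <= k2. Proof. by rewrite /k2; case: ifP. Qed.

Let cost_ge0 e ka (cost : path R -> \bar R) om : 0 <= ka -> (forall om, 0 <= cost om)%E ->
  (0 <= event_cost M e ka cost om)%E.
Proof. exact: event_cost_ge0. Qed.

Let path_ratio_le (Phi : path R -> \bar R) (PhiR : R) om : tail_cost Phi PhiR ->
  recurrent_paths om -> (path_ratio om <= bound Phi om)%E.
Proof.
move=> [mPhi Phi0 _ hPhi] rec; have recm := recurrentP rec.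
have on0 : (0 <= online_slots w Ct Pr c g B0 (steps ie om) (steps ir om))%E.
  by apply: le_ereal_inf_tmp => _ [n _ <-]; rewrite lee_fin.
have M1 := ltn0Sn m.
have inv0 : 0 <= M%:R^-1 :> R by rewrite invr_ge0 ltW.
have p1 := cost_ge0 done_by_M om inv0 (rcost_ge0 K).
have p2 := cost_ge0 low_energy om k2_ge0 (rcost_ge0 K.+1).
have inv1 : 0 <= M.+1%:R^-1 :> R by [].
have p3 := cost_ge0 undeliverable om inv1 (rcost_ge0 K.+1).
have p4 := cost_ge0 one_dump om inv0 rwait_ge0.
have p5 := cost_ge0 several_dumps om inv0 rwait_ge0.
have p6 : (0 <= (M%:R^-1)%:E * dumps_cost Phi om)%E.
  by rewrite mule_ge0 ?lee_fin// dumps_cost_ge0.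
have la (u v t : \bar R) : (0 <= t)%E -> (u <= v)%E -> (u <= v + t)%E.
  by move=> t0 uv; apply: (le_trans uv); rewrite leeDl.
have ra (u v t : \bar R) : (0 <= t)%E -> (u <= v)%E -> (u <= t + v)%E.
  by move=> t0 uv; apply: (le_trans uv); rewrite leeDr.
have le_rounds := online_le_rounds w_gt0 Ct_gt0 c_ge1 g_mono ie_ge0 ir_ge0 recm
  (K := K.+1) M B0_rounds.
have ratio V D : (M <= D)%N -> (0 <= V)%E ->
    (online_slots w Ct Pr c g B0 (steps ie om) (steps ir om) <= (M%:R)%:E + V)%E ->
    ((D%:R)%:E <= offline_slots w Ct Cr Pr g B0 (steps ie om) (steps ir om))%E ->
    (path_ratio om <= 1 + (D%:R^-1)%:E * V)%E.
  by move=> MD V0 hon hoff; apply: (ratio_le M1 MD V0 on0 hon hoff).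
have [hE|hE] := boolP (enough_energy om); last first.
  have low : low_energy om by [].
  apply: (@le_trans _ _ (1 + k2%:E * rcost K.+1 (shift M om))%E); last first.
    rewrite leeD2l//; apply: (@le_trans _ _ (event_cost M low_energy k2 (rcost K.+1) om)).
      by rewrite /event_cost indicator_true// mul1e.
    apply: (ra _ _ _) => //; apply: (la _ _ _) => //; do ?[apply: adde_ge0 => //].
  rewrite /k2; case: ifPn => KM; first by apply: ratio.
  apply: ratio => //; apply: offline_gt => hM; move/negP: KM; apply.
  have sth : \sum_(i < M) steps ie om i <= th.
    by move: hE; rewrite /enough_energy -ltNge => /ltW.
  have := offline_le_slots w_gt0 Pr_gt0 g_rate th_gt0 (fun i => ie_ge0 _) (or_intror sth) hM.
  by rewrite -/L -ler_pdivrMr// -xE => xM; rewrite -(ltr_nat R) (lt_le_trans K_lt).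
have [hR|hR] := boolP (enough_receiver om).
  have dn : done_by_M om by rewrite /done_by_M hE hR.
  apply: (@le_trans _ _ (1 + (M%:R^-1)%:E * rcost K (shift M om))%E); last first.
    rewrite leeD2l//; apply: (@le_trans _ _ (event_cost M done_by_M M%:R^-1 (rcost K) om)).
      by rewrite /event_cost indicator_true// mul1e.
    apply: (la _ _ _) => //; do ?[apply: adde_ge0 => //].
  apply: ratio => //.
  exact: (online_le_after_round w_gt0 Ct_gt0 c_ge1 g_mono ie_ge0 ir_ge0 recm B0_rounds).
have st : starved om by rewrite /starved hE.
have rM : sr M om < rh by rewrite ltNge.
have [hD|hD] := boolP (deliverable om); last first.
  have ud : undeliverable om by rewrite /undeliverable st.
  apply: (@le_trans _ _ (1 + (M.+1%:R^-1)%:E * rcost K.+1 (shift M om))%E); last first.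
    rewrite leeD2l//.
    apply: (@le_trans _ _ (event_cost M undeliverable M.+1%:R^-1 (rcost K.+1) om)).
      by rewrite /event_cost indicator_true// mul1e.
    do 2![apply: (ra _ _ _) => //]; apply: (la _ _ _) => //; do ?[apply: adde_ge0 => //].
  apply: ratio => //; apply: offline_gt => hM; move/negP: hD; apply.
  apply: (offline_le_total w_gt0 Pr_gt0 g_rate _ _ hM); first exact: lt_le_trans hE.
  exact: ltW.
have [hS|hS] := boolP (dumpable om).
  have od : one_dump om by rewrite /one_dump st hD.
  apply: (@le_trans _ _ (1 + (M%:R^-1)%:E * rwait (shift M om))%E); last first.
    rewrite leeD2l//; apply: (@le_trans _ _ (event_cost M one_dump M%:R^-1 rwait om)).
      by rewrite /event_cost indicator_true// mul1e.
    do 3![apply: (ra _ _ _) => //]; apply: (la _ _ _) => //; do ?[apply: adde_ge0 => //].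
  apply: ratio => //.
  exact: (online_le_receiver_wait w_gt0 Ct_gt0 c_ge1 g_mono ie_ge0 ir_ge0 recm hE rM hS).
have sv : several_dumps om by rewrite /several_dumps st hD.
have CM : Ct <= se M om by have [_ _ /ltW] := several_dumpsP sv.
have on := online_le_after_first w_gt0 Ct_gt0 c_ge1 g_mono ie_ge0 ir_ge0 recm hE rM CM Phi0
  (hPhi _ rec sv).
have dE : after_first w Ct Pr c ie ir M Phi om = dumps_cost Phi om.
  apply: eq_eseriesr => t _; congr (_%:E * _)%E; rewrite !indicE.
  suff -> : (om \in first_met t `&` [set _ | (M < t)%N]) =
    (om \in [set om | several_dumps om] `&` first_met t `&` [set _ | (M < t)%N]) by [].
  by apply/idP/idP; rewrite !inE => -[]; [split|case].
rewrite dE -addeA in on.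
apply: (@le_trans _ _ (1 + (M%:R^-1)%:E * (rwait (shift M om) + dumps_cost Phi om))%E).
  by apply: ratio => //; rewrite adde_ge0// dumps_cost_ge0.
rewrite leeD2l// ge0_muleDr//; last exact: dumps_cost_ge0.
rewrite {1}[X in (X + _ <= _)%E](_ : _ = event_cost M several_dumps M%:R^-1 rwait om); last first.
  by rewrite /event_cost indicator_true// mul1e.
by do 4![apply: (ra _ _ _) => //].
Qed.

Let rho_M : rho * y <= rho * M%:R.
Proof. by rewrite ler_pM2l// (lt_le_trans ltr01). Qed.

Let rate_done : M%:R^-1 * (K%:R * N) <= rho * N.
Proof.
rewrite mulrA; apply: ler_wpM2r => //; rewrite ler_pdivrMl// mulrC.
exact: ltW (lt_le_trans K_lt rho_M).
Qed.

Let rate_undeliverable : M.+1%:R^-1 * (K.+1%:R * N) <= rho * N.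
Proof.
rewrite mulrA; apply: ler_wpM2r => //; rewrite ler_pdivrMl ?ltr0n// mulrC.
rewrite -natr1 -[M.+1%:R]natr1 mulrDr mulr1; apply: lerD => //.
exact: ltW (lt_le_trans K_lt rho_M).
Qed.

Let rate_low : k2 * (K.+1%:R * N) <= rho * N.
Proof.
rewrite /k2; case: ifPn => [KM|_]; last exact: rate_undeliverable.
rewrite mulrA; apply: ler_wpM2r => //; rewrite ler_pdivrMl//.
apply: (@le_trans _ _ M%:R); first by rewrite ler_nat.
by rewrite ler_peMr// ltW.
Qed.

Let rate_one : M%:R^-1 * N2 <= rho * N.
Proof.
have h : N2 <= N by rewrite /N lerDl.
rewrite ler_pdivrMl//; apply: (le_trans h); rewrite mulrA ler_peMl//.
by rewrite -[leLHS]mulr1; apply: ler_pM => //; rewrite ?ler1n.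
Qed.

(** A measurable majorant is needed, not just a bound on the integral, so that the result can be
    carried back to the original probability space. *)
Lemma path_ratio_bound : exists W : path R -> \bar R,
  [/\ measurable_fun [set: path R] W, forall om, (0 <= W om)%E,
      forall om, recurrent_paths om -> (path_ratio om <= W om)%E &
      (\int[nu]_om W om <= (rho * (a + b))%:E)%E].
Proof.
have [Phi [PhiR [tc alt]]] := dumps_alternative.
have [mPhi Phi0 iPhi _] := tc.
have inv0 : 0 <= M%:R^-1 :> R by rewrite invr_ge0 ltW.
have inv1 : 0 <= M.+1%:R^-1 :> R by [].
have p1 om := cost_ge0 done_by_M om inv0 (rcost_ge0 K).
have p2 om := cost_ge0 low_energy om k2_ge0 (rcost_ge0 K.+1).
have p3 om := cost_ge0 undeliverable om inv1 (rcost_ge0 K.+1).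
have p4 om := cost_ge0 one_dump om inv0 rwait_ge0.
have p5 om := cost_ge0 several_dumps om inv0 rwait_ge0.
have p6 om : (0 <= (M%:R^-1)%:E * dumps_cost Phi om)%E.
  by rewrite mule_ge0 ?lee_fin// dumps_cost_ge0.
have m1 := measurable_event_cost M M%:R^-1 m_done (m_rcost K).
have m2 := measurable_event_cost M k2 m_low (m_rcost K.+1).
have m3 := measurable_event_cost M M.+1%:R^-1 m_undeliverable (m_rcost K.+1).
have m4 := measurable_event_cost M M%:R^-1 m_one m_rwait.
have m5 := measurable_event_cost M M%:R^-1 m_several m_rwait.
have m6 : measurable_fun [set: path R] (fun om => (M%:R^-1)%:E * dumps_cost Phi om)%E.
  by apply: emeasurable_funM => //; exact: m_dumps_cost.
have i1 := integral_event_cost inv_past m_done (m_rcost K) (rcost_ge0 K) inv0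
  (@adapted_walks (fun u v => (th <= u) && (rh <= v))) (integral_rcost K) rate_done.
have i2 := integral_event_cost inv_past m_low (m_rcost K.+1) (rcost_ge0 K.+1) k2_ge0
  (@adapted_walks (fun u v => ~~ (th <= u))) (integral_rcost K.+1) rate_low.
have i3 := integral_event_cost inv_past m_undeliverable (m_rcost K.+1) (rcost_ge0 K.+1) inv1
  (@adapted_walks (fun u v => ((th <= u) && ~~ (rh <= v)) && ~~ (B0 <= bits u)))
  (integral_rcost K.+1) rate_undeliverable.
have iw : (\int[nu]_om rwait om <= N2%:E)%E by rewrite integral_rwait.
have i4 := integral_event_cost inv_past m_one m_rwait rwait_ge0 inv0
  (@adapted_walks (fun u v => (((th <= u) && ~~ (rh <= v)) && (B0 <= bits u)) &&
     (B0 <= bits (Num.min Ct u)))) iw rate_one.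
have i5 := integral_event_cost inv_past m_several m_rwait rwait_ge0 inv0
  (@adapted_walks (fun u v => (((th <= u) && ~~ (rh <= v)) && (B0 <= bits u)) &&
     ~~ (B0 <= bits (Num.min Ct u)))) iw (lexx _).
have i6 : (\int[nu]_om ((M%:R^-1)%:E * dumps_cost Phi om) <=
    (M%:R^-1 * (prob several_dumps * PhiR))%:E)%E.
  rewrite ge0_integralZl//; last 2 first.
  - exact: m_dumps_cost.
  - by move=> om _; exact: dumps_cost_ge0.
  rewrite EFinM; apply: lee_wpmul2l; first by rewrite lee_fin.
  exact: integral_dumps_cost.
have q5 om := adde_ge0 (p5 om) (p6 om).
have q4 om := adde_ge0 (p4 om) (q5 om).
have q3 om := adde_ge0 (p3 om) (q4 om).
have q2 om := adde_ge0 (p2 om) (q3 om).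
have q1 om := adde_ge0 (p1 om) (q2 om).
have n5 := emeasurable_funD m5 m6.
have n4 := emeasurable_funD m4 n5.
have n3 := emeasurable_funD m3 n4.
have n2 := emeasurable_funD m2 n3.
have n1 := emeasurable_funD m1 n2.
exists (bound Phi); split.
- exact: (emeasurable_funD (measurable_cst 1%E) n1).
- by move=> om; rewrite adde_ge0.
- by move=> om rec; exact: (path_ratio_le tc rec).
rewrite ge0_integralD// ge0_integralD// ge0_integralD// ge0_integralD// ge0_integralD//.
rewrite ge0_integralD// integral_cst// [X in (1 * X + _)%E]probability_setT mule1.
apply: (@le_trans _ _ (1%:E + ((prob done_by_M)%:E * (rho * N)%:E +
  ((prob low_energy)%:E * (rho * N)%:E + ((prob undeliverable)%:E * (rho * N)%:E +
  ((prob one_dump)%:E * (rho * N)%:E + ((prob several_dumps)%:E * (M%:R^-1 * N2)%:E +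
   (M%:R^-1 * (prob several_dumps * PhiR))%:E))))))%E).
  rewrite -!probE// leeD2l// leeD// leeD// leeD// leeD// leeD//.
rewrite -!EFinM -!EFinD lee_fin.
have arith := @expected_ratio_arith R rho M%:R N N2 X a b tau (1 - c^-1) (Ct / mE)
  (prob several_dumps) PhiR.
have ps : prob done_by_M + prob low_energy + prob undeliverable + prob one_dump =
  1 - prob several_dumps by move: prob_split; lra.
have p01 : 0 <= prob several_dumps <= 1.
  rewrite prob_ge0/= -subr_ge0 -ps; by rewrite !addr_ge0 ?prob_ge0.
apply: le_trans (arith _ _ _ _ _ _ _ p01 _ _ tauE alt) => //.
- rewrite -ps; lra.
- by rewrite ler1n.
- by rewrite -lee_fin fineK.
- by rewrite -lee_fin EFinD fineK// (le_trans excess_le).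
- by rewrite divr_ge0// ltW.
- by rewrite subr_ge0 invf_le1.
Qed.

End PathTheorem.

(* Clipping makes the range constraints, which hold almost surely, hold everywhere. *)
Definition clip {R : realType} (C x : R) : R := Num.max 0 (Num.min C x).

(** * Clipped arrivals and consequences of a bounded density *)

Section Clip.
Context {R : realType}.
Variable C : R.
Hypothesis C_gt0 : 0 < C.

Lemma clip_ge0 x : 0 <= clip C x. Proof. by rewrite le_max lexx. Qed.

Lemma clip_le x : clip C x <= C.
Proof. by rewrite ge_max ltW//= ge_min lexx. Qed.

Lemma clip_id x : 0 <= x <= C -> clip C x = x.
Proof. by move=> /andP[x0 xC]; rewrite /clip min_r// max_r. Qed.

Lemma measurable_clip : measurable_fun [set: R] (clip C).
Proof. by apply: measurable_maxr => //; exact: measurable_minr. Qed.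

Lemma le_clip gamma x : 0 < gamma -> gamma <= C -> (gamma <= clip C x) = (gamma <= x).
Proof. by move=> g0 gC; rewrite le_max le_min gC/= leNgt g0. Qed.

End Clip.

Lemma measure0_sub_setU d (T : measurableType d) (R : realType)
    (mu : {measure set T -> \bar R}) (A B D : set T) :
  measurable A -> measurable B -> measurable D -> mu A = 0%E -> mu B = 0%E ->
  D `<=` A `|` B -> mu D = 0%E.
Proof.
move=> mA mB mD A0 B0 DAB.
by apply: subset_measure0 DAB _ => //; [exact: measurableU|exact: null_set_setU].
Qed.

Section BoundedDensity.
Local Open Scope ereal_scope.
Context {R : realType} {d : measure_display} {T : measurableType d}.
Variables (P : probability T R) (Y : {RV P >-> R}) (f : R -> R) (C : R).
Hypothesis C_gt0 : (0 < C)%R.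
Hypothesis f_density : density_on C f.
Hypothesis Y_law : has_density P Y f.

Lemma has_density_outside (A : set R) : measurable A ->
  (forall x, A x -> x < 0 \/ C < x)%R -> P (Y @^-1` A) = 0.
Proof.
move=> mA hA; rewrite Y_law//; apply: integral0_eq => x /hA h.
by rewrite (density_support f_density h).
Qed.

Lemma has_density_point (x : R) : P (Y @^-1` [set x]) = 0.
Proof. by rewrite Y_law// integral_set1. Qed.

Definition out_of_range : set T := Y @^-1` (~` `[0%R, C]%classic).

Lemma measurable_preimage_RV (A : set R) : measurable A -> measurable (Y @^-1` A).
Proof. by move=> mA; rewrite -[_ @^-1` _]setTI; exact: measurable_funPT. Qed.

Lemma measurable_out_of_range : measurable out_of_range.
Proof. by apply: measurable_preimage_RV; apply: measurableC; exact: measurable_itv. Qed.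

Lemma out_of_range_null : P out_of_range = 0.
Proof.
apply: has_density_outside; first by apply: measurableC; exact: measurable_itv.
move=> x /negP; rewrite in_itv/= negb_and -!ltNge => /orP[]; [by left|by right].
Qed.

Lemma in_range om : ~ out_of_range om -> (0 <= Y om <= C)%R.
Proof. by move=> /contrapT; rewrite /= in_itv. Qed.

Lemma measurable_clip_RV : measurable_fun [set: T] (fun om => clip C (Y om)).
Proof. exact: (measurableT_comp (measurable_clip C)). Qed.

Lemma clip_ae_eq (D : set T) : ae_eq P D (fun om => (clip C (Y om))%:E) (fun om => (Y om)%:E).
Proof.
exists out_of_range; split; [exact: measurable_out_of_range|exact: out_of_range_null|].
move=> om /= h; apply: contrapT => /in_range h'; apply: h => _.
by rewrite clip_id.
Qed.

Lemma integral_clip_in (D : set T) : measurable D ->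
  \int[P]_(om in D) (clip C (Y om))%:E = \int[P]_(om in D) (Y om)%:E.
Proof.
move=> mD; apply: ae_eq_integral => //.
- by apply/measurable_EFinP; apply: measurable_funTS; exact: measurable_clip_RV.
- by apply/measurable_EFinP; exact: measurable_funTS.
- exact: clip_ae_eq.
Qed.

Lemma integral_clip : \int[P]_om (clip C (Y om))%:E = (mean P Y)%:E.
Proof.
rewrite /mean unlock fineK; first exact: integral_clip_in.
rewrite -integral_clip_in// ge0_fin_numE; last first.
  by apply: integral_ge0 => om _; rewrite lee_fin clip_ge0.
apply: (@le_lt_trans _ _ (\int[P]_om C%:E)).
  apply: ge0_le_integral_nonmeasurable => om; rewrite lee_fin ?clip_ge0//.
  exact: clip_le.
by rewrite integral_cst// [X in _ * X]probability_setT mule1 ltry.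
Qed.

(** A law with a density has no atom at 0, so arrivals are almost surely positive. *)
Lemma mean_gt0 : (0 < mean P Y)%R.
Proof.
have m0 : (0 <= mean P Y)%R.
  by rewrite -lee_fin -integral_clip; apply: integral_ge0 => om _; rewrite lee_fin clip_ge0.
rewrite lt_neqAle m0 andbT; apply/eqP => mE.
have : \int[P]_om `|(clip C (Y om))%:E| = 0.
  rewrite -[0]/(0%R%:E) mE -integral_clip; apply: eq_integral => om _.
  by rewrite gee0_abs// lee_fin clip_ge0.
move=> /ae_eq_integral_abs h; have {h} : ae_eq P setT (fun om => (clip C (Y om))%:E) (cst 0).
  by apply: h => //; apply/measurable_EFinP; exact: measurable_clip_RV.
move=> [N [mN N0 hN]].
have mneg : measurable (Y @^-1` `]-oo, 0%R[%classic).
  by apply: measurable_preimage_RV; exact: measurable_itv.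
have mpt : measurable (Y @^-1` [set 0%R]) by exact: measurable_preimage_RV.
have mle : measurable (Y @^-1` `]-oo, 0%R]%classic).
  by apply: measurable_preimage_RV; exact: measurable_itv.
have neg0 : P (Y @^-1` `]-oo, 0%R[%classic) = 0.
  apply: has_density_outside; first exact: measurable_itv.
  by move=> x /=; rewrite in_itv/=; left.
have le0 : P (Y @^-1` `]-oo, 0%R]%classic) = 0.
  apply: (measure0_sub_setU mneg mpt mle neg0 (has_density_point 0)) => om /=.
  by rewrite !in_itv/= le_eqVlt => /orP[/eqP|]; [right|left].
have : P setT = 0.
  apply: (measure0_sub_setU mN mle measurableT N0 le0) => om _.
  have [h|h] := ltP 0%R (Y om); last by right; rewrite /= in_itv.
  left; apply: hN => /= /(_ I) [] /eqP; apply/negP.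
  by rewrite gt_eqF// lt_max lt_min C_gt0 h orbT.
by rewrite probability_setT => /eqP; rewrite onee_eq0.
Qed.

Lemma clip_mean_residual : bounded_mean_residual P Y C ->
  forall gamma, (0 < gamma)%R ->
  \int[P]_(om in [set om | (gamma <= clip C (Y om))%R]) (clip C (Y om))%:E <=
  (gamma + mean P Y)%:E * P [set om | (gamma <= clip C (Y om))%R].
Proof.
move=> res gamma g0; set A := [set om | _].
have mA : measurable A.
  rewrite -[A]setTI.
  exact: (measurable_fun_ler (measurable_cst gamma) measurable_clip_RV) measurableT [set true] _.
have [PA0|PA0] := eqVneq (P A) 0.
  by rewrite PA0 mule0 null_set_integral// ; apply/measurable_EFinP;
    apply: measurable_funTS; exact: measurable_clip_RV.
(* At a level gamma >= C the event is, up to a null set, contained in Y = C, which is null as there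
   are no atoms. *)
have gC : (gamma < C)%R.
  rewrite ltNge; apply/negP => Cg; move/negP: PA0; apply; apply/eqP.
  have mpt : measurable (Y @^-1` [set C]) by exact: measurable_preimage_RV.
  apply: (measure0_sub_setU measurable_out_of_range mpt mA out_of_range_null
    (has_density_point C)) => om; rewrite /A/= => h.
  have [out|/in_range i] := pselect (out_of_range om); first by left.
  right; rewrite clip_id// in h.
  by apply/eqP; rewrite eq_le (le_trans Cg h) andbT; case/andP: i.
have eqA : A = [set om | (gamma <= Y om)%R].
  by apply/seteqP; split => om; rewrite /A/= le_clip// ltW.
have PAgt0 : 0 < P A by rewrite lt0e PA0 measure_ge0.
have Pfin : P A \is a fin_num by exact: fin_num_measure.
have If : \int[P]_(om in A) (Y om)%:E \is a fin_num.
  rewrite -integral_clip_in// ge0_fin_numE; last first.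
    by apply: integral_ge0 => om _; rewrite lee_fin clip_ge0.
  apply: (@le_lt_trans _ _ (\int[P]_om (clip C (Y om))%:E)).
    apply: ge0_subset_integral => //.
      by apply/measurable_EFinP; exact: measurable_clip_RV.
    by move=> om _; rewrite lee_fin clip_ge0.
  by rewrite integral_clip ltry.
have := res gamma (ltW g0) gC; rewrite -eqA => /(_ PAgt0).
rewrite /cond_mean ler_pdivrMr; last by rewrite fine_gt0// PAgt0 ltey_eq Pfin.
by rewrite integral_clip_in// -lee_fin EFinM (fineK Pfin) /Rintegral (fineK If).
Qed.

End BoundedDensity.

Lemma integral_le_off_null d (T : measurableType d) (R : realType)
    (mu : {measure set T -> \bar R}) (N : set T) (f h : T -> \bar R) :
  measurable N -> mu N = 0%E -> measurable_fun [set: T] h ->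
  (forall x, 0 <= f x)%E -> (forall x, 0 <= h x)%E ->
  (forall x, ~ N x -> (f x <= h x)%E) ->
  (\int[mu]_x f x <= \int[mu]_x h x)%E.
Proof.
move=> mN N0 mh f0 h0 fh.
(* Since f may fail to be measurable, the inequality is first made to hold everywhere, by raising h
   to infinity on the null set. *)
pose h' x := (h x + +oo * (\1_N x)%:E)%E.
have m1 : measurable_fun [set: T] (fun x => +oo * (\1_N x)%:E : \bar R)%E.
  apply: emeasurable_funM => //; apply/measurable_EFinP; exact: measurable_indic.
have p1 x : (0 <= +oo * (\1_N x)%:E :> \bar R)%E by rewrite mule_ge0 ?lee_fin.
apply: (@le_trans _ _ (\int[mu]_x h' x)%E).
  apply: ge0_le_integral_nonmeasurable => // x; rewrite /h' indicE.
  case: (boolP (x \in N)) => xN.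
    by rewrite mule1 addey ?leey// gt_eqF// (lt_le_trans _ (h0 x))// ltNyr.
  by rewrite mule0 adde0 fh//; move: xN; rewrite notin_setE.
rewrite le_eqVlt; apply/orP; left; apply/eqP.
apply: ge0_ae_eq_integral => //.
- exact: emeasurable_funD.
- by move=> x _; exact: adde_ge0.
exists N; split => // x /= hx; apply: contrapT => xN; apply: hx => _.
by rewrite /h' indicE memNset// mule0 adde0.
Qed.

(** * Transfer to the arrival processes of the model *)

Section Model.
Context {R : realType} {d : measure_display} {T : measurableType d}.
Variables (P : probability T R) (w Ct Cr Pr B0 c : R) (g f h : R -> R).
Variables (E Rv : nat -> {RV P >-> R}).
Hypothesis w_gt0 : 0 < w.
Hypothesis Ct_gt0 : 0 < Ct.
Hypothesis Cr_gt0 : 0 < Cr.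
Hypothesis Pr_gt0 : 0 < Pr.
Hypothesis B0_gt0 : 0 < B0.
Hypothesis c_ge1 : 1 <= c.
Hypothesis g_rate : rate_function g.
Hypothesis f_density : density_on Ct f.
Hypothesis h_density : density_on Cr h.
Hypothesis E_law : forall i, has_density P (E i) f.
Hypothesis Rv_law : forall i, has_density P (Rv i) h.
Hypothesis indep : mutually_independent P (joint_family E Rv).

Definition arrivals (i : nat + nat) : {mfun T >-> R} :=
  match i with inl j => E j | inr j => Rv j end.

Notation nu := (law P arrivals).
Notation traj := (trajectory arrivals).

Definition energy_step (om : path R) : R := clip Ct (om (inl 0%N)).
Definition receiver_step (om : path R) : R := clip Cr (om (inr 0%N)).

Let arrivals_indep : mutually_independent P (arrivals : nat + nat -> T -> R).
Proof.
have -> : (arrivals : nat + nat -> T -> R) = joint_family E Rv by apply/funext => -[].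
exact: indep.
Qed.

Let inv_past n : reindex_invariant nu (before n) (past_future n).
Proof.
apply: (law_reindex arrivals_indep).
- by move=> i j; rewrite /in_mem /= /past_future => -> ->.
- have sub_inj i j : (n <= i)%N -> (n <= j)%N -> (i - n = j - n)%N -> i = j.
    by move=> ni nj e; rewrite -(subnK ni) -(subnK nj) e.
  move=> [i|i] [j|j]; rewrite /in_mem /= /past_future /before/= -!leqNgt => ni nj;
  rewrite !ltnNge ni nj //= => -[] e; congr (_ _); exact: sub_inj.
move=> i A mA; rewrite /past_future; case: ifP => // _.
by case: i => i /=; [rewrite !E_law|rewrite !Rv_law].
Qed.

Let inv_left : reindex_invariant nu is_left id.
Proof. by apply: (law_reindex arrivals_indep) => // i j _ _. Qed.

Let mE : measurable_fun [set: path R] energy_step.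
Proof. exact: (measurableT_comp (measurable_clip Ct) (measurable_coord _)). Qed.

Let mR : measurable_fun [set: path R] receiver_step.
Proof. exact: (measurableT_comp (measurable_clip Cr) (measurable_coord _)). Qed.

Let integral_law (F : path R -> \bar R) : measurable_fun [set: path R] F ->
  (forall om, 0 <= F om)%E -> (\int[nu]_om F om = \int[P]_om F (traj om))%E.
Proof.
move=> mF F0; exact: (@ge0_integral_pushforward _ _ _ _ _ _ (measurable_trajectory arrivals)).
Qed.

Let integral_energy : (\int[nu]_om (energy_step om)%:E = (mean P (E 0%N))%:E)%E.
Proof.
rewrite integral_law; first exact: (integral_clip Ct_gt0 f_density (E_law 0)).
- exact/measurable_EFinP.
- by move=> om; rewrite lee_fin clip_ge0.
Qed.

Let integral_receiver : (\int[nu]_om (receiver_step om)%:E = (mean P (Rv 0%N))%:E)%E.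
Proof.
rewrite integral_law; first exact: (integral_clip Cr_gt0 h_density (Rv_law 0)).
- exact/measurable_EFinP.
- by move=> om; rewrite lee_fin clip_ge0.
Qed.

Let bad : set T := (\bigcup_i out_of_range (E i) Ct) `|` (\bigcup_i out_of_range (Rv i) Cr) `|`
  traj @^-1` (~` recurrent_paths energy_step receiver_step w Ct Pr c).

Let path_ratioE om : ~ bad om ->
  (online_slots w Ct Pr c g B0 (E ^~ om) (Rv ^~ om) /
   offline_slots w Ct Cr Pr g B0 (E ^~ om) (Rv ^~ om))%E =
  path_ratio energy_step receiver_step w Ct Cr Pr B0 c g (traj om).
Proof.
move=> nb; have eE : E ^~ om = steps energy_step (traj om).
  apply/funext => i; rewrite /steps /energy_step /shift /= /trajectory addn0 clip_id//.
  have nout : ~ out_of_range (E i) Ct om by move=> o; apply: nb; left; left; exists i.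
  exact: in_range nout.
have eR : Rv ^~ om = steps receiver_step (traj om).
  apply/funext => i; rewrite /steps /receiver_step /shift /= /trajectory addn0 clip_id//.
  have nout : ~ out_of_range (Rv i) Cr om by move=> o; apply: nb; left; right; exists i.
  exact: in_range nout.
by rewrite /path_ratio -eE -eR.
Qed.

Let energy_local : forall om om' : path R,
  (forall i, (time i < 1)%N -> om i = om' i) -> energy_step om = energy_step om'.
Proof. by move=> om om' e; rewrite /energy_step e. Qed.

Let receiver_local : forall om om' : path R,
  (forall i, (time i < 1)%N -> om i = om' i) -> receiver_step om = receiver_step om'.
Proof. by move=> om om' e; rewrite /receiver_step e. Qed.

Let energy_ge0 om : 0 <= energy_step om. Proof. exact: clip_ge0. Qed.
Let receiver_ge0 om : 0 <= receiver_step om. Proof. exact: clip_ge0. Qed.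
Let energy_le om : energy_step om <= Ct. Proof. exact: clip_le. Qed.
Let receiver_le om : receiver_step om <= Cr. Proof. exact: clip_le. Qed.

Let meanE_gt0 : 0 < mean P (E 0%N). Proof. exact: (mean_gt0 Ct_gt0 f_density (E_law 0)). Qed.
Let meanR_gt0 : 0 < mean P (Rv 0%N). Proof. exact: (mean_gt0 Cr_gt0 h_density (Rv_law 0)). Qed.

Let null_bigcup (A : nat -> set T) : (forall i, measurable (A i)) -> (forall i, P (A i) = 0%E) ->
  P (\bigcup_i A i) = 0%E.
Proof.
move=> mA A0; apply/eqP; rewrite eq_le measure_ge0 andbT.
have mU := bigcupT_measurable _ mA.
apply: (le_trans (measure_sigma_subadditive P mA mU (@subset_refl _ _))).
by rewrite le_eqVlt; apply/orP; left; apply/eqP; apply: eseries0 => i _ _; exact: A0.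
Qed.

(** The relation between tau and b holds in both regimes because a passage to level l is bounded by
    (l + overshoot) / mean with the same overshoot, [Ct] or one mean, at Ct / c and at Ct. *)
Lemma expected_ratio_le (a b tau : R) :
  (passage receiver_step nu (Pr * w) <= a%:E)%E ->
  (passage energy_step nu (Ct / c) <= b%:E)%E ->
  (passage energy_step nu Ct <= tau%:E)%E ->
  tau = b + (1 - c^-1) * (Ct / mean P (E 0%N)) ->
  (expected_ratio P w Ct Cr Pr c g B0 E Rv <=
    ((a + b) * (g (Ct / w) / g (Ct / (c * w))))%:E)%E.
Proof.
move=> ha hb htau tauE.
pose G := bits_of_energy w g Ct; pose L := bits_of_energy w g (Ct / c).
have c_gt0 : 0 < c by exact: lt_le_trans c_ge1.
have G0 : 0 < G by rewrite mulr_gt0// (rate_gt0 g_rate)// divr_gt0.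
have L0 : 0 < L by rewrite mulr_gt0// (rate_gt0 g_rate)// !divr_gt0.
have y0 : 0 < B0 / G by rewrite divr_gt0.
have x0 : 0 < G / L * (B0 / G) by rewrite mulr_gt0// divr_gt0.
have [m [m_lt m_ge]] := nat_ceil y0.
have [K [K_lt K_ge]] := nat_ceil x0.
have [W [mW W0 hW iW]] := path_ratio_bound Cr w_gt0 Ct_gt0 Pr_gt0 B0_gt0 c_ge1 g_rate mE mR
  energy_local receiver_local (fun om om' e => congr1 (clip Ct) (e 0%N))
  (fun om om' e => congr1 (clip Cr) (e 0%N)) energy_ge0 receiver_ge0 energy_le inv_past inv_left
  meanE_gt0 integral_energy ha hb htau tauE m_lt m_ge K_lt K_ge.
have rec0 := recurrent_paths_full w_gt0 Ct_gt0 Pr_gt0 c_ge1 mE mR inv_past ha hb.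
have mrec := measurable_recurrent_paths w Ct Pr c mE mR.
have mbad1 : measurable (\bigcup_i out_of_range (E i) Ct).
  by apply: bigcupT_measurable => i; exact: measurable_out_of_range.
have mbad2 : measurable (\bigcup_i out_of_range (Rv i) Cr).
  by apply: bigcupT_measurable => i; exact: measurable_out_of_range.
have mbad3 : measurable (traj @^-1` (~` recurrent_paths energy_step receiver_step w Ct Pr c)).
  rewrite -[_ @^-1` _]setTI; apply: (measurable_trajectory arrivals) => //.
  exact: measurableC.
have mbad12 : measurable ((\bigcup_i out_of_range (E i) Ct) `|` (\bigcup_i out_of_range (Rv i) Cr)).
  exact: measurableU.
have mbad : measurable bad by exact: measurableU.
have bad0 : P bad = 0%E.
  apply: null_set_setU => //; apply: null_set_setU => //; apply: null_bigcup => i.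
  - exact: measurable_out_of_range.
  - exact: (out_of_range_null f_density (E_law i)).
  - exact: measurable_out_of_range.
  - exact: (out_of_range_null h_density (Rv_law i)).
apply: (@le_trans _ _ (\int[P]_om W (traj om))%E).
  apply: (integral_le_off_null mbad bad0) => //.
  - exact: (measurableT_comp mW (measurable_trajectory arrivals)).
  - move=> om; rewrite mule_ge0 ?inve_ge0//; apply: le_ereal_inf_tmp => _ [n _ <-];
    by rewrite lee_fin.
  - move=> om nb; rewrite path_ratioE//; apply: hW.
    by apply: contrapT => nr; apply: nb; right.
rewrite -integral_law//; apply: (le_trans iW).
rewrite lee_fin le_eqVlt; apply/orP; left; apply/eqP.
have -> : Ct / (c * w) = Ct / c / w by rewrite invfM mulrA.
by rewrite mulrC /bits_of_energy -mulf_div divff ?mul1r ?gt_eqF.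
Qed.

Lemma expected_ratio_bounded :
  (expected_ratio P w Ct Cr Pr c g B0 E Rv <=
     (((Cr + Pr * w) / mean P (Rv 0%N) + (Ct + Ct / c) / mean P (E 0%N))
      * (g (Ct / w) / g (Ct / (c * w))))%:E)%E.
Proof.
have c_gt0 : 0 < c by exact: lt_le_trans c_ge1.
have Prw0 : 0 < Pr * w by rewrite mulr_gt0.
have Ctc0 : 0 < Ct / c by rewrite divr_gt0.
rewrite [Cr + _]addrC [Ct + _]addrC.
apply: (@expected_ratio_le _ _ ((Ct + Ct) / mean P (E 0%N))).
- exact: (passage_le_bounded mR receiver_local receiver_ge0 inv_past (ltW Prw0) (ltW Cr_gt0)
    meanR_gt0 receiver_le integral_receiver).
- exact: (passage_le_bounded mE energy_local energy_ge0 inv_past (ltW Ctc0) (ltW Ct_gt0)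
    meanE_gt0 energy_le integral_energy).
- exact: (passage_le_bounded mE energy_local energy_ge0 inv_past (ltW Ct_gt0) (ltW Ct_gt0)
    meanE_gt0 energy_le integral_energy).
- by ring.
Qed.

Let mean_residual_law i C (step := fun om : path R => clip C (om i)) :
  measurable_fun [set: path R] step -> (forall om, 0 <= step om) ->
  (forall gamma, 0 < gamma ->
    (\int[P]_(om in [set om | (gamma <= clip C (arrivals i om))%R])
        (clip C (arrivals i om))%:E <=
      (gamma + mean P (arrivals i))%:E *
        P [set om | (gamma <= clip C (arrivals i om))%R])%E) ->
  forall gamma, 0 < gamma ->
    (\int[nu]_(om in [set om | (gamma <= step om)%R]) (step om)%:E <=
      (gamma + mean P (arrivals i))%:E * nu [set om | (gamma <= step om)%R])%E.
Proof.
move=> mstep step0 res gamma g0; have := res gamma g0.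
have mA : measurable [set om : path R | (gamma <= step om)%R].
  rewrite -[mkset _]setTI.
  exact: (measurable_fun_ler (measurable_cst gamma) mstep) measurableT [set true] _.
rewrite (@ge0_integral_pushforward _ _ _ _ _ _ (measurable_trajectory arrivals))//.
- by apply/measurable_EFinP; apply: measurable_funTS.
- by move=> om _; rewrite lee_fin.
Qed.

Lemma expected_ratio_residual :
  bounded_mean_residual P (E 0%N) Ct -> bounded_mean_residual P (Rv 0%N) Cr ->
  (expected_ratio P w Ct Cr Pr c g B0 E Rv <=
     ((Pr * w / mean P (Rv 0%N) + (Ct / c) / mean P (E 0%N) + 2)
      * (g (Ct / w) / g (Ct / (c * w))))%:E)%E.
Proof.
move=> resE resR.
have c_gt0 : 0 < c by exact: lt_le_trans c_ge1.
have Prw0 : 0 < Pr * w by rewrite mulr_gt0.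
have Ctc0 : 0 < Ct / c by rewrite divr_gt0.
have {}resE := mean_residual_law (i := inl 0%N) mE energy_ge0
  (clip_mean_residual Ct_gt0 f_density (E_law 0) resE).
have {}resR := mean_residual_law (i := inr 0%N) mR receiver_ge0
  (clip_mean_residual Cr_gt0 h_density (Rv_law 0) resR).
have -> : Pr * w / mean P (Rv 0%N) + (Ct / c) / mean P (E 0%N) + 2 =
    (Pr * w / mean P (Rv 0%N) + 1) + ((Ct / c) / mean P (E 0%N) + 1) by ring.
apply: (@expected_ratio_le _ _ (Ct / mean P (E 0%N) + 1)).
- exact: (passage_le_residual mR receiver_local receiver_ge0 inv_past (ltW meanR_gt0) resR
    meanR_gt0 integral_receiver Prw0).
- exact: (passage_le_residual mE energy_local energy_ge0 inv_past (ltW meanE_gt0) resE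
    meanE_gt0 integral_energy Ctc0).
- exact: (passage_le_residual mE energy_local energy_ge0 inv_past (ltW meanE_gt0) resE
    meanE_gt0 integral_energy Ct_gt0).
- by ring.
Qed.

End Model.

Theorem theorem7 (R : realType) (d : measure_display) (T : measurableType d)
    (P : probability T R) (w Ct Cr Pr B0 c : R) (g f h : R -> R)
    (E Rv : nat -> {RV P >-> R})
    (w_gt0 : 0 < w) (Ct_gt0 : 0 < Ct) (Cr_gt0 : 0 < Cr) (Pr_gt0 : 0 < Pr)
    (B0_gt0 : 0 < B0) (c_ge1 : 1 <= c) (g_rate : rate_function g)
    (f_density : density_on Ct f) (h_density : density_on Cr h)
    (E_law : forall i, has_density P (E i) f)
    (Rv_law : forall i, has_density P (Rv i) h)
    (indep : mutually_independent P (joint_family E Rv)) :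
  (expected_ratio P w Ct Cr Pr c g B0 E Rv <=
     (((Cr + Pr * w) / mean P (Rv 0%N) + (Ct + Ct / c) / mean P (E 0%N))
      * (g (Ct / w) / g (Ct / (c * w))))%:E)%E
  /\
  (bounded_mean_residual P (E 0%N) Ct ->
   bounded_mean_residual P (Rv 0%N) Cr ->
   (expected_ratio P w Ct Cr Pr c g B0 E Rv <=
     ((Pr * w / mean P (Rv 0%N) + (Ct / c) / mean P (E 0%N) + 2)
      * (g (Ct / w) / g (Ct / (c * w))))%:E)%E).
Proof.
split; first exact: (expected_ratio_bounded w_gt0 Ct_gt0 Cr_gt0 Pr_gt0 B0_gt0 c_ge1 g_rate
  f_density h_density E_law Rv_law indep).
exact: (expected_ratio_residual w_gt0 Ct_gt0 Cr_gt0 Pr_gt0 B0_gt0 c_ge1 g_rate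
  f_density h_density E_law Rv_law indep).
Qed.
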